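(* Let $n\geq 2$, let $\pi:\widetilde{\mathcal{N}}_1\to\mathcal{N}_1$ be the Springer resolution of the odd nilpotent cone of $\mathfrak{osp}(2n+1,2n)$, and let $X$ be in the orbit $\mathcal{O}_3\subset\mathcal{N}_1$. The reduced fiber $\pi^{-1}(X)_{\mathrm{red}}$ is the union of $2n-2$ irreducible components $(C_i)_{1\le i\le n-1}$ and $(S_i)_{1\le i\le n-1}$ such that - the components $(C_i)_{1\le i\le n-1}$ are isomorphic to $\mathbb{P}^1$; - the components $(S_i)_{1\le i\le n-1}$ are isomorphic to the blow-up of $\mathbb{P}^2$ in two distinct points; - the components $(C_i)_{1\le i\le n-1}$ form a chain; - the components $(S_i)_{1\le i\le n-1}$ form a chain, two (consecutive) components intersecting along a $\mathbb{P}^1$; - the two chains intersect each other in a point on $C_{n-1}\cap S_{n-1}$.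
   Context: We work over $\mathbb{C}$. Let $V=V_0\oplus V_1$ be a $\mathbb{Z}/2\mathbb{Z}$-graded vector space with $\dim V_0=2n+1$, $\dim V_1=2n$, equipped with a bilinear form $B$ for which $V_0$ and $V_1$ are orthogonal, and whose restrictions $\varphi:V_0\to V_0^\vee$ and $\psi:V_1\to V_1^\vee$ are non-degenerate, respectively symmetric and alternating. For $u\in\mathrm{Hom}(V_0,V_1)$ let $u^*=\varphi^{-1}\circ u^t\circ\psi\in\mathrm{Hom}(V_1,V_0)$. The odd elements of $\mathfrak{osp}(2n+1,2n)$ are the endomorphisms $X=(u,u^* )$ of $V$ (acting as $u$ on $V_0$ and as $u^*$ on $V_1$). The odd nilpotent cone $\mathcal{N}_1$ is the set of those $X=(u,u^* )$ that are nilpotent; the group $G_0\times G_1=\mathrm{O}(V_0,\varphi)\times \mathrm{Sp}(V_1,\psi)$ acts on it by conjugation. Let $B_0,B_1$ be Borel subgroups of $G_0,G_1$; $G_0/B_0$ (resp. $G_1/B_1$) is the variety of complete isotropic flags $(E_i)_{1\le i\le n}$ in $V_0$ (resp. $(F_j)_{1\le j\le n}$ in $V_1$), with $\dim E_i=i$, $\dim F_j=j$; set $E_0=F_0=0$. Put $$\widetilde{\mathcal{N}}_1=\{(u,(E_i),(F_j))\in \mathrm{Hom}(V_0,V_1)\times G_0/B_0\times G_1/B_1 : u(E_i)\subset F_{i-1},\ u^*(F_i)\subset E_i \text{ for all } 1\le i\le n\}$$ and let $\pi:\widetilde{\mathcal{N}}_1\to\mathcal{N}_1$ be the first projection; it is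 a resolution of singularities. $\pi^{-1}(X)_{\mathrm{red}}$ is the fiber with its reduced structure. Orbits in $\mathcal{N}_1$ are classified by marked Young diagrams: diagrams whose boxes are labelled $0$ or $1$, alternating along each line (row), a line having parity $\epsilon$ if its first label is $\epsilon$; the diagram of $X$ is the one in which, for all $k\ge1$ and $\epsilon\in\{0,1\}$, the number of lines of parity $\epsilon$ and length at least $k$ is $\dim(\ker X\cap \mathrm{Im}\,X^{k-1}\cap V_\epsilon)$. The orbit $\mathcal{O}_3$, the unique orbit of codimension $3$ in $\mathcal{N}_1$, is the orbit whose diagram consists of three lines: $0101\cdots1010$ of length $4n-3$, and two lines $01$ and $10$ of length $2$. A chain is a sequence of components in which exactly the consecutive ones meet (for curves, each time in one point). *)

(* Defs.v *)
From HB Require Import structures.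
From mathcomp Require Import all_boot all_order all_algebra.
From mathcomp Require Import classical_sets.

Set Implicit Arguments.
Unset Strict Implicit.
Unset Printing Implicit Defensive.

Import GRing.Theory.
Local Open Scope ring_scope.
Local Open Scope classical_set_scope.

(* Classical algebraic geometry.  A variety over K (to be used with K
   algebraically closed) is a set of closed points together with its Zariski
   topology and its regular functions.  The varieties needed here are locally
   closed subsets of products of affine spaces, Grassmannians and flag
   varieties; their points are presented by (generalised) homogeneous
   coordinates, exactly as points of P^m are presented by nonzero vectors. *)

Section Varieties.
Variable K : fieldType.

(* K[W], the algebra of functions on W generated by the linear forms. *)
Inductive polyfun (W : vectType K) : (W -> K) -> Prop :=
| polyfun_const (a : K) : polyfun (fun=> a)
| polyfun_lin (l : 'Hom(W, K^o)) : polyfun (fun w => l w)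
| polyfun_add f g : polyfun f -> polyfun g -> polyfun (fun w => f w + g w)
| polyfun_mul f g : polyfun f -> polyfun g -> polyfun (fun w => f w * g w).

(* The points of zspace are the classes zcls w with w in zframe, the allowed
   homogeneous coordinates.  In all instances below zframe is open in the
   affine space zcoord and zcls is a Zariski-locally trivial quotient. *)
Record zspace := ZSpace {
  zcoord : vectType K;
  zpt : Type;
  zframe : set zcoord;
  zcls : zcoord -> zpt }.

Definition zpoints (S : zspace) : set (zpt S) := @zcls S @` @zframe S.

Definition affine (W : vectType K) : zspace :=
  @ZSpace W W setT id.

(* Gr(k, V): linearly independent k-tuples modulo GL_k. *)
Definition grassmannian (k : nat) (V : vectType K) : zspace :=
  @ZSpace {ffun 'I_k -> V} {vspace V}
    [set e | free (codom e)] (fun e => <<codom e>>%VS).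

Definition projective_space (m : nat) : zspace := grassmannian 1 'rV[K]_m.+1.

(* Flags E_0 < E_1 < ... < E_n with dim E_i = i: linearly independent n-tuples
   modulo a Borel subgroup of GL_n. *)
Definition flag_variety (n : nat) (V : vectType K) : zspace :=
  @ZSpace {ffun 'I_n -> V} {ffun 'I_n.+1 -> {vspace V}}
    [set e | free (codom e)]
    (fun e => [ffun i : 'I_n.+1 => (\sum_(j < n | (j < i)%N) <[e j]>)%VS]).

Definition zprod (S T : zspace) : zspace :=
  @ZSpace (zcoord S * zcoord T)%type (zpt S * zpt T)%type
    [set w | zframe w.1 /\ zframe w.2] (fun w => (zcls w.1, zcls w.2)).

Definition zclosed (S : zspace) (Z : set (zpt S)) : Prop :=
  exists2 P : set (zcoord S -> K), P `<=` @polyfun (zcoord S) &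
    forall w, zframe w -> (Z (zcls w) <-> forall p, P p -> p w = 0).

Definition zclosure (S : zspace) (A : set (zpt S)) : set (zpt S) :=
  [set x | zpoints x /\ forall Z, zclosed Z -> A `<=` Z -> Z x].

(* h is a regular function on U, for the reduced structure of U: near every
   point of U it is a quotient of polynomials in the homogeneous coordinates.
   (No degree condition is needed: p / q is constant on the fibres of zcls.) *)
Definition regular_on (S : zspace) (U : set (zpt S)) (h : zpt S -> K) : Prop :=
  forall w, zframe w -> U (zcls w) ->
    exists p q, [/\ polyfun p, polyfun q, q w != 0 &
      forall w', zframe w' -> U (zcls w') -> q w' != 0 ->
        h (zcls w') = p w' / q w'].

(* f restricts to a morphism A -> B: it is continuous, and it pulls back
   regular functions on the open subset B `\` Z to regular functions. *)
Definition variety_morphism (S T : zspace) (A : set (zpt S)) (B : set (zpt T))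
    (f : zpt S -> zpt T) : Prop :=
  [/\ forall x, A x -> B (f x),
      forall Z, zclosed Z -> exists2 Z', zclosed Z' &
        A `&` (f @^-1` Z) = A `&` Z' &
      forall Z h, zclosed Z -> regular_on (B `\` Z) h ->
        regular_on (A `&` (f @^-1` (B `\` Z))) (h \o f)].

Definition variety_iso (S T : zspace) (A : set (zpt S)) (B : set (zpt T)) :
    Prop :=
  exists f g, [/\ variety_morphism A B f, variety_morphism B A g,
    forall x, A x -> g (f x) = x & forall y, B y -> f (g y) = y].

Definition irreducible (S : zspace) (A : set (zpt S)) : Prop :=
  A !=set0 /\ forall Z1 Z2, zclosed Z1 -> zclosed Z2 ->
    A `<=` Z1 `|` Z2 -> A `<=` Z1 \/ A `<=` Z2.

Definition irreducible_component (S : zspace) (A Z : set (zpt S)) : Prop :=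
  [/\ Z `<=` A, irreducible Z &
    forall Z', irreducible Z' -> Z `<=` Z' -> Z' `<=` A -> Z' = Z].

(* The blow-up of P^2 in the points p and q: the closure of the graph of
   x |-> (line px, line qx), where the lines through p form the P^1 of tangent
   directions at p. *)
Definition blowup2_space : zspace :=
  zprod (projective_space 2)
    (zprod (grassmannian 2 'rV[K]_3) (grassmannian 2 'rV[K]_3)).

Definition blowup2 (p q : {vspace 'rV[K]_3}) : set (zpt blowup2_space) :=
  @zclosure blowup2_space
    [set (x, ((p + x)%VS, (q + x)%VS)) | x in
      [set x | [/\ zpoints (x : zpt (projective_space 2)), x <> p & x <> q]]].

(* D_1, ..., D_m is a chain, the intersections of consecutive members having
   the property P. *)
Definition chain (T : Type) (m : nat) (P : set T -> Prop) (D : nat -> set T) :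
    Prop :=
  forall i j, (1 <= i)%N -> (i < j)%N -> (j <= m)%N ->
    if j == i.+1 then P (D i `&` D j) else D i `&` D j = set0.

End Varieties.

Section OddNilpotentCone.
Variables (K : fieldType) (V0 V1 : vectType K).

Definition dualv (V : vectType K) : vectType K := 'Hom(V, K^o).

(* A bilinear form on V is given as the map V -> dualv V it induces. *)
Definition bilin_symmetric (V : vectType K) (phi : 'Hom(V, dualv V)) : Prop :=
  forall x y, phi x y = phi y x.
Definition bilin_alternating (V : vectType K) (phi : 'Hom(V, dualv V)) : Prop :=
  forall x, phi x x = 0.
Definition bilin_nondegenerate (V : vectType K) (phi : 'Hom(V, dualv V)) :
    Prop :=
  lker phi = 0%VS.

Definition transpose_lfun (u : 'Hom(V0, V1)) : 'Hom(dualv V1, dualv V0) :=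
  linfun (fun l : dualv V1 => (l \o u)%VF).

Definition adjoint_lfun (phi : 'Hom(V0, dualv V0)) (psi : 'Hom(V1, dualv V1))
    (u : 'Hom(V0, V1)) : 'Hom(V1, V0) :=
  (phi^-1 \o transpose_lfun u \o psi)%VF.

Definition supV : vectType K := (V0 * V1)%type.

(* V0 has parity false and V1 has parity true. *)
Definition Vpart (e : bool) : {vspace supV} :=
  if e then lker (linfun (fst : supV -> V0))
  else lker (linfun (snd : supV -> V1)).

Definition odd_end (phi : 'Hom(V0, dualv V0)) (psi : 'Hom(V1, dualv V1))
    (u : 'Hom(V0, V1)) : 'End(supV) :=
  linfun (fun v : supV => (adjoint_lfun phi psi u v.2, u v.1) : supV).

Definition endX (X : 'End(supV)) (k : nat) : 'End(supV) :=
  iter k (fun Y => (X \o Y)%VF) \1%VF.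

Definition odd_nilcone (phi : 'Hom(V0, dualv V0)) (psi : 'Hom(V1, dualv V1)) :
    set 'End(supV) :=
  [set X | (exists u, X = odd_end phi psi u) /\ exists k, endX X k = 0].

(* A marked Young diagram is the list of its lines; a line, whose labels
   alternate, is given by its parity (its first label) and its length. *)
Definition has_diagram (X : 'End(supV)) (d : seq (bool * nat)) : Prop :=
  forall (k : nat) (e : bool), (1 <= k)%N ->
    count (fun l => (l.1 == e) && (k <= l.2)%N) d =
    \dim (lker X :&: limg (endX X k.-1) :&: Vpart e)%VS.

Definition orbit3 (n : nat) (phi : 'Hom(V0, dualv V0))
    (psi : 'Hom(V1, dualv V1)) : set 'End(supV) :=
  [set X | odd_nilcone phi psi X /\
    has_diagram X [:: (false, 4 * n - 3); (false, 2); (true, 2)]%N].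

Definition isotropic_flag (n : nat) (V : vectType K) (phi : 'Hom(V, dualv V))
    (E : {ffun 'I_n.+1 -> {vspace V}}) : Prop :=
  [/\ forall i, \dim (E i) = i,
      forall i j : 'I_n.+1, (i <= j)%N -> (E i <= E j)%VS &
      forall i x y, x \in E i -> y \in E i -> phi x y = 0].

Definition resolution_space (n : nat) : zspace K :=
  zprod (affine 'Hom(V0, V1)) (zprod (flag_variety n V0) (flag_variety n V1)).

(* A flag E : {ffun 'I_n.+1 -> _} includes E_0 = 0, so indices agree with
   dimensions. *)
Definition Ntilde (n : nat) (phi : 'Hom(V0, dualv V0))
    (psi : 'Hom(V1, dualv V1)) : set (zpt (resolution_space n)) :=
  [set z | let: (u, (E, F)) := z in
    [/\ isotropic_flag phi E, isotropic_flag psi F &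
      forall i : nat, (1 <= i <= n)%N ->
        (u @: E (inord i) <= F (inord i.-1))%VS /\
        (adjoint_lfun phi psi u @: F (inord i) <= E (inord i))%VS]].

Definition springer_map (n : nat) (phi : 'Hom(V0, dualv V0))
    (psi : 'Hom(V1, dualv V1)) (z : zpt (resolution_space n)) : 'End(supV) :=
  odd_end phi psi z.1.

Definition springer_fiber (n : nat) (phi : 'Hom(V0, dualv V0))
    (psi : 'Hom(V1, dualv V1)) (X : 'End(supV)) :
    set (zpt (resolution_space n)) :=
  Ntilde phi psi `&` (springer_map phi psi @^-1` [set X]).

Lemma transpose_lfunE u (l : dualv V1) : transpose_lfun u l = (l \o u)%VF.
Proof.
pose f (l : dualv V1) : dualv V0 := (l \o u)%VF.
have fL : linear f.
  by move=> a x y; rewrite /f comp_lfunDl comp_lfunZl.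
pose fM := GRing.isLinear.Build _ _ _ _ f fL.
pose fl : {linear dualv V1 -> dualv V0} := HB.pack f fM.
exact: (lfunE fl).
Qed.

Lemma dim_dualv (V : vectType K) : \dim {: dualv V} = \dim {:V}.
Proof. by rewrite !dimvf /dim /= muln1. Qed.

Lemma adjoint_lfunP phi psi u (v : V1) (x : V0) : bilin_nondegenerate phi ->
  phi (adjoint_lfun phi psi u v) x = psi v (u x).
Proof.
move=> ndeg; have phiT : limg phi = fullv.
  apply/eqP; rewrite eqEdim subvf dim_dualv limg_dim_eq ?leqnn //.
  by rewrite (ndeg : lker phi = 0%VS) capv0.
rewrite /adjoint_lfun !comp_lfunE limg_lfunVK ?phiT ?memvf //.
by rewrite transpose_lfunE comp_lfunE.
Qed.

Lemma odd_endE phi psi u (v : supV) :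
  odd_end phi psi u v = (adjoint_lfun phi psi u v.2, u v.1).
Proof.
pose f (v : supV) : supV := (adjoint_lfun phi psi u v.2, u v.1).
have fL : linear f.
  by move=> a x y; rewrite /f /= !linearP.
pose fM := GRing.isLinear.Build _ _ _ _ f fL.
pose fl : {linear supV -> supV} := HB.pack f fM.
exact: (lfunE fl).
Qed.

Lemma memVpart e (v : supV) :
  (v \in Vpart e) = if e then v.1 == 0 else v.2 == 0.
Proof. by case: e; rewrite memv_ker lfunE. Qed.

End OddNilpotentCone.

(* Main.v *)
(* Let P_0, Q_0, P_1, ... be the long line of the diagram of X, so that
   u P_(j+1) = Q_j, u^* Q_j = P_j, and let (a0, a1), (b1, b0) be the short ones,
   with phi(a0, b0) = psi(a1, b1) = 1.  Put A_j = <P_0, ..., P_(j-1)> and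
   D_j = <Q_0, ..., Q_(j-1)>.  Suppose that E_j = A_j and F_j = D_j for j <= k.
   The inclusions u E_(j+1) <= F_j, u^* F_j <= E_j and isotropy leave three
   possibilities at the next step.
   - E_(k+2) = A_(k+1) + <a0>.  Then all the later E_j are determined, and the
     flags depend on the point x = F_(k+1) / D_k of the plane
     <b1, Q_k, a1> = P^2, on a line through x and b1 (which amounts to
     E_(k+1)) and on a line through x and Q_k (which amounts to F_(k+2)): this
     is the blow-up S_(k+1) of P^2 in two points.
   - E_(k+1) = A_(k+1), and E_(k+2) is determined by the point F_(k+1) / D_k of
     the line <b1, Q_k>, through a parametrisation of a line, or of a conic
     if k + 2 = n: this is the curve C_(k+1).
   - E_(k+1) = A_(k+1) and F_(k+1) = D_(k+1), and k increases by one.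
   Each component is cut out of the fiber by closed conditions and is the
   isomorphic image of P^1 or of the blow-up, hence irreducible; the
   intersections are read off from the flags.  Morphisms are checked on local
   polynomial lifts to homogeneous coordinates. *)
From HB Require Import structures.
Require Import Defs.
From mathcomp Require Import all_boot all_order all_algebra.
From mathcomp Require Import classical_sets boolp ring zify.

Set Implicit Arguments.
Unset Strict Implicit.
Unset Printing Implicit Defensive.

Import GRing.Theory.
Local Open Scope ring_scope.
Local Open Scope classical_set_scope.

(** * Polynomial maps *)

Section Polynomials.
Variable K : fieldType.
Implicit Types U V W : vectType K.

(** On the span of the vectors P_j, a0, b0 that a flag of length n can reach, phi pairs a0 with b0,
    and P_j with P_k only for j = k = n - 1; on the side of V1, psi pairs only a1 with b1. Isotropy
    therefore acts through very few coefficients: once a0 lies in some E_j no later vector has a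
    b0-coefficient, and a vector of E_j with a b0-coefficient, isotropic below the last level,
    excludes a0 afterwards. The one number phi(P_(n-1), P_(n-1)), nonzero because P_(n-1) is the
    middle box of the long line, stops the third possibility at the last level, and bends the last
    curve into a conic through <a0>. That point is where the two chains meet.

    The geometric obstacle is that a point has many coordinates, so a set of frames defined by
    equations need not be a union of classes; the group acting on frames repairs this. Maximality of
    the components is obtained without dimension theory: the fiber has a finite cover by closed
    conditions, and each component has a point lying on no other. *)

Lemma polyfun_ext W (f g : W -> K) : f =1 g -> polyfun f -> polyfun g.
Proof. by move=> /funext ->. Qed.

Lemma polyfun_sum W I (r : seq I) (F : I -> W -> K) :
  (forall i, polyfun (F i)) -> polyfun (fun w => \sum_(i <- r) F i w).
Proof.
move=> Fp; elim: r => [|i r IH].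
  by apply: polyfun_ext (polyfun_const _ 0) => w; rewrite big_nil.
by apply: polyfun_ext (polyfun_add (Fp i) IH) => w; rewrite big_cons.
Qed.

Lemma polyfun_prod W I (r : seq I) (F : I -> W -> K) :
  (forall i, polyfun (F i)) -> polyfun (fun w => \prod_(i <- r) F i w).
Proof.
move=> Fp; elim: r => [|i r IH].
  by apply: polyfun_ext (polyfun_const _ 1) => w; rewrite big_nil.
by apply: polyfun_ext (polyfun_mul (Fp i) IH) => w; rewrite big_cons.
Qed.

Lemma polyfun_scale W a (f : W -> K) : polyfun f -> polyfun (fun w => a * f w).
Proof. exact/polyfun_mul/polyfun_const. Qed.

Definition polymap V W (G : V -> W) : Prop :=
  forall l : 'Hom(W, K^o), polyfun (fun v => l (G v)).

Lemma polymap_ext V W (G H : V -> W) : G =1 H -> polymap G -> polymap H.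
Proof. by move=> /funext ->. Qed.

Lemma polyfun_comp V W (G : V -> W) f :
  polymap G -> polyfun f -> polyfun (fun v => f (G v)).
Proof.
move=> Gp; elim=> [a|l|f1 f2 _ p1 _ p2|f1 f2 _ p1 _ p2].
- exact: polyfun_const.
- exact: Gp.
- exact: polyfun_add.
- exact: polyfun_mul.
Qed.

Lemma polymap_id V : polymap (@id V).
Proof. by move=> l; apply: polyfun_lin. Qed.

Lemma polymap_const V W (c : W) : polymap (fun _ : V => c).
Proof. by move=> l; apply: polyfun_const. Qed.

Lemma polymap_hom U V W (L : 'Hom(V, W)) (G : U -> V) :
  polymap G -> polymap (fun u => L (G u)).
Proof.
by move=> Gp l; apply: polyfun_ext (Gp (l \o L)%VF) => u; rewrite comp_lfunE.
Qed.

Lemma polymap_linear U V W (L : V -> W) (G : U -> V) :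
  linear L -> polymap G -> polymap (fun u => L (G u)).
Proof.
move=> Ll Gp; pose LM := GRing.isLinear.Build _ _ _ _ L Ll.
pose LL : {linear V -> W} := HB.pack L LM.
by apply: polymap_ext (polymap_hom (linfun LL) Gp) => u; rewrite (lfunE LL).
Qed.

Lemma polymap_add V W (G H : V -> W) :
  polymap G -> polymap H -> polymap (fun v => G v + H v).
Proof.
move=> Gp Hp l; apply: polyfun_ext (polyfun_add (Gp l) (Hp l)) => v.
by rewrite linearD.
Qed.

Lemma polymap_sum V W I (r : seq I) (G : I -> V -> W) :
  (forall i, polymap (G i)) -> polymap (fun v => \sum_(i <- r) G i v).
Proof.
move=> Gp l; apply: polyfun_ext (polyfun_sum r (fun i => Gp i l)) => v.
by rewrite linear_sum.
Qed.

Lemma polymap_scale V W (f : V -> K) (G : V -> W) :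
  polyfun f -> polymap G -> polymap (fun v => f v *: G v).
Proof.
move=> fp Gp l; apply: polyfun_ext (polyfun_mul fp (Gp l)) => v.
by rewrite linearZ.
Qed.

Lemma polymap_fst U V W (G : U -> (V * W)%type) :
  polymap G -> polymap (fun u => (G u).1).
Proof. exact: (@polymap_linear _ (V * W)%type _ fst). Qed.

Lemma polymap_snd U V W (G : U -> (V * W)%type) :
  polymap G -> polymap (fun u => (G u).2).
Proof. exact: (@polymap_linear _ (V * W)%type _ snd). Qed.

Lemma polymap_eval U V (I : finType) (G : U -> {ffun I -> V}) i :
  polymap G -> polymap (fun u => G u i).
Proof.
apply: (@polymap_linear _ {ffun I -> V} _ (fun e => e i)).
by move=> a x y; rewrite !ffunE.
Qed.

Lemma polymap_pair U V W (G : U -> V) (H : U -> W) :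
  polymap G -> polymap H -> polymap (fun u => (G u, H u) : (V * W)%type).
Proof.
move=> Gp Hp.
have in1 : linear (fun v : V => (v, 0) : (V * W)%type).
  by move=> a x y; rewrite pair_equal_spec /= scaler0 addr0.
have in2 : linear (fun v : W => (0, v) : (V * W)%type).
  by move=> a x y; rewrite pair_equal_spec /= scaler0 addr0.
apply: polymap_ext (polymap_add (polymap_linear in1 Gp) (polymap_linear in2 Hp)).
by move=> u; rewrite pair_equal_spec /= add0r addr0.
Qed.

Lemma polymap_ffun U V (I : finType) (G : U -> {ffun I -> V}) :
  (forall i, polymap (fun u => G u i)) -> polymap G.
Proof.
move=> Gp; pose inj i (v : V) : {ffun I -> V} := [ffun j => if j == i then v else 0].
have injL i : linear (inj i).
  move=> a x y; apply/ffunP=> j; rewrite !ffunE; case: eqP => // _.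
  by rewrite scaler0 addr0.
apply: (polymap_ext _ (polymap_sum (index_enum I)
  (fun i => polymap_linear (injL i) (Gp i)))) => u.
apply/ffunP=> j; rewrite sum_ffunE (bigD1 j) //= big1 ?addr0.
  by rewrite ffunE eqxx.
by move=> i /negPf ij; rewrite ffunE eq_sym ij.
Qed.

(** Restriction to a line brings products of polynomial functions into [{poly K}], which is an
    integral domain. *)
Lemma polyfun_line W (f : W -> K) (a b : W) : polyfun f ->
  exists P : {poly K}, forall t, f (a + t *: b) = P.[t].
Proof.
elim=> [c|l|f1 f2 _ [P1 E1] _ [P2 E2]|f1 f2 _ [P1 E1] _ [P2 E2]].
- by exists c%:P => t; rewrite hornerC.
- exists ((l a)%:P + (l b) *: 'X) => t.
  by rewrite linearD linearZ !hornerE mulrC.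
- by exists (P1 + P2) => t; rewrite hornerD E1 E2.
- by exists (P1 * P2) => t; rewrite hornerM E1 E2.
Qed.

Hypothesis charK : [pchar K] =i pred0.

(** In characteristic zero 0, ..., [size P] - 1 are distinct elements of K, one more than P can have
    roots. *)
Lemma horner_neq0_pchar0 (P : {poly K}) : P != 0 -> exists t, P.[t] != 0.
Proof.
move=> P0; pose r := [seq i%:R : K | i <- iota 0 (size P)].
have: ~~ all (root P) r.
  apply/negP => ra; have := max_poly_roots P0 ra.
  rewrite size_map size_iota ltnn map_inj_uniq ?iota_uniq; first by move/(_ isT).
  have inj i j : (i <= j)%N -> i%:R = j%:R :> K -> i = j.
    move=> ij /eqP; rewrite eq_sym -subr_eq0 -natrB // => /eqP E.
    apply/eqP; rewrite eqn_leq ij /= -subn_eq0; apply: contraT => ne.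
    suff : (j - i)%N = 0%N by move/eqP; rewrite (negPf ne).
    by apply/eqP; rewrite -((pcharf0P K).1 charK) E.
  move=> i j E; case: (leqP i j) => [|/ltnW] ij; first exact: inj.
  exact/esym/inj.
by case/allPn => t _ tP; exists t.
Qed.

(** This is the irreducibility of affine space: on the line through a and b both functions are
    nonzero polynomials in t, hence so is their product. *)
Lemma polyfun_mul_neq0 W (f g : W -> K) a b : polyfun f -> polyfun g ->
  f a != 0 -> g b != 0 -> exists w, f w * g w != 0.
Proof.
move=> fp gp fa gb; have [P EP] := polyfun_line a (b - a) fp.
have [Q EQ] := polyfun_line a (b - a) gp.
have P0 : P != 0.
  by apply: contraNneq fa => P0; rewrite -[a]addr0 -(scale0r (b - a)) EP P0 horner0.
have Q0 : Q != 0.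
  apply: contraNneq gb => Q0.
  by rewrite -[b](subrKC a) -(scale1r (b - a)) EQ Q0 horner0.
have [t] := horner_neq0_pchar0 (mulf_neq0 P0 Q0).
by rewrite hornerM -EP -EQ => ?; exists (a + t *: (b - a)).
Qed.

End Polynomials.

(** * Zariski topology and morphisms *)

Section Zariski.
Variable K : fieldType.
Implicit Types S T : zspace K.

(* The coordinates of a point form an orbit of a group acting on the frames by
   polynomial maps; this makes ideals of cones saturated. *)
Definition zhomogeneous S : Prop := forall w w' : zcoord S,
  zframe w -> zframe w' -> zcls w = zcls w' ->
  exists L : zcoord S -> zcoord S, [/\ polymap L, L w = w' &
    forall v, zframe v -> zframe (L v) /\ zcls (L v) = zcls v].

Lemma zhomogeneous_prod S T :
  zhomogeneous S -> zhomogeneous T -> zhomogeneous (zprod S T).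
Proof.
move=> hS hT [w1 w2] [w1' w2'] /= [f1 f2] [f1' f2'] [e1 e2].
have [L1 [p1 a1 b1]] := hS _ _ f1 f1' e1.
have [L2 [p2 a2 b2]] := hT _ _ f2 f2' e2.
exists (fun w => (L1 w.1, L2 w.2)); split=> /=.
- have pfst := polymap_fst (@polymap_id _ (zcoord (zprod S T))).
  have psnd := polymap_snd (@polymap_id _ (zcoord (zprod S T))).
  apply: polymap_pair => l.
    exact: polyfun_comp pfst (p1 l).
  exact: polyfun_comp psnd (p2 l).
- by rewrite a1 a2.
- move=> [v1 v2] [/= g1 g2]; have [? ->] := b1 _ g1; have [? ->] := b2 _ g2.
  by [].
Qed.

Lemma zhomogeneous_affine (W : vectType K) : zhomogeneous (affine W).
Proof. by move=> w w' _ _ /= <-; exists id; split=> //; apply: polymap_id. Qed.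

(** The equations of the closure are the polynomials vanishing on all frames over A. Their validity
    does not depend on the frame chosen for a point: if p is such an equation, so is p composed with
    the map L of [zhomogeneous]. *)
Lemma zclosed_closure S (A : set (zpt S)) : zhomogeneous S ->
  zclosed (zclosure A) /\ forall w, zframe w ->
  (zclosure A (zcls w) <-> forall p, polyfun p ->
     (forall v, zframe v -> A (zcls v) -> p v = 0) -> p w = 0).
Proof.
move=> hS; pose P : set (zcoord S -> K) :=
  [set p | polyfun p /\ forall v, zframe v -> A (zcls v) -> p v = 0].
pose Z : set (zpt S) :=
  [set x | exists w, [/\ zframe w, zcls w = x & forall p, P p -> p w = 0]].
have ZP w : zframe w -> (Z (zcls w) <-> forall p, P p -> p w = 0).
  move=> fw; split=> [[w' [fw' ew' Pw']] p [pp pA]|?]; last by exists w.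
  have [L [Lp <- Lf]] := hS _ _ fw' fw ew'.
  apply: (Pw' (fun v => p (L v))); split; first exact: polyfun_comp.
  by move=> v fv Av; have [? e] := Lf _ fv; apply: pA; rewrite ?e.
have clZ : zclosed Z by exists P => // p [].
have AZ : A `&` zpoints (S:=S) `<=` Z.
  by move=> x [Ax [w fw ew]]; exists w; split=> // p [_]; apply; rewrite // ew.
have cl w : zframe w -> (zclosure A (zcls w) <-> forall p, P p -> p w = 0).
  (* A may contain elements that are not points, and [zclosed] constrains points only; adding all
     non-points to Z gives a closed set that contains A. *)
  move=> fw; rewrite -ZP //; split=> [[_ /(_ (Z `|` ~` (zpoints (S:=S))))]|Zw].
    case=> //; last by case; exists w.
      exists P => [p [] //|v fv]; rewrite -ZP //; split=> [[//|[]]|]; last by left.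
      by exists v.
    move=> x Ax; have [zx|] := pselect (zpoints x); last by right.
    by left; apply: AZ.
  split; first by exists w.
  move=> Z' [P' P'p ZP'] AZ'; apply/ZP' => // p P'p'.
  have /ZP : Z (zcls w) by []. 
  move=> /(_ fw p); apply; split; first exact: P'p.
  by move=> v fv /AZ' /ZP'; apply.
split.
  by exists P => [p []|].
move=> w fw; rewrite cl //; split=> [H p pp pA|H p [pp pA]]; exact: H.
Qed.

Lemma zclosed_cap S (A B : set (zpt S)) :
  zclosed A -> zclosed B -> zclosed (A `&` B).
Proof.
move=> [P Pp AP] [Q Qp BQ]; exists (P `|` Q) => [p [/Pp|/Qp] //|w fw].
split=> [[/(AP _ fw) Aw /(BQ _ fw) Bw] p [/Aw|/Bw]//|PQ]; split.
  by apply/AP => // p ?; apply: PQ; left.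
by apply/BQ => // p ?; apply: PQ; right.
Qed.

Lemma zclosed_forall S I (A : I -> set (zpt S)) :
  (forall i, zclosed (A i)) -> zclosed [set x | forall i, A i x].
Proof.
move=> cA; exists [set p | polyfun p /\ exists i, forall w,
    zframe w -> A i (zcls w) -> p w = 0] => [p [] //|w fw]; split.
  by move=> Aw p [_ [i]]; apply.
move=> Pw i; have [P Pp AP] := cA i; apply/AP => // p Pp'.
by apply: Pw; split; [exact: Pp|exists i => v fv /AP; apply].
Qed.

Lemma zclosed_imply S (Q : Prop) (A : set (zpt S)) :
  (Q -> zclosed A) -> zclosed [set x | Q -> A x].
Proof.
move=> cA; have [q|nq] := pselect Q.
  by have [P Pp AP] := cA q; exists P => // w fw; rewrite -AP //; split=> [H|H _]; exact: H.
by exists set0 => [p []|w fw]; split=> [_ p []|_ /nq].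
Qed.

Lemma zclosed_fst S T (Z : set (zpt S)) :
  zclosed Z -> @zclosed _ (zprod S T) [set z | Z z.1].
Proof.
move=> [P Pp ZP]; exists [set p | exists2 p', P p' & p = (fun w => p' w.1)].
  move=> _ [p /Pp pp ->]; apply: (polyfun_comp _ pp).
  exact/polymap_fst/polymap_id.
move=> w [f1 f2] /=; rewrite ZP //; split=> [H _ [p Pp' ->]|H p Pp']; first exact: H.
by apply: (H (fun w => p w.1)); exists p.
Qed.

Lemma zclosed_snd S T (Z : set (zpt T)) :
  zclosed Z -> @zclosed _ (zprod S T) [set z | Z z.2].
Proof.
move=> [P Pp ZP]; exists [set p | exists2 p', P p' & p = (fun w => p' w.2)].
  move=> _ [p /Pp pp ->]; apply: (polyfun_comp _ pp).
  exact/polymap_snd/polymap_id.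
move=> w [f1 f2] /=; rewrite ZP //; split=> [H _ [p Pp' ->]|H p Pp']; first exact: H.
by apply: (H (fun w => p w.2)); exists p.
Qed.

(** A lift to coordinates needs no denominators, since frames may be rescaled; q only delimits the
    chart where the polynomial lift G is valid. *)
Definition local_lift S T (A : set (zpt S)) (f : zpt S -> zpt T)
    (w0 : zcoord S) : Prop :=
  exists (q : zcoord S -> K) (G : zcoord S -> zcoord T),
    [/\ polyfun q, q w0 != 0, polymap G &
     forall w, zframe w -> A (zcls w) -> q w != 0 ->
       zframe (G w) /\ zcls (G w) = f (zcls w)].

(** An equation p of Z pulls back on the chart to p composed with G. Multiplied by q it vanishes on
    the whole preimage, also off the chart, so the closure of the preimage meets A in nothing
    new. *)
Lemma variety_morphism_lift S T (A : set (zpt S)) (B : set (zpt T)) f :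
  zhomogeneous S -> (forall x, A x -> B (f x)) -> A `<=` @zpoints _ S ->
  (forall w, zframe w -> A (zcls w) -> local_lift A f w) ->
  variety_morphism A B f.
Proof.
move=> hS AB Az lift; split=> // [Z cZ|Z h cZ hr].
  have [clc clP] := zclosed_closure (A `&` f @^-1` Z) hS.
  exists (zclosure (A `&` f @^-1` Z)) => //.
  apply/seteqP; split=> [x [Ax Zx]|x [Ax clx]].
    by split=> //; split; [exact: Az|move=> Z' _; apply].
  split=> //; have [w fw wx] := Az _ Ax; subst x.
  have [q [G [qp qw Gp GP]]] := lift _ fw Ax.
  have [fG eG] := GP _ fw Ax qw; move: cZ => [P Pp ZP].
  rewrite /preimage /= -eG; apply/ZP => // p Pp'.
  have /(clP _ fw)/(_ (fun w => q w * p (G w))) := clx.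
  have -> : forall x, (q w * x = 0) = (x = 0).
    move=> x; apply/propext; split=> [/eqP|->]; last by rewrite mulr0.
    by rewrite mulf_eq0 (negPf qw) /= => /eqP.
  apply.
    by apply: polyfun_mul => //; apply: polyfun_comp Gp (Pp _ Pp').
  move=> v fv [Av Zv]; have [->|qv] := eqVneq (q v) 0; first by rewrite mul0r.
  have [fGv eGv] := GP _ fv Av qv; rewrite ((ZP _ fGv).1 _ p Pp') ?mulr0 //.
  by rewrite eGv.
move=> w fw [Aw BZw]; have [q [G [qp qw Gp GP]]] := lift _ fw Aw.
have [fG eG] := GP _ fw Aw qw; have := hr (G w) fG.
rewrite eG => /(_ BZw)[p1 [q1 [p1p q1p q1w H]]].
(* The factor q in numerator and denominator makes a nonzero denominator imply that v lies in the
   chart. *)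
exists (fun v => p1 (G v) * q v), (fun v => q1 (G v) * q v); split.
- exact/polyfun_mul/qp/polyfun_comp.
- exact/polyfun_mul/qp/polyfun_comp.
- by rewrite mulf_neq0.
move=> v fv [Av BZv]; rewrite mulf_eq0 negb_or => /andP[q1v qv].
have [fGv eGv] := GP _ fv Av qv; rewrite /= -eGv H ?eGv //.
by field; rewrite q1v qv.
Qed.

Lemma irreducible_image S T (A : set (zpt S)) (B : set (zpt T)) f :
  variety_morphism A B f -> irreducible A -> irreducible (f @` A).
Proof.
move=> [AB cf _] [[x Ax] irrA]; split; first by exists (f x); exists x.
move=> Z1 Z2 /cf[Z1' c1 e1] /cf[Z2' c2 e2] sub.
have sub' : A `<=` Z1' `|` Z2'.
  move=> y Ay; case: (sub (f y)) => [|Z1y|Z2y]; first by exists y.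
    by left; have [] : (A `&` Z1') y by rewrite -e1.
  by right; have [] : (A `&` Z2') y by rewrite -e2.
case: (irrA _ _ c1 c2 sub') => AZ; [left|right] => _ [y Ay <-].
  by have [] : (A `&` f @^-1` Z1) y by rewrite e1; split=> //; apply: AZ.
by have [] : (A `&` f @^-1` Z2) y by rewrite e2; split=> //; apply: AZ.
Qed.

Lemma irreducible_closure S (A : set (zpt S)) : A `<=` @zpoints _ S ->
  irreducible A -> irreducible (zclosure A).
Proof.
move=> Az [[x Ax] irrA]; have sub : A `<=` zclosure A.
  by move=> y Ay; split; [exact: Az|move=> Z _; apply].
split; first by exists x; apply: sub.
move=> Z1 Z2 c1 c2 clA; case: (irrA _ _ c1 c2 (subset_trans sub clA)) => AZ.
  by left=> y [_]; apply.
by right=> y [_]; apply.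
Qed.

(** D contains the principal open set where d is nonzero. If neither Z1 nor Z2 contained the image,
    an equation of each would be nonzero somewhere on D, and the product of both with d would be
    nonzero at a common v. *)
Lemma irreducible_param S (W : vectType K) (D : set W) (d : W -> K)
    (g : W -> zcoord S) :
  [pchar K] =i pred0 -> polymap g -> polyfun d -> (exists v, d v != 0) ->
  (forall v, D v -> zframe (g v)) -> (forall v, d v != 0 -> D v) ->
  irreducible ((fun v => zcls (g v)) @` D).
Proof.
move=> charK gp dp [v0 dv0] gf dD.
split; first by exists (zcls (g v0)), v0 => //; apply: dD.
move=> Z1 Z2 [P1 P1p ZP1] [P2 P2p ZP2] sub.
have [s1|ns1] := pselect ((fun v => zcls (g v)) @` D `<=` Z1); first by left.
have [s2|ns2] := pselect ((fun v => zcls (g v)) @` D `<=` Z2); first by right.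
have bad P Z : P `<=` @polyfun _ _ ->
    (forall w, zframe w -> (Z (zcls w) <-> forall p, P p -> p w = 0)) ->
    ~ ((fun v => zcls (g v)) @` D `<=` Z) ->
    exists v p, [/\ P p, polyfun (fun v => p (g v)) & p (g v) != 0].
  move=> Pp ZP ns; apply: contrapT => H; apply: ns => _ [v Dv <-].
  apply/ZP; first exact: gf.
  move=> p Pp'; apply: contrapT => /eqP ne; apply: H; exists v, p.
  by split=> //; apply: polyfun_comp gp (Pp _ Pp').
have [v1 [p1 [Pp1 pf1 ne1]]] := bad _ _ P1p ZP1 ns1.
have [v2 [p2 [Pp2 pf2 ne2]]] := bad _ _ P2p ZP2 ns2.
have [v3 ne3] := polyfun_mul_neq0 charK pf1 pf2 ne1 ne2.
have [v] := polyfun_mul_neq0 charK dp (polyfun_mul pf1 pf2) dv0 ne3.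
rewrite !mulf_eq0 !negb_or => /and3P[/dD Dv n1 n2].
have fv := gf _ Dv; exfalso; case: (sub (zcls (g v))); first by exists v.
  by move=> /(ZP1 _ fv)/(_ _ Pp1)/eqP; apply/negP.
by move=> /(ZP2 _ fv)/(_ _ Pp2)/eqP; apply/negP.
Qed.

(** Induction on the list from the case of two closed sets; a finite union is cut out by the
    products of the equations. *)
Lemma irreducible_cover S (A : set (zpt S)) (I : eqType) (r : seq I)
    (Z : I -> set (zpt S)) :
  irreducible A -> (forall i, i \in r -> zclosed (Z i)) ->
  (forall x, A x -> exists2 i, i \in r & Z i x) ->
  exists2 i, i \in r & A `<=` Z i.
Proof.
move=> [[x0 Ax0] irrA]; elim: r => [|i r IH] cZ cov.
  by have [i] := cov _ Ax0.
have cU : zclosed [set x | exists2 j, j \in r & Z j x].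
  elim: r cZ {cov IH} => [|j r IHr] cZ.
    (* The empty union has the equation 1 = 0. *)
    by exists [set (fun=> 1)] => [_ ->|w fw]; [exact: polyfun_const|
      split=> [[] //|/(_ _ erefl)/eqP]; rewrite oner_eq0].
  have [P1 P1p ZP1] : zclosed (Z j) by apply: cZ; rewrite !inE eqxx orbT.
  have [|P2 P2p ZP2] := IHr; first by move=> k; rewrite inE => /orP[] kr; apply: cZ;
    rewrite !inE kr ?orbT.
  exists [set p | exists p1 p2, [/\ P1 p1, P2 p2 & p = (fun w => p1 w * p2 w)]].
    by move=> _ [p1 [p2 [/P1p ? /P2p ? ->]]]; apply: polyfun_mul.
  move=> w fw; split.
    move=> [k]; rewrite inE => /orP[/eqP-> Zw|kr Zw] _ [p1 [p2 [Pp1 Pp2 ->]]].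
      by rewrite ((ZP1 _ fw).1 Zw _ Pp1) mul0r.
    by rewrite ((ZP2 _ fw).1 _ _ Pp2) ?mulr0 //; exists k.
  move=> H; have [Zw|nZ] := pselect (Z j (zcls w)).
    by exists j => //; rewrite inE eqxx.
  have [p1 Pp1 ne] : exists2 p1, P1 p1 & p1 w != 0.
    apply: contrapT => H'; apply: nZ; apply/ZP1 => // p Pp.
    by apply: contrapT => /eqP ne; apply: H'; exists p.
  have [k kr Zk] : [set x | exists2 j, j \in r & Z j x] (zcls w).
    apply/ZP2 => // p2 Pp2; have := H _ (ex_intro _ p1 (ex_intro _ p2 (And3 Pp1 Pp2 erefl))).
    by move/eqP; rewrite mulf_eq0 (negPf ne) /= => /eqP.
  by exists k => //; rewrite inE kr orbT.
case: (irrA _ _ (cZ i (mem_head _ _)) cU).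
- move=> x /cov[j]; rewrite inE => /orP[/eqP->|jr] Zx; first by left.
  by right; exists j.
- by move=> AZ; exists i => //; rewrite mem_head.
- have cZ' j : j \in r -> zclosed (Z j) by move=> jr; apply: cZ; rewrite inE jr orbT.
  move=> /(IH cZ')[j jr AZ].
  by exists j => //; rewrite inE jr orbT.
Qed.

End Zariski.

(** * Frames of subspaces and flags *)

Lemma lfunZ (K : fieldType) (V W : vectType K) (f : 'Hom(V, W)) c x :
  f (c *: x) = c *: f x.
Proof. exact: linearZ. Qed.

Lemma lfunB (K : fieldType) (V W : vectType K) (f : 'Hom(V, W)) x y :
  f (x - y) = f x - f y.
Proof. exact: linearB. Qed.

Lemma lfunD (K : fieldType) (V W : vectType K) (f : 'Hom(V, W)) x y :
  f (x + y) = f x + f y.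
Proof. exact: linearD. Qed.

Section LinearAlgebra.
Variables (K : fieldType) (V : vectType K).
Implicit Types (U E : {vspace V}) (x v : V).

Lemma memv_addv_lineP U v x :
  reflect (exists c, x - c *: v \in U) (x \in U + <[v]>)%VS.
Proof.
apply: (iffP memv_addP) => [[y Uy [z /vlineP[c ->] ->]]|[c Uxc]].
  by exists c; rewrite addrK.
exists (x - c *: v) => //; exists (c *: v); first exact/memvZ/memv_line.
by rewrite subrK.
Qed.

Lemma dim_addv_line U v : v \notin U -> \dim (U + <[v]>) = (\dim U).+1.
Proof.
move=> Uv; have v0 : v != 0 by apply: contraNneq Uv => ->; exact: mem0v.
rewrite dimv_disjoint_sum ?dim_vline ?v0 ?addn1 //; apply/eqP.
rewrite -subv0; apply/subvP => x; rewrite memv_cap => /andP[Ux /vlineP[c xE]].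
have [c0|c0] := eqVneq c 0; first by rewrite xE c0 scale0r mem0v.
by case/negP: Uv; rewrite -[v](scalerK c0) -xE memvZ.
Qed.

Lemma addv_lineC U v x c : c != 0 -> v - c *: x \in U -> (U + <[v]> = U + <[x]>)%VS.
Proof.
move=> c0 Uvx; apply/eqP; rewrite eqEsubv !subv_add !addvSl /=.
apply/andP; split; apply/memv_addv_lineP; first by exists c.
exists c^-1; rewrite -memvN opprB -(memvN U) opprB.
by have := memvZ c^-1 Uvx; rewrite scalerBr scalerK // => ?; rewrite -memvN opprB.
Qed.

Lemma subv_dim_eq U E : (U <= E)%VS -> (\dim E <= \dim U)%N -> E = U.
Proof. by move=> UE dE; apply/esym/eqP; rewrite eqEdim UE. Qed.

Lemma addv_line_dim U E v :
  (U <= E)%VS -> (\dim E <= (\dim U).+1)%N -> v \in E -> v \notin U ->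
  E = (U + <[v]>)%VS.
Proof.
move=> UE dE Ev Uv; apply: subv_dim_eq; last by rewrite dim_addv_line.
by rewrite subv_add UE -memvE.
Qed.

Lemma addv_line_exists U E : (U <= E)%VS -> \dim E = (\dim U).+1 ->
  exists v, [/\ v \in E, v \notin U & E = (U + <[v]>)%VS].
Proof.
move=> UE dE; have /subvPn[v Ev Uv] : ~~ (E <= U)%VS.
  by apply: contra_eqN dE => /dimvS; rewrite -ltnS => /ltn_eqF; rewrite eq_sym => ->.
by exists v; split=> //; apply: addv_line_dim; rewrite ?dE.
Qed.

Lemma vline_exists E : \dim E = 1%N -> exists2 v, v != 0 & E = <[v]>%VS.
Proof.
move=> dE; have [|v [_ v0 ->]] := addv_line_exists (sub0v E); first by rewrite dimv0.
by exists v; rewrite ?add0v // -memv0.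
Qed.

Lemma vline_notin v x : v != 0 -> x != 0 -> <[v]>%VS <> <[x]>%VS -> v \notin <[x]>%VS.
Proof.
move=> v0 x0 ne; apply/negP; rewrite memvE => le; apply: ne; apply: esym.
by apply: subv_dim_eq => //; rewrite !dim_vline v0 x0.
Qed.

(** For v outside U, w is the nonzero component of v in the complement of U singled out by [projv];
    the form takes that component of x, projects it to the line of w and reads its coordinate. *)
Definition sep_form U v : 'Hom(V, K^o) :=
  let w := v - projv U v in
  linfun (fun x => coord [tuple w] ord0 (projv <[w]> (x - projv U x)) : K^o).

Lemma sep_formP U v : v \notin U ->
  sep_form U v v = 1 /\ (forall x, x \in U -> sep_form U v x = 0).
Proof.
move=> Uv; rewrite /sep_form; set w := v - _.
pose f x := coord [tuple w] ord0 (projv <[w]> (x - projv U x)) : K^o.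
have fL : linear f.
  move=> a x y; rewrite /f linearP opprD addrACA -scalerBr.
  by rewrite (linearP (projv <[w]>)) linearP.
pose fM := GRing.isLinear.Build _ _ _ _ f fL.
pose fl : {linear V -> K^o} := HB.pack f fM.
have w0 : w != 0.
  by apply: contraNneq Uv => /eqP; rewrite subr_eq0 => /eqP->; exact: memv_proj.
rewrite !(lfunE fl) /= /f; split=> [|x Ux].
  rewrite projv_id ?memv_line // -/w.
  have := @coord_free _ _ _ [tuple w] ord0 ord0; rewrite /= => -> //.
  by rewrite seq1_free.
by rewrite (lfunE fl) /= /f (projv_id Ux) subrr !linear0.
Qed.

End LinearAlgebra.

Section Frames.
Variables (K : fieldType) (V : vectType K) (n : nat).
Implicit Types (e f : {ffun 'I_n -> V}).

Lemma span_codom e : <<codom e>>%VS = (\sum_(i < n) <[e i]>)%VS.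
Proof. by rewrite span_def big_map big_enum. Qed.

Lemma free_codom_dim e : free (codom e) = (\dim (\sum_(i < n) <[e i]>) == n)%N.
Proof. by rewrite -span_codom /free size_codom card_ord. Qed.

Lemma memv_sum_lineP (P : pred 'I_n) e v :
  reflect (exists2 c : 'I_n -> K, (forall i, ~~ P i -> c i = 0) &
             v = \sum_i c i *: e i)
          (v \in (\sum_(i < n | P i) <[e i]>)%VS).
Proof.
apply: (iffP memv_sumP) => [[w wP ->]|[c c0 ->]].
  have /choice[c cP] i : exists c, P i -> w i = c *: e i.
    by case: (boolP (P i)) => [/wP/vlineP[c ?]|_]; [exists c|exists 0].
  exists (fun i => if P i then c i else 0) => [i /negPf->//|].
  rewrite big_mkcond; apply: eq_bigr => i _; case: ifP => [/cP->//|].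
  by rewrite scale0r.
exists (fun i => c i *: e i) => [i _|]; first exact/memvZ/memv_line.
rewrite [RHS]big_mkcond; apply: eq_bigr => i _.
by case: ifPn => // /c0->; rewrite scale0r.
Qed.

Lemma free_codomP e c : free (codom e) -> \sum_i c i *: e i = 0 -> c =1 fun=> 0.
Proof.
have -> : codom e = mktuple e :> seq V by [].
move=> /freeP-/(_ c) H E i; apply: H; rewrite -[RHS]E.
by apply: eq_bigr => j _; rewrite -tnth_nth tnth_mktuple.
Qed.

(** Freeness of e makes the matrix product d c the identity, and this no longer refers to e and f: d
    undoes c on every tuple v. *)
Lemma lincomb_inverse (e f v : {ffun 'I_n -> V}) (c d : 'I_n -> 'I_n -> K) :
  free (codom e) -> (forall i, f i = \sum_j c i j *: e j) ->
  (forall i, e i = \sum_j d i j *: f j) ->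
  forall i, v i = \sum_j d i j *: (\sum_k c j k *: v k).
Proof.
move=> fe fE eE i.
have compE (g : {ffun 'I_n -> V}) : \sum_j d i j *: (\sum_k c j k *: g k) =
    \sum_k (\sum_j d i j * c j k) *: g k.
  under eq_bigr => j _ do rewrite scaler_sumr.
  rewrite exchange_big /=; apply: eq_bigr => k _; rewrite scaler_suml.
  by apply: eq_bigr => j _; rewrite scalerA.
have dc : (fun k => \sum_j d i j * c j k - (k == i)%:R) =1 fun=> 0.
  apply: (free_codomP fe); under eq_bigr => k _ do rewrite scalerBl.
  rewrite sumrB -compE; under eq_bigr => j _ do rewrite -fE.
  rewrite -eE (bigD1 i) //= eqxx scale1r big1 ?addr0 ?subrr //.
  by move=> k /negPf->; rewrite scale0r.
rewrite compE (bigD1 i) //= [X in _ = _ + X]big1 ?addr0.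
  by have /eqP := dc i; rewrite /= eqxx subr_eq0 => /eqP->; rewrite scale1r.
by move=> k /negPf ki; have /eqP := dc k; rewrite /= ki subr0 => /eqP->; rewrite scale0r.
Qed.

Lemma polymap_lincomb (c : 'I_n -> 'I_n -> K) :
  polymap (fun v : {ffun 'I_n -> V} => [ffun i => \sum_j c i j *: v j] : {ffun _}).
Proof.
apply: polymap_ffun => i.
apply: (@polymap_ext _ _ _ (fun v : {ffun 'I_n -> V} => \sum_j c i j *: v j)).
  by move=> v; rewrite ffunE.
apply: polymap_sum => j; apply: polymap_scale; first exact: polyfun_const.
exact/polymap_eval/polymap_id.
Qed.

Lemma sum_line_le (P : pred 'I_n) e f :
  (forall i, P i -> exists2 c : 'I_n -> K, (forall j, ~~ P j -> c j = 0) &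
             e i = \sum_j c j *: f j) ->
  (\sum_(i < n | P i) <[e i]> <= \sum_(i < n | P i) <[f i]>)%VS.
Proof.
move=> H; apply/subv_sumP => i /H ec; rewrite -memvE.
exact/memv_sum_lineP.
Qed.

(** The matrix taking w to w' is invertible and acts on all frames at once, preserving their
    spans. *)
Lemma zhomogeneous_grassmannian : zhomogeneous (grassmannian n V).
Proof.
move=> w w' /= fw fw' E.
have ex (a b : {ffun 'I_n -> V}) : <<codom a>>%VS = <<codom b>>%VS ->
    exists c : 'I_n -> 'I_n -> K, forall i, b i = \sum_j c i j *: a j.
  move=> ab; suff /choice[c cE] i : exists c : 'I_n -> K, b i = \sum_j c j *: a j.
    by exists c.
  have : b i \in <<codom a>>%VS by rewrite ab; apply/memv_span/codom_f.
  by rewrite span_codom => /memv_sum_lineP[c _ ->]; exists c.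
have [c cE] := ex _ _ E; have [d dE] := ex _ _ (esym E).
exists (fun v : {ffun 'I_n -> V} => [ffun i => \sum_j c i j *: v j]).
split; first exact: polymap_lincomb.
  by apply/ffunP => i; rewrite ffunE cE.
move=> v; rewrite /= !free_codom_dim !span_codom => fv.
set L := [ffun i => _].
suff -> : (\sum_(i < n) <[L i]> = \sum_(i < n) <[v i]>)%VS by [].
apply/eqP; rewrite eqEsubv; apply/andP; split; apply: sum_line_le => i _.
  by exists (c i); rewrite // ffunE.
exists (d i) => //; rewrite (lincomb_inverse v fw cE dE).
by apply: eq_bigr => j _; rewrite ffunE.
Qed.

(** Here the matrix and its inverse are both triangular, because the partial spans agree; so the
    partial spans of every frame are preserved. *)
Lemma zhomogeneous_flag : zhomogeneous (flag_variety n V).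
Proof.
move=> w w' /= fw fw' E.
have ex (a b : {ffun 'I_n -> V}) : @zcls _ (flag_variety n V) a = @zcls _ (flag_variety n V) b ->
    exists c : 'I_n -> 'I_n -> K, forall i : 'I_n, (forall j : 'I_n, (i < j)%N -> c i j = 0) /\
       b i = \sum_j c i j *: a j.
  move=> /ffunP ab; suff /choice[c cE] (i : 'I_n) : exists c : 'I_n -> K,
     (forall j : 'I_n, (i < j)%N -> c j = 0) /\ b i = \sum_j c j *: a j.
    by exists c.
  have lti : (i.+1 < n.+1)%N by rewrite ltnS ltn_ord.
  have : b i \in (\sum_(j < n | (j < Ordinal lti)%N) <[b j]>)%VS.
    by rewrite memvE (sumv_sup i) //=.
  move: (ab (Ordinal lti)); rewrite !ffunE => <- /memv_sum_lineP[c c0 ->].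
  by exists c; split=> // j ij; apply: c0; rewrite -leqNgt.
have [c cE] := ex _ _ E; have [d dE] := ex _ _ (esym E).
exists (fun v : {ffun 'I_n -> V} => [ffun i => \sum_j c i j *: v j]).
split; first exact: polymap_lincomb.
  by apply/ffunP => i; rewrite ffunE (cE i).2.
move=> v; rewrite /= => fv.
set L := [ffun i => _].
have LE m : (\sum_(i < n | (i < m)%N) <[L i]> = \sum_(i < n | (i < m)%N) <[v i]>)%VS.
  apply/eqP; rewrite eqEsubv; apply/andP; split; apply: sum_line_le => i im.
    exists (c i); last by rewrite ffunE.
    by move=> j; rewrite -leqNgt => mj; apply: (cE i).1; apply: leq_trans mj.
  exists (d i).
    by move=> j; rewrite -leqNgt => mj; apply: (dE i).1; apply: leq_trans mj.
  rewrite (lincomb_inverse v fw (fun i => (cE i).2) (fun i => (dE i).2)).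
  by apply: eq_bigr => j _; rewrite ffunE.
split; last by apply/ffunP => i; rewrite !ffunE LE.
move: fv; rewrite !free_codom_dim; have := LE n.
by under eq_bigl => i do rewrite ltn_ord; under [in RHS]eq_bigl => i do rewrite ltn_ord;
  move=> ->.
Qed.

(** Freeness need not be checked step by step: n vectors that span a space of dimension n are
    independent. *)
Lemma flag_of_frame (E : nat -> {vspace V}) e : E 0%N = 0%VS ->
  (forall i : 'I_n, E i.+1 = E i + <[e i]>)%VS -> \dim (E n) = n ->
  zframe (e : zcoord (flag_variety n V)) /\
  @zcls _ (flag_variety n V) e = [ffun i : 'I_n.+1 => E i].
Proof.
move=> E0 ES dE.
have sumE m : (m <= n)%N -> (\sum_(i < n | (i < m)%N) <[e i]>)%VS = E m.
  elim: m => [|m IH] mn; first by rewrite big_pred0.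
  rewrite (bigD1 (Ordinal mn)) //= addvC (ES (Ordinal mn)) -IH 1?ltnW //.
  congr (_ + _)%VS; apply: eq_bigl => i.
  by rewrite ltnS -val_eqE /= ltn_neqAle andbC.
split; last by apply/ffunP => i; rewrite !ffunE sumE // -ltnS.
rewrite /= free_codom_dim -[X in _ == X]dE -sumE //; apply/eqP; congr (\dim _).
by apply: eq_bigl => i; rewrite ltn_ord.
Qed.

End Frames.

(** * The blow-up of the plane *)

Section Grassmannians.
Variables (K : fieldType).
Implicit Type V W : vectType K.

Lemma zpoints_grassmannian V k (E : {vspace V}) :
  @zpoints _ (grassmannian k V) E <-> \dim E = k.
Proof.
split=> [[e fe <-]|<-]; first by rewrite (eqP fe) size_codom card_ord.
pose e : {ffun 'I_(\dim E) -> V} := [ffun i : 'I_(\dim E) => (vbasis E)`_i].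
have sE : <<codom e>>%VS = E.
  rewrite span_codom -[RHS](span_basis (vbasisP E)) span_def (big_nth 0) big_mkord.
  by rewrite size_tuple; apply: eq_bigr => i _; rewrite ffunE.
by exists e; rewrite //= free_codom_dim -span_codom sE.
Qed.

Definition frame1 V (a : V) : {ffun 'I_1 -> V} := [ffun=> a].
Definition frame2 V (a b : V) : {ffun 'I_2 -> V} :=
  [ffun i : 'I_2 => if i == ord0 then a else b].

Lemma span_frame1 V (a : V) : <<codom (frame1 a)>>%VS = <[a]>%VS.
Proof. by rewrite span_codom big_ord_recl big_ord0 addv0 ffunE. Qed.

Lemma span_frame2 V (a b : V) : <<codom (frame2 a b)>>%VS = (<[a]> + <[b]>)%VS.
Proof. by rewrite span_codom !big_ord_recl big_ord0 addv0 !ffunE. Qed.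

Lemma zframe_dim V k (e : {ffun 'I_k -> V}) :
  zframe (e : zcoord (grassmannian k V)) <-> \dim <<codom e>> = k.
Proof. by rewrite /= /free size_codom card_ord; split=> [/eqP|->]. Qed.

Lemma polymap_frame1 V W (f : W -> V) : polymap f -> polymap (fun w => frame1 (f w)).
Proof.
move=> fp; apply: polymap_ffun => i; apply: polymap_ext fp => w.
by rewrite ffunE.
Qed.

Lemma polymap_frame2 V W (f g : W -> V) :
  polymap f -> polymap g -> polymap (fun w => frame2 (f w) (g w)).
Proof.
move=> fp gp; apply: polymap_ffun => i.
have [i0|i0] := eqVneq i ord0.
  by apply: polymap_ext fp => w; rewrite ffunE i0 eqxx.
by apply: polymap_ext gp => w; rewrite ffunE (negPf i0).
Qed.

Lemma dim_two_lines V (a b : V) : a != 0 -> b \notin <[a]>%VS ->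
  \dim (<[a]> + <[b]>) = 2%N.
Proof. by move=> a0 ab; rewrite dim_addv_line // dim_vline a0. Qed.

Lemma dim_two_linesP V (a b : V) : \dim (<[a]> + <[b]>) = 2%N ->
  a != 0 /\ b \notin <[a]>%VS.
Proof.
move=> dab; split.
  apply: contra_eqN dab => /eqP->.
  by have /addv_idPr-> : (<[0 : V]> <= <[b]>)%VS; rewrite -?memvE ?mem0v // dim_vline;
    case: (b != 0).
apply: contra_eqN dab; rewrite memvE => /addv_idPl->.
by rewrite dim_vline; case: (a != 0).
Qed.

(** An equation of Z that is nonzero at [g 0] would be nonzero, together with d, at some t. This
    passage to the limit reaches the points of a closure that are not in the original set. *)
Lemma zclosed_curve (S : zspace K) (Z : set (zpt S)) (d : K^o -> K)
    (g : K^o -> zcoord S) :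
  [pchar K] =i pred0 -> zclosed Z -> polyfun d -> polymap g ->
  (exists t, d t != 0) -> zframe (g 0) ->
  (forall t, d t != 0 -> zframe (g t) /\ Z (zcls (g t))) -> Z (zcls (g 0)).
Proof.
move=> charK [P Pp ZP] dp gp [t0 dt0] fg0 H; apply/ZP => // p Pp'.
apply: contrapT => /eqP ne.
have [t] := polyfun_mul_neq0 charK dp (polyfun_comp gp (Pp _ Pp')) dt0 ne.
rewrite mulf_eq0 negb_or => /andP[/H[fg /ZP-/(_ fg _ Pp') ->]].
by rewrite eqxx.
Qed.

Definition rowcoef m (j : 'I_m) : 'Hom('rV[K]_m, K^o) :=
  linfun (fun v : 'rV[K]_m => v 0 j : K^o).

Lemma rowcoefE m (j : 'I_m) v : rowcoef j v = v 0 j.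
Proof.
pose f (v : 'rV[K]_m) : K^o := v 0 j.
have fL : linear f by move=> a x y; rewrite /f !mxE.
pose fM := GRing.isLinear.Build _ _ _ _ f fL.
pose fl : {linear 'rV[K]_m -> K^o} := HB.pack f fM.
exact: (lfunE fl).
Qed.

Lemma polyfun_rowcoef V m (f : V -> 'rV[K]_m) j :
  polymap f -> polyfun (fun v => f v 0 j).
Proof.
by move=> fp; apply: polyfun_ext (fp (rowcoef j)) => v; rewrite rowcoefE.
Qed.

Lemma polyfun_det V m (A : V -> 'M[K]_m) :
  (forall i j, polyfun (fun v => A v i j)) -> polyfun (fun v => \det (A v)).
Proof.
move=> Ap; apply: polyfun_sum => s; apply: polyfun_scale.
exact: polyfun_prod.
Qed.

End Grassmannians.

Section Blowup.
Variable K : fieldType.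
Hypothesis charK : [pchar K] =i pred0.

Local Notation row3 := 'rV[K]_3.

Definition e3 (i : nat) : row3 := delta_mx 0 (inord i).

Lemma e3E i j : (i < 3)%N -> (j < 3)%N -> e3 i 0 (inord j) = (j == i)%:R.
Proof. by move=> i3 j3; rewrite mxE eqxx -val_eqE /= !inordK. Qed.

Lemma row3P (x y : row3) : (forall j, (j < 3)%N -> x 0 (inord j) = y 0 (inord j)) -> x = y.
Proof. by move=> H; apply/rowP => j; rewrite -(inord_val j) H. Qed.

Lemma e3_neq0 i : (i < 3)%N -> e3 i != 0.
Proof.
move=> i3; apply/eqP => /rowP/(_ (inord i)); rewrite e3E // eqxx mxE.
by move/eqP; rewrite oner_eq0.
Qed.

Definition rows3 (x a b : row3) : 'M[K]_3 :=
  \matrix_(i < 3) (if val i is k.+1 then if k is 0 then a else b else x).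

Lemma polyfun_det3 (V : vectType K) (f g h : V -> row3) :
  polymap f -> polymap g -> polymap h ->
  polyfun (fun v => \det (rows3 (f v) (g v) (h v))).
Proof.
move=> fp gp hp; apply: polyfun_det => i j.
case: i => [[|[|[|//]]] lti].
- by apply: polyfun_ext (polyfun_rowcoef j fp) => w; rewrite mxE.
- by apply: polyfun_ext (polyfun_rowcoef j gp) => w; rewrite mxE.
- by apply: polyfun_ext (polyfun_rowcoef j hp) => w; rewrite mxE.
Qed.

Lemma mul_rows3 v x a b : v *m rows3 x a b =
  v 0 (inord 0) *: x + v 0 (inord 1) *: a + v 0 (inord 2) *: b.
Proof.
apply/rowP => j; rewrite !mxE !big_ord_recl big_ord0 addr0 !mxE /= addrA.
by congr (_ * _ + _ * _ + _ * _); congr (v 0 _); apply/val_inj; rewrite /= inordK.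
Qed.

(** A vector killed by the matrix is a relation between x, a and b; independence of a and b forces
    the coefficient of x to be nonzero. Membership in a plane is thus one polynomial equation. *)
Lemma det_rows3_eq0 x a b : \dim (<[a]> + <[b]>) = 2%N ->
  (\det (rows3 x a b) = 0 <-> x \in (<[a]> + <[b]>)%VS).
Proof.
move=> dab; split=> [/eqP/det0P[v v0]|/memv_addP[_ /vlineP[c ->] [_ /vlineP[c' ->] xE]]].
  have [a0 ba] := dim_two_linesP dab.
  rewrite mul_rows3; have [v0E|vx] := eqVneq (v 0 (inord 0)) 0.
    rewrite v0E scale0r add0r => E; have v2E : v 0 (inord 2) = 0.
      apply: contraNeq ba => v2; apply/vlineP.
      exists (- (v 0 (inord 1) / v 0 (inord 2))); apply: (scalerI v2).
      rewrite scalerA mulrN mulrC divfK // scaleNr.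
      by apply/eqP; rewrite -addr_eq0 addrC E.
    move: E; rewrite v2E scale0r addr0 => /eqP; rewrite scaler_eq0 (negPf a0) orbF.
    move=> /eqP v1E; case/eqP: v0; apply/rowP => i; rewrite mxE -(inord_val i).
    by case: (val i) (ltn_ord i) => [|[|[|]]].
  move=> /eqP; rewrite -addrA addr_eq0 => /eqP E.
  rewrite -[x](scalerK vx) E memvZ // memvN.
  by apply: memv_add; apply/memvZ/memv_line.
apply/eqP/det0P; exists (\row_j (if j == ord0 then -1 else if j == inord 1 then c else c')).
  by apply/eqP => /rowP/(_ ord0); rewrite !mxE => /eqP; rewrite oppr_eq0 oner_eq0.
have e0 : inord 0 = ord0 :> 'I_3 by apply/val_inj; rewrite /= inordK.
have e2 : (inord 2 == inord 1 :> 'I_3) = false by rewrite -val_eqE /= !inordK.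
have e1 : (inord 1 == ord0 :> 'I_3) = false by rewrite -val_eqE /= !inordK.
have e3 : (inord 2 == ord0 :> 'I_3) = false by rewrite -val_eqE /= !inordK.
rewrite mul_rows3 !mxE e0 eqxx e1 e3 eqxx e2 xE scaleN1r -addrA.
by rewrite addrC subrr.
Qed.

(** The blow-up as a closed incidence variety: a point of the plane with one line through it and
    each of the two centres. The defining closure of a graph is identified with it in [blowup2E]. *)
Definition incidence : set (zpt (blowup2_space K)) :=
  [set z | [/\ \dim z.1 = 1%N, \dim z.2.1 = 2%N & \dim z.2.2 = 2%N] /\
    [/\ (z.1 <= z.2.1)%VS, (z.1 <= z.2.2)%VS, e3 0 \in z.2.1 & e3 1 \in z.2.2]].

Lemma incidence_zpoints : incidence `<=` @zpoints _ (blowup2_space K).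
Proof.
move=> [x [P Q]] [[/= /zpoints_grassmannian[a fa <-] /zpoints_grassmannian[b fb <-]]].
by move=> /zpoints_grassmannian[c fc <-] _; exists (a, (b, c)).
Qed.

Lemma zhomogeneous_blowup2_space : zhomogeneous (blowup2_space K).
Proof. by do !apply: zhomogeneous_prod; apply: zhomogeneous_grassmannian. Qed.

Lemma frame2_eta (V : vectType K) (f : {ffun 'I_2 -> V}) : f = frame2 (f ord0) (f (inord 1)).
Proof.
apply/ffunP => i; rewrite ffunE; case: eqVneq => [->//|i0]; congr (f _).
by apply/val_inj; rewrite /= inordK //; case: i i0 => [[|[|]]].
Qed.

Lemma frame1_eta (V : vectType K) (f : {ffun 'I_1 -> V}) : f = frame1 (f ord0).
Proof. by apply/ffunP => i; rewrite ffunE ord1. Qed.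

Lemma zclosed_mem_plane (T : zspace K) (v : zcoord T -> row3)
   (p : zcoord T -> {ffun 'I_2 -> row3}) (Z : set (zpt T)) :
   polymap v -> polymap p -> (forall w, zframe w -> free (codom (p w))) ->
   (forall w, zframe w -> Z (zcls w) <-> v w \in <<codom (p w)>>%VS) -> zclosed Z.
Proof.
move=> vp pp pf ZP.
exists [set (fun w => \det (rows3 (v w) (p w ord0) (p w (inord 1))))].
  by move=> _ ->; apply: polyfun_det3 => //; apply: polymap_eval.
move=> w fw; have := pf _ fw; rewrite ZP // {1 2}(frame2_eta (p w)).
move=> /zframe_dim; rewrite span_frame2 => /det_rows3_eq0 H.
by split=> [/H E _ ->//|/(_ _ erefl)/H].
Qed.

Lemma e3_line_coef i j (x : row3) : (i < 3)%N -> (j < 3)%N -> j != i ->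
  x \in <[e3 i]>%VS -> x 0 (inord j) = 0.
Proof.
move=> i3 j3 ji /vlineP[c ->]; rewrite mxE e3E // (negPf ji) mulr0 //.
Qed.

Definition blowup_graph : set (zpt (blowup2_space K)) :=
  [set (x, ((<[e3 0]> + x)%VS, (<[e3 1]> + x)%VS)) | x in
    [set x | [/\ @zpoints _ (projective_space K 2) x,
       x <> <[e3 0]>%VS & x <> <[e3 1]>%VS]]].

Lemma incidence_closed : zclosed incidence.
Proof.
have pid := @polymap_id K (zcoord (blowup2_space K)).
have p1 := polymap_eval ord0 (polymap_fst pid).
have p2 := polymap_fst (polymap_snd pid).
have p3 := polymap_snd (polymap_snd pid).
pose Z1 : set (zpt (blowup2_space K)) := [set z | (z.1 <= z.2.1)%VS].
pose Z2 : set (zpt (blowup2_space K)) := [set z | (z.1 <= z.2.2)%VS].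
pose Z3 : set (zpt (blowup2_space K)) := [set z | e3 0 \in (z.2.1 : {vspace row3})].
pose Z4 : set (zpt (blowup2_space K)) := [set z | e3 1 \in (z.2.2 : {vspace row3})].
have c1 : zclosed Z1.
  apply: (zclosed_mem_plane p1 p2) => [w [_ []]//|w [_ _]].
  by rewrite /Z1 /= [w.1]frame1_eta span_frame1 ffunE memvE.
have c2 : zclosed Z2.
  apply: (zclosed_mem_plane p1 p3) => [w [_ []]//|w [_ _]].
  by rewrite /Z2 /= [w.1]frame1_eta span_frame1 ffunE memvE.
have c3 : zclosed Z3.
  by apply: (zclosed_mem_plane (polymap_const _ (e3 0)) p2) => [w [_ []]//|w [_ _]].
have c4 : zclosed Z4.
  by apply: (zclosed_mem_plane (polymap_const _ (e3 1)) p3) => [w [_ []]//|w [_ _]].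
have [P Pp PZ] := zclosed_cap (zclosed_cap c1 c2) (zclosed_cap c3 c4).
exists P => // w fw; rewrite -PZ //; case: fw => [f1 [f2 f3]].
split=> [[_ []]//|[[? ?] [? ?]]]; split; split=> //; exact/zframe_dim.
Qed.

Lemma graph_incidence : blowup_graph `<=` incidence.
Proof.
move=> _ [x [/zpoints_grassmannian/vline_exists[v v0 ->] x0 x1] <-].
split; split=> /=; rewrite ?dim_vline ?v0 ?addvSr ?(subvP (addvSl _ _)) ?memv_line //.
  by apply: dim_two_lines; rewrite ?e3_neq0 // vline_notin ?e3_neq0.
by apply: dim_two_lines; rewrite ?e3_neq0 // vline_notin ?e3_neq0.
Qed.

(** Subtracting its [e3 i] component normalises the second generator, which is then visibly
    independent of the centre and can serve as a direction of approach to it. *)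
Lemma plane_line_coef (P : {vspace row3}) i : (i < 3)%N -> \dim P = 2%N ->
  e3 i \in P -> exists y : row3, [/\ y 0 (inord i) = 0, y \notin <[e3 i]>%VS &
    P = (<[e3 i]> + <[y]>)%VS].
Proof.
move=> i3 dP eP.
have [||v [Pv nv ->]] := @addv_line_exists _ _ <[e3 i]>%VS P.
- by rewrite -memvE.
- by rewrite dP dim_vline e3_neq0.
exists (v - v 0 (inord i) *: e3 i); split.
- by rewrite !mxE !eqxx mulr1 subrr.
- by rewrite rpredBr // memvZ // memv_line.
apply: (@addv_lineC _ _ _ _ _ 1); first exact: oner_neq0.
by rewrite scale1r opprB addrC subrK memvZ // memv_line.
Qed.

(** Away from the centres both lines are determined by the point, so incidence and graph agree. Over
    a centre only the line through it is free, and the pair is a limit of graph points moving along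
    that line. *)
Lemma blowup2E : blowup2 <[e3 0]> <[e3 1]> = incidence.
Proof.
apply/seteqP; split=> [z [_]|z iz]; first by apply; [exact: incidence_closed|exact: graph_incidence].
split; first exact: incidence_zpoints.
move=> Z cZ GZ; case: z iz => [x [P Q]] [/= [dx dP dQ] [xP xQ eP eQ]].
have [v v0 xE] := vline_exists dx; subst x.
have pl i (U : {vspace row3}) : (i < 3)%N -> \dim U = 2%N -> e3 i \in U ->
    (<[v]> <= U)%VS -> <[v]>%VS <> <[e3 i]>%VS -> U = (<[e3 i]> + <[v]>)%VS.
  move=> i3 dU eU vU ne; apply: addv_line_dim; rewrite ?dim_vline ?e3_neq0 ?dU -?memvE //.
  by apply: vline_notin; rewrite ?e3_neq0.
have poly_t (a b : row3) : polymap (fun t : K^o => a + (t : K) *: b).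
  apply: polymap_add; first exact: polymap_const.
  apply: polymap_scale; last exact: polymap_const.
  by apply: polyfun_ext (@polymap_id K K^o \1%VF) => t; rewrite id_lfunE.
have pt : polyfun (fun t : K^o => t : K).
  by apply: polyfun_ext (@polymap_id K K^o \1%VF) => t; rewrite id_lfunE.
have graphP (a : row3) : a \notin <[e3 0]>%VS -> a \notin <[e3 1]>%VS ->
    Z (<[a]>%VS, ((<[e3 0]> + <[a]>)%VS, (<[e3 1]> + <[a]>)%VS)).
  move=> a0 a1; apply: GZ; exists <[a]>%VS => //; split.
  - apply/zpoints_grassmannian; rewrite dim_vline.
    by case: eqP a0 => // ->; rewrite mem0v.
  - by move=> E; rewrite -E memv_line in a0.
  - by move=> E; rewrite -E memv_line in a1.
have [x0|/eqP x0] := eqVneq <[v]>%VS <[e3 0]>%VS.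
  rewrite x0 in xP xQ *; have [y [y0 ny PE]] := plane_line_coef (isT : (0 < 3)%N) dP eP.
  have QE : Q = (<[e3 1]> + <[e3 0]>)%VS.
    apply: addv_line_dim; rewrite ?dim_vline ?e3_neq0 ?dQ -?memvE //.
    by apply/negP => /(@e3_line_coef 1 0 _ isT isT isT)/eqP; rewrite e3E // oner_eq0.
  (* The point leaves the centre along the line P = <e3 0, y>, which stays constant, while its line
     to the other centre varies with t. *)
  pose g (t : K^o) : zcoord (blowup2_space K) :=
    (frame1 (e3 0 + t *: y), (frame2 (e3 0) y, frame2 (e3 1) (e3 0 + t *: y))).
  have gfr t : zframe (g t).
    have n1 : e3 0 + t *: y \notin <[e3 1]>%VS.
      apply/negP => /(@e3_line_coef 1 0 _ isT isT isT)/eqP.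
      by rewrite mxE [(t *: y) _ _]mxE y0 mulr0 addr0 e3E // oner_eq0.
    split; [|split]; apply/zframe_dim; rewrite ?span_frame1 ?span_frame2.
    - by rewrite dim_vline; case: eqP n1 => // ->; rewrite mem0v.
    - by apply: dim_two_lines; rewrite ?e3_neq0.
    - by apply: dim_two_lines; rewrite ?e3_neq0.
  have -> : (<[e3 0]>%VS, (P, Q)) = zcls (g 0) :> zpt (blowup2_space K).
    by rewrite /= /zcls /= !span_frame1 !span_frame2 scale0r addr0 PE QE.
  apply: (zclosed_curve charK cZ pt) => //.
  - apply: polymap_pair; first exact: polymap_frame1.
    apply: polymap_pair; first by apply: polymap_frame2; exact: polymap_const.
    by apply: polymap_frame2 => //; exact: polymap_const.
  - by exists 1; rewrite oner_neq0.
  move=> t t0; split=> //; rewrite /= span_frame1 !span_frame2.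
  have -> : (<[e3 0]> + <[y]> = <[e3 0]> + <[e3 0 + t *: y]>)%VS.
    apply: esym; apply: (addv_lineC t0).
    by rewrite addrK memv_line.
  apply: graphP.
    by rewrite rpredDl ?memv_line // rpredZeq (negPf t0).
  apply/negP => /(@e3_line_coef 1 0 _ isT isT isT)/eqP.
  by rewrite mxE [(t *: y) _ _]mxE y0 mulr0 addr0 e3E // oner_eq0.
have PE := pl 0 _ isT dP eP xP x0.
have [x1|/eqP x1] := eqVneq <[v]>%VS <[e3 1]>%VS.
  rewrite x1 in PE xP xQ *; have [y [y0 ny QE]] := plane_line_coef (isT : (1 < 3)%N) dQ eQ.
  pose g (t : K^o) : zcoord (blowup2_space K) :=
    (frame1 (e3 1 + t *: y), (frame2 (e3 0) (e3 1 + t *: y), frame2 (e3 1) y)).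
  have n0 t : e3 1 + t *: y \notin <[e3 0]>%VS.
    apply/negP => /(@e3_line_coef 0 1 _ isT isT isT)/eqP.
    by rewrite mxE [(t *: y) _ _]mxE y0 mulr0 addr0 e3E // oner_eq0.
  have gfr t : zframe (g t).
    split; [|split]; apply/zframe_dim; rewrite ?span_frame1 ?span_frame2.
    - by rewrite dim_vline; case: eqP (n0 t) => // ->; rewrite mem0v.
    - by apply: dim_two_lines; rewrite ?e3_neq0.
    - by apply: dim_two_lines; rewrite ?e3_neq0.
  have -> : (<[e3 1]>%VS, (P, Q)) = zcls (g 0) :> zpt (blowup2_space K).
    by rewrite /= /zcls /= !span_frame1 !span_frame2 scale0r addr0 PE QE.
  apply: (zclosed_curve charK cZ pt) => //.
  - apply: polymap_pair; first exact: polymap_frame1.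
    apply: polymap_pair; last by apply: polymap_frame2; exact: polymap_const.
    by apply: polymap_frame2 => //; exact: polymap_const.
  - by exists 1; rewrite oner_neq0.
  move=> t t0; split=> //; rewrite /= span_frame1 !span_frame2.
  have -> : (<[e3 1]> + <[y]> = <[e3 1]> + <[e3 1 + t *: y]>)%VS.
    apply: esym; apply: (addv_lineC t0).
    by rewrite addrK memv_line.
  apply: graphP => //.
  by rewrite rpredDl ?memv_line // rpredZeq (negPf t0).
have QE := pl 1 _ isT dQ eQ xQ x1.
by rewrite PE QE; apply: graphP; apply: vline_notin; rewrite ?e3_neq0.
Qed.

(** The graph is parametrised by the vectors outside the two centres, among them all vectors with
    nonzero third coordinate. *)
Lemma irreducible_blowup2 : irreducible (blowup2 <[e3 0]> <[e3 1]>).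
Proof.
apply: irreducible_closure => [x /graph_incidence|]; first exact: incidence_zpoints.
pose g (v : row3) : zcoord (blowup2_space K) :=
  (frame1 v, (frame2 (e3 0) v, frame2 (e3 1) v)).
pose D : set row3 := [set v | v \notin <[e3 0]>%VS /\ v \notin <[e3 1]>%VS].
have gp : polymap g.
  have pid := @polymap_id K row3.
  apply: polymap_pair; first exact: polymap_frame1.
  by apply: polymap_pair; apply: polymap_frame2 => //; exact: polymap_const.
have Dn v : D v -> v != 0 by move=> [vn _]; apply: contraNneq vn => ->; exact: mem0v.
change (irreducible blowup_graph); rewrite (_ : blowup_graph = (fun v => zcls (g v)) @` D).
  apply: (irreducible_param charK gp (polyfun_rowcoef (inord 2) (@polymap_id K row3))).
  - by exists (e3 2); rewrite e3E // oner_neq0.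
  - move=> v Dv; case: (Dv) => v0 v1.
    split; [|split]; apply/zframe_dim; rewrite ?span_frame1 ?span_frame2.
    + by rewrite dim_vline Dn.
    + by apply: dim_two_lines; rewrite ?e3_neq0.
    + by apply: dim_two_lines; rewrite ?e3_neq0.
  - move=> v v2; split; apply: contraNN v2 => vl; apply/eqP; exact: e3_line_coef vl.
apply/seteqP; split=> [_ [x [/zpoints_grassmannian/vline_exists[v v0 ->] x0 x1] <-]|].
  exists v; last by rewrite /= /zcls /= !span_frame1 !span_frame2.
  by split; apply: vline_notin; rewrite ?e3_neq0.
move=> _ [v Dv <-]; exists <[v]>%VS; last by rewrite /= /zcls /= !span_frame1 !span_frame2.
split; first by apply/zpoints_grassmannian; rewrite dim_vline Dn.
  by case: Dv => + _ E; rewrite -E memv_line.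
by case: Dv => _ + E; rewrite -E memv_line.
Qed.

End Blowup.

(** * Irreducibility of the projective line *)

Section ProjectiveLine.
Variable K : fieldType.
Hypothesis charK : [pchar K] =i pred0.

Lemma irreducible_line : irreducible (@zpoints _ (projective_space K 1)).
Proof.
have pid := @polymap_id K 'rV[K]_2.
rewrite (_ : zpoints (S:=_) =
  (fun v : 'rV[K]_2 => @zcls _ (projective_space K 1) (frame1 v)) @` [set v | v != 0]).
  apply: (irreducible_param (S := projective_space K 1) charK
    (polymap_frame1 pid) (polyfun_rowcoef ord0 pid)).
  - by exists (delta_mx 0 ord0); rewrite mxE !eqxx oner_neq0.
  - by move=> v v0; apply/zframe_dim; rewrite span_frame1 dim_vline v0.
  - by move=> v; apply: contraNneq => ->; rewrite mxE.
apply/seteqP; split=> [x /zpoints_grassmannian/vline_exists[v v0 ->]|_ [v v0 <-]].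
  by exists v; rewrite //= span_frame1.
by apply/zpoints_grassmannian; rewrite /= span_frame1 dim_vline v0.
Qed.

End ProjectiveLine.

(** * Standard form of X *)

Section Bilinear.
Variables (K : fieldType) (V : vectType K) (b : 'Hom(V, dualv V)).
Lemma bilin_addl x y z : b (x + y) z = b x z + b y z.
Proof. by rewrite linearD; exact: add_lfunE. Qed.
Lemma bilin_scalel c x z : b (c *: x) z = c * b x z.
Proof. by rewrite linearZ; exact: scale_lfunE. Qed.
Lemma bilin_zerol z : b 0 z = 0.
Proof. by rewrite linear0; exact: zero_lfunE. Qed.
Lemma bilin_addr x y z : b x (y + z) = b x y + b x z.
Proof. exact: linearD. Qed.
Lemma bilin_scaler c x z : b x (c *: z) = c * b x z.
Proof. exact: linearZ. Qed.
End Bilinear.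

Lemma lformZ (K : fieldType) (V : vectType K) (l : 'Hom(V, K^o)) c x :
  l (c *: x) = c * l x.
Proof. exact: linearZ. Qed.

Lemma lformB (K : fieldType) (V : vectType K) (l : 'Hom(V, K^o)) x y :
  l (x - y) = l x - l y.
Proof. exact: linearB. Qed.

Lemma lformD (K : fieldType) (V : vectType K) (l : 'Hom(V, K^o)) x y :
  l (x + y) = l x + l y.
Proof. exact: linearD. Qed.

(* P 0, Q 0, P 1, Q 1, ... are the boxes of the long line of the diagram of X,
   starting from the kernel; only the first 2n - 1 of its 4n - 3 boxes matter.
   The lines 01 and 10 are (a0, a1) and (b1, b0). *)
Record standard_form (K : fieldType) (n : nat) (V0 V1 : vectType K)
    (phi : 'Hom(V0, dualv V0)) (psi : 'Hom(V1, dualv V1))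
    (u : 'Hom(V0, V1)) (us : 'Hom(V1, V0)) (P : nat -> V0) (Q : nat -> V1)
    (a0 b0 : V0) (a1 b1 : V1) : Prop := StandardForm {
  sf_adj : forall v x, phi (us v) x = psi v (u x);
  sf_sym : bilin_symmetric phi;
  sf_alt : bilin_alternating psi;
  sf_P0 : P 0%N != 0;
  sf_uP0 : u (P 0%N) = 0;
  sf_uP : forall j, (j.+1 < n)%N -> u (P j.+1) = Q j;
  sf_usQ : forall j, (j.+1 < n)%N -> us (Q j) = P j;
  sf_ua0 : u a0 = 0;
  sf_ub0 : u b0 = b1;
  sf_usa1 : us a1 = a0;
  sf_usb1 : us b1 = 0;
  sf_keru : forall x, u x = 0 -> x \in (<[P 0%N]> + <[a0]>)%VS;
  sf_kerus : forall v, us v = 0 -> v \in <[b1]>%VS;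
  sf_PP : forall j k, (j < n)%N -> (k < n)%N -> (j + k < 2 * n - 2)%N ->
    phi (P j) (P k) = 0;
  sf_Pn : phi (P n.-1) (P n.-1) != 0;
  sf_aP : forall j, (j < n)%N -> phi a0 (P j) = 0;
  sf_bP : forall j, (j < n)%N -> phi b0 (P j) = 0;
  sf_ab : phi a0 b0 = 1;
  sf_bb : phi b0 b0 = 0 }.

Section Sections.
Variables (K : fieldType) (V W : vectType K).

Definition rank_one (l : 'Hom(V, K^o)) (w : W) : 'Hom(V, W) :=
  linfun (fun x => (l x : K) *: w).

Lemma rank_oneE l w x : rank_one l w x = (l x : K) *: w.
Proof.
pose f x := (l x : K) *: w.
have fL : linear f by move=> a y z; rewrite /f linearP scalerDl -scalerA.
pose fM := GRing.isLinear.Build _ _ _ _ f fL.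
pose fl : {linear V -> W} := HB.pack f fM.
exact: (lfunE fl).
Qed.

Variables (U E : {vspace V}) (p : 'Hom(V, W)) (i : 'Hom(W, V)).
Hypothesis UE : (U <= E)%VS.
Hypothesis ip : forall x, x \in E -> x - i (p x) \in U.

(** The hypotheses say that i is a section of p on E modulo U; this recovers a member of a flag from
    its image in a small coordinate space. *)
Lemma section_eq : E = (U + i @: (p @: E))%VS.
Proof.
apply/eqP; rewrite eqEsubv subv_add UE; apply/andP; split.
  apply/subvP => x xE; rewrite -[x](subrK (i (p x))) memv_add ?ip //.
  by rewrite !memv_img.
apply/subvP => _ /memv_imgP[_ /memv_imgP[x xE ->] ->].
by have := memvB xE (subvP UE _ (ip xE)); rewrite opprB subrKC.
Qed.

Lemma section_dim : (forall x, x \in U -> p x = 0) ->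
  \dim (p @: E) = (\dim E - \dim U)%N.
Proof.
move=> p0; rewrite -(limg_ker_dim p E) (_ : E :&: lker p = U)%VS ?addKn //.
apply/eqP; rewrite eqEsubv subv_cap UE /=; apply/andP; split; apply/subvP => x.
  rewrite memv_cap memv_ker => /andP[xE /eqP px].
  by have := ip xE; rewrite px linear0 subr0.
by move=> /p0 px; rewrite memv_ker px.
Qed.

End Sections.

Section StandardForm.
Variables (K : fieldType) (n : nat) (V0 V1 : vectType K).
Variables (phi : 'Hom(V0, dualv V0)) (psi : 'Hom(V1, dualv V1)).
Variables (u : 'Hom(V0, V1)) (us : 'Hom(V1, V0)) (P : nat -> V0) (Q : nat -> V1).
Variables (a0 b0 : V0) (a1 b1 : V1).
Hypothesis sf : standard_form n phi psi u us P Q a0 b0 a1 b1.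

Definition Aspace j : {vspace V0} := (\sum_(i < j) <[P i]>)%VS.
Definition Dspace j : {vspace V1} := (\sum_(i < j) <[Q i]>)%VS.
(** The analysis stays inside these spaces: u^-1 of N_j lies in M_(j+1) and us^-1 of M_j in N_j, and
    on them phi and psi depend on a few coefficients only. *)
Definition Mspace j : {vspace V0} := (Aspace j + <[a0]> + <[b0]>)%VS.
Definition Nspace j : {vspace V1} := (Dspace j + <[a1]> + <[b1]>)%VS.

Local Notation A := Aspace.
Local Notation D := Dspace.
Local Notation M := Mspace.
Local Notation N := Nspace.

Lemma Aspace0 : A 0 = 0%VS. Proof. by rewrite /Aspace big_ord0. Qed.
Lemma Dspace0 : D 0 = 0%VS. Proof. by rewrite /Dspace big_ord0. Qed.
Lemma AspaceS j : A j.+1 = (A j + <[P j]>)%VS.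
Proof. by rewrite /Aspace big_ord_recr. Qed.
Lemma DspaceS j : D j.+1 = (D j + <[Q j]>)%VS.
Proof. by rewrite /Dspace big_ord_recr. Qed.

Lemma Aspace_le j k : (j <= k)%N -> (A j <= A k)%VS.
Proof.
elim: k => [|k IH]; first by rewrite leqn0 => /eqP->.
rewrite leq_eqVlt => /orP[/eqP->//|/IH jk].
by apply: subv_trans jk _; rewrite AspaceS addvSl.
Qed.

Lemma Dspace_le j k : (j <= k)%N -> (D j <= D k)%VS.
Proof.
elim: k => [|k IH]; first by rewrite leqn0 => /eqP->.
rewrite leq_eqVlt => /orP[/eqP->//|/IH jk].
by apply: subv_trans jk _; rewrite DspaceS addvSl.
Qed.

Lemma memA j k : (j < k)%N -> P j \in A k.
Proof. by move=> jk; apply: (subvP (Aspace_le jk)); rewrite AspaceS (subvP (addvSr _ _)) ?memv_line. Qed.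

Lemma memD j k : (j < k)%N -> Q j \in D k.
Proof. by move=> jk; apply: (subvP (Dspace_le jk)); rewrite DspaceS (subvP (addvSr _ _)) ?memv_line. Qed.

Lemma Mspace_le j k : (j <= k)%N -> (M j <= M k)%VS.
Proof. by move=> jk; rewrite !addvS // Aspace_le. Qed.

Lemma Nspace_le j k : (j <= k)%N -> (N j <= N k)%VS.
Proof. by move=> jk; rewrite !addvS // Dspace_le. Qed.

Lemma A_sub_M j : (A j <= M j)%VS.
Proof. by rewrite /Mspace -addvA addvSl. Qed.
Lemma D_sub_N j : (D j <= N j)%VS.
Proof. by rewrite /Nspace -addvA addvSl. Qed.
Lemma Aa_sub_M j : (A j + <[a0]> <= M j)%VS. Proof. exact: addvSl. Qed.
Lemma Ab_sub_M j : (A j + <[b0]> <= M j)%VS.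
Proof. by rewrite addvS // addvSl. Qed.

Lemma limg_u_A j : (j < n)%N -> (u @: A j.+1 = D j)%VS.
Proof.
move=> jn; rewrite /Aspace big_ord_recl limgD limg_line (sf_uP0 sf) limg_sum.
have /addv_idPr-> : (<[0 : V1]> <= \sum_(i < j) u @: <[P (lift ord0 i)]>)%VS.
  by rewrite -memvE mem0v.
apply: eq_bigr => i _; rewrite limg_line lift0 (sf_uP sf) //.
by apply: leq_ltn_trans jn; rewrite ltn_ord.
Qed.

Lemma limg_us_D j : (j < n)%N -> (us @: D j = A j)%VS.
Proof.
move=> jn; rewrite /Dspace limg_sum; apply: eq_bigr => i _.
by rewrite limg_line (sf_usQ sf) // (leq_ltn_trans _ jn) // ltn_ord.
Qed.

Lemma psi_anti x y : psi x y = - psi y x.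
Proof.
apply/eqP; rewrite -addr_eq0; have := sf_alt sf (x + y).
by rewrite bilin_addl !bilin_addr !(sf_alt sf) add0r addr0 => /eqP.
Qed.

Lemma phi_a0a0 : phi a0 a0 = 0.
Proof. by rewrite -{1}(sf_usa1 sf) (sf_adj sf) (sf_ua0 sf) linear0. Qed.

Lemma phi_b0a0 : phi b0 a0 = 1. Proof. by rewrite (sf_sym sf) (sf_ab sf). Qed.

Lemma psi_a1b1 : psi a1 b1 = 1.
Proof. by rewrite -(sf_ub0 sf) -(sf_adj sf) (sf_usa1 sf) (sf_ab sf). Qed.

(* fa, fb, ga and gb are the coefficients at a0, b0, a1 and b1. *)
Definition fa : 'Hom(V0, K^o) := phi b0.
Definition fb : 'Hom(V0, K^o) := phi a0.
Definition ga : 'Hom(V1, K^o) := - psi b1.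
Definition gb : 'Hom(V1, K^o) := psi a1.

Lemma fa_us v : fa (us v) = ga v.
Proof. by rewrite /fa (sf_sym sf) (sf_adj sf) (sf_ub0 sf) opp_lfunE psi_anti. Qed.
Lemma fb_us v : fb (us v) = 0.
Proof. by rewrite /fb (sf_sym sf) (sf_adj sf) (sf_ua0 sf) linear0. Qed.
Lemma ga_u x : ga (u x) = 0.
Proof. by rewrite /ga opp_lfunE -(sf_adj sf) (sf_usb1 sf) bilin_zerol oppr0. Qed.
Lemma gb_u x : gb (u x) = fb x.
Proof. by rewrite /gb -(sf_adj sf) (sf_usa1 sf). Qed.

Lemma fa_a0 : fa a0 = 1. Proof. exact: phi_b0a0. Qed.
Lemma fa_b0 : fa b0 = 0. Proof. exact: (sf_bb sf). Qed.
Lemma fb_a0 : fb a0 = 0. Proof. exact: phi_a0a0. Qed.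
Lemma fb_b0 : fb b0 = 1. Proof. exact: (sf_ab sf). Qed.
Lemma ga_a1 : ga a1 = 1. Proof. by rewrite -fa_us (sf_usa1 sf) fa_a0. Qed.
Lemma ga_b1 : ga b1 = 0. Proof. by rewrite -fa_us (sf_usb1 sf) linear0. Qed.
Lemma gb_a1 : gb a1 = 0. Proof. exact: (sf_alt sf). Qed.
Lemma gb_b1 : gb b1 = 1. Proof. exact: psi_a1b1. Qed.

Lemma lin_A0 (l : 'Hom(V0, K^o)) j x :
  (forall i, (i < j)%N -> l (P i) = 0) -> x \in A j -> l x = 0.
Proof.
move=> l0; have : (A j <= lker l)%VS.
  by apply/subv_sumP => i _; rewrite -memvE memv_ker l0.
by move=> /subvP H /H; rewrite memv_ker => /eqP.
Qed.

Lemma fa_A j x : (j <= n)%N -> x \in A j -> fa x = 0.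
Proof. by move=> jn; apply: lin_A0 => i ij; apply: (sf_bP sf); apply: leq_trans jn. Qed.
Lemma fb_A j x : (j <= n)%N -> x \in A j -> fb x = 0.
Proof. by move=> jn; apply: lin_A0 => i ij; apply: (sf_aP sf); apply: leq_trans jn. Qed.
Lemma ga_D j v : (j < n)%N -> v \in D j -> ga v = 0.
Proof.
by move=> jn vD; rewrite -fa_us; apply: (fa_A (ltnW jn)); rewrite -limg_us_D ?memv_img.
Qed.
Lemma gb_D j v : (j < n)%N -> v \in D j -> gb v = 0.
Proof.
move=> jn; rewrite -limg_u_A // => /memv_imgP[x xA ->].
by rewrite gb_u (fb_A jn xA).
Qed.

(** The indices of P occurring are at most j - 1 and k - 1, so their sum stays below 2n - 2. *)
Lemma phi_A j k x y : (j <= n)%N -> (k <= n)%N -> (j + k < 2 * n)%N ->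
  x \in A j -> y \in A k -> phi x y = 0.
Proof.
move=> jn kn jkn xA yA; apply: (lin_A0 _ yA) => i ik; rewrite (sf_sym sf).
apply: (lin_A0 _ xA) => i' ij; apply: (sf_PP sf); first exact: leq_trans kn.
  exact: leq_trans jn.
rewrite ltn_subRL add2n; apply: leq_ltn_trans jkn.
by have := leq_add ij ik; rewrite addSn addnS (addnC i').
Qed.

(** Writing y = u z with z in A_(k+1) turns psi x y into phi (us x) z, which pairs A_j with
    A_(k+1). *)
Lemma psi_D j k x y : (j < n)%N -> (k < n)%N -> x \in D j -> y \in D k -> psi x y = 0.
Proof.
move=> jn kn xD; rewrite -limg_u_A // => /memv_imgP[z zA ->].
rewrite -(sf_adj sf); apply: phi_A zA; [exact: ltnW jn|exact: kn| |].
  by rewrite mul2n -addnn; apply: leq_trans (leq_add jn kn); rewrite addSn.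
by rewrite -limg_us_D // memv_img.
Qed.

(** [fa] and [fb] vanish on A_j and are dual to a0 and b0, so they read off the two extra
    coefficients. *)
Lemma memMP j x : (j <= n)%N ->
  (x \in M j) = (x - fa x *: a0 - fb x *: b0 \in A j).
Proof.
move=> jn; apply/idP/idP.
  move=> /memv_addv_lineP[d /memv_addv_lineP[c yA]].
  have := fa_A jn yA; have := fb_A jn yA.
  rewrite !lformB !lformZ fa_a0 fa_b0 fb_a0 fb_b0.
  rewrite !mulr0 !mulr1 !subr0 => /eqP; rewrite subr_eq0 => /eqP -> /eqP.
  by rewrite subr_eq0 => /eqP ->; rewrite addrAC.
move=> H; apply/memv_addv_lineP; exists (fb x); apply/memv_addv_lineP.
by exists (fa x); rewrite addrAC.
Qed.

Lemma memNP j v : (j < n)%N ->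
  (v \in N j) = (v - ga v *: a1 - gb v *: b1 \in D j).
Proof.
move=> jn; apply/idP/idP.
  move=> /memv_addv_lineP[d /memv_addv_lineP[c yD]].
  have := ga_D jn yD; have := gb_D jn yD.
  rewrite !lformB !lformZ ga_a1 ga_b1 gb_a1 gb_b1.
  rewrite !mulr0 !mulr1 !subr0 => /eqP; rewrite subr_eq0 => /eqP -> /eqP.
  by rewrite subr_eq0 => /eqP ->; rewrite addrAC.
move=> H; apply/memv_addv_lineP; exists (gb v); apply/memv_addv_lineP.
by exists (ga v); rewrite addrAC.
Qed.

Lemma mem_Aa j x : (j <= n)%N -> (x \in A j + <[a0]>)%VS = (x \in M j) && (fb x == 0).
Proof.
move=> jn; apply/idP/andP.
  move=> xA; split; first by apply: (subvP (Aa_sub_M j)).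
  move: xA => /memv_addv_lineP[c /(fb_A jn)].
  by rewrite lformB lformZ fb_a0 mulr0 subr0 => ->.
rewrite memMP // => -[H /eqP E]; apply/memv_addv_lineP; exists (fa x).
by move: H; rewrite E scale0r subr0.
Qed.

Lemma mem_Ab j x : (j <= n)%N -> (x \in A j + <[b0]>)%VS = (x \in M j) && (fa x == 0).
Proof.
move=> jn; apply/idP/andP.
  move=> xA; split; first by apply: (subvP (Ab_sub_M j)).
  move: xA => /memv_addv_lineP[c /(fa_A jn)].
  by rewrite lformB lformZ fa_b0 mulr0 subr0 => ->.
rewrite memMP // => -[H /eqP E]; apply/memv_addv_lineP; exists (fb x).
by move: H; rewrite E scale0r subr0.
Qed.

Lemma mem_Db j v : (j < n)%N -> (v \in D j + <[b1]>)%VS = (v \in N j) && (ga v == 0).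
Proof.
move=> jn; apply/idP/andP.
  move=> vD; split; first by apply: (subvP _ _ vD); rewrite addvS ?addvSl.
  move: vD => /memv_addv_lineP[c /(ga_D jn)].
  by rewrite lformB lformZ ga_b1 mulr0 subr0 => ->.
rewrite memNP // => -[H /eqP E]; apply/memv_addv_lineP; exists (gb v).
by move: H; rewrite E scale0r subr0.
Qed.

Lemma mem_A j x : (j <= n)%N -> x \in M j -> fa x = 0 -> fb x = 0 -> x \in A j.
Proof. by move=> jn; rewrite memMP // => + ax bx; rewrite ax bx !scale0r !subr0. Qed.

Lemma mem_D j v : (j < n)%N -> v \in N j -> ga v = 0 -> gb v = 0 -> v \in D j.
Proof. by move=> jn; rewrite memNP // => + ax bx; rewrite ax bx !scale0r !subr0. Qed.

(** Once its b0-component is removed, u x lies in D_j = u A_(j+1); what remains is in the kernel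
    <P_0, a0> of u. *)
Lemma u_preimage j x : (j < n)%N -> u x \in N j -> x \in M j.+1.
Proof.
move=> jn; rewrite memNP // ga_u scale0r subr0 gb_u -limg_u_A //.
case/memv_imgP => y yA E.
have /(sf_keru sf) : u (x - fb x *: b0 - y) = 0.
  by rewrite !linearB linearZ /= (sf_ub0 sf) E subrr.
move=> /(subvP (addvS (_ : (<[P 0%N]> <= A j.+1)%VS) (subvv _))).
rewrite -memvE memA // => /(_ isT) H.
have : x - fb x *: b0 \in (A j.+1 + <[a0]>)%VS.
  by rewrite -[_ - _](subrK y) memvD // (subvP (addvSl _ _)).
by move=> ?; apply/memv_addv_lineP; exists (fb x).
Qed.

(** The same argument with D_j mapping onto A_j, and with the kernel <b1> of [us]. *)
Lemma us_preimage j v : (j < n)%N -> us v \in M j -> v \in N j.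
Proof.
move=> jn; rewrite memMP ?(ltnW jn) // fb_us scale0r subr0 fa_us -limg_us_D //.
case/memv_imgP => y yD E.
have /(sf_kerus sf)/vlineP[c cE] : us (v - ga v *: a1 - y) = 0.
  by rewrite !linearB linearZ /= (sf_usa1 sf) E subrr.
apply/memv_addv_lineP; exists c; apply/memv_addv_lineP; exists (ga v).
by rewrite -cE !opprB addrCA subrKC addrK.
Qed.

Lemma u_A j x : (j < n)%N -> x \in A j.+1 -> u x \in D j.
Proof. by move=> jn xA; rewrite -limg_u_A // memv_img. Qed.

Lemma us_N j v : (j < n)%N -> v \in N j -> us v \in M j.
Proof.
move=> jn; rewrite memNP // => H; rewrite memMP ?(ltnW jn) // fa_us fb_us scale0r subr0.
have := memv_img us H; rewrite limg_us_D // !linearB !linearZ /=.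
by rewrite (sf_usa1 sf) (sf_usb1 sf) oppr0 scaler0 addr0.
Qed.

(** Applying [us] after [u] lowers the index by one; at j = 0 the forms [fa] and [fb] vanish on P_0,
    which is nonzero. *)
Lemma P_notin_M j : (j < n)%N -> P j \notin M j.
Proof.
elim: j => [|j IH] jn; apply/negP.
  rewrite memMP // Aspace0 /fa /fb (sf_aP sf) // (sf_bP sf) // !scale0r !subr0.
  by rewrite memv0 (negPf (sf_P0 sf)).
rewrite memMP ?(ltnW jn) // /fa /fb (sf_aP sf) // (sf_bP sf) // !scale0r !subr0.
move=> /(u_A (ltnW jn)); rewrite (sf_uP sf) // => /(memv_img us).
rewrite (sf_usQ sf) // limg_us_D ?(ltnW jn) // => /(subvP (A_sub_M j)).
by apply/negP/IH/ltnW.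
Qed.

(* mu j and nu j extract the coefficients at P j and Q j modulo M j and N j. *)
Definition mu j : 'Hom(V0, K^o) := sep_form (M j) (P j).
Definition nu j : 'Hom(V1, K^o) := (mu j \o us)%VF.

Lemma mu_P j : (j < n)%N -> mu j (P j) = 1.
Proof. by move=> /P_notin_M/sep_formP[]. Qed.
Lemma mu_M j x : (j < n)%N -> x \in M j -> mu j x = 0.
Proof. by move=> /P_notin_M/sep_formP[_]; apply. Qed.
Lemma nu_Q j : (j.+1 < n)%N -> nu j (Q j) = 1.
Proof. by move=> jn; rewrite comp_lfunE (sf_usQ sf) // mu_P // ltnW. Qed.
Lemma nu_N j v : (j < n)%N -> v \in N j -> nu j v = 0.
Proof. by move=> jn vN; rewrite comp_lfunE mu_M // us_N. Qed.

Lemma memM_S j x : (j < n)%N ->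
  (x \in M j.+1) = (x - mu j x *: P j \in M j).
Proof.
move=> jn; have E : M j.+1 = (M j + <[P j]>)%VS.
  by rewrite /Mspace AspaceS -!addvA; congr (_ + _)%VS; rewrite addvC addvA.
rewrite E; apply/memv_addv_lineP/idP => [[c H]|]; last by exists (mu j x).
have := mu_M jn H; rewrite lformB lformZ mu_P // mulr1.
by move=> /eqP; rewrite subr_eq0 => /eqP->.
Qed.

Lemma memN_S j v : (j.+1 < n)%N ->
  (v \in N j.+1) = (v - nu j v *: Q j \in N j).
Proof.
move=> jn; have E : N j.+1 = (N j + <[Q j]>)%VS.
  by rewrite /Nspace DspaceS -!addvA; congr (_ + _)%VS; rewrite addvC addvA.
rewrite E; apply/memv_addv_lineP/idP => [[c H]|]; last by exists (nu j v).
have := nu_N (ltnW jn) H; rewrite lformB lformZ nu_Q // mulr1.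
by move=> /eqP; rewrite subr_eq0 => /eqP->.
Qed.

Lemma dimA j : (j <= n)%N -> \dim (A j) = j.
Proof.
elim: j => [|j IH] jn; first by rewrite Aspace0 dimv0.
rewrite AspaceS dim_addv_line ?IH ?(ltnW jn) //.
by apply: contra (P_notin_M jn); apply/subvP/A_sub_M.
Qed.

Lemma Q_notin_N j : (j.+1 < n)%N -> Q j \notin N j.
Proof.
move=> jn; apply/negP => /(us_N (ltnW jn)); rewrite (sf_usQ sf) //.
by apply/negP/P_notin_M/ltnW.
Qed.

Lemma dimD j : (j < n)%N -> \dim (D j) = j.
Proof.
elim: j => [|j IH] jn; first by rewrite Dspace0 dimv0.
rewrite DspaceS dim_addv_line ?IH ?(ltnW jn) //.
by apply: contra (Q_notin_N jn); apply/subvP/D_sub_N.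
Qed.

Lemma dim_A_line j x : (j <= n)%N -> x \in M 0 -> x != 0 ->
  x \notin A j /\ \dim (A j + <[x]>) = j.+1.
Proof.
move=> jn; rewrite memMP // Aspace0 memv0 => /eqP xE x0.
have xA : x \notin A j.
  apply: contra_neqN x0 => xA; move: xE; rewrite (fa_A jn xA) (fb_A jn xA).
  by rewrite !scale0r !subr0.
by rewrite xA dim_addv_line ?dimA.
Qed.

Lemma dim_D_line j v : (j < n)%N -> v \in N 0 -> v != 0 ->
  v \notin D j /\ \dim (D j + <[v]>) = j.+1.
Proof.
move=> jn; rewrite memNP ?(leq_ltn_trans _ jn) // Dspace0 memv0 => /eqP vE v0.
have vD : v \notin D j.
  apply: contra_neqN v0 => vD; move: vE; rewrite (ga_D jn vD) (gb_D jn vD).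
  by rewrite !scale0r !subr0.
by rewrite vD dim_addv_line ?dimD.
Qed.

Lemma dimN j : (j < n)%N -> \dim (N j) = j.+2.
Proof.
move=> jn; have a1N : a1 \in N 0.
  by rewrite (subvP (_ : (D 0 + <[a1]> <= _)%VS)) ?addvSl // (subvP (addvSr _ _)) ?memv_line.
have a10 : a1 != 0 by apply: contra_eqN psi_a1b1 => /eqP->; rewrite bilin_zerol eq_sym oner_eq0.
rewrite dim_addv_line; first by have [_ ->] := dim_D_line jn a1N a10.
apply/negP => /memv_addv_lineP[c /(gb_D jn)/eqP].
by rewrite lformB lformZ gb_a1 gb_b1 mulr0 subr0 oner_eq0.
Qed.

(* D j is the radical of psi on N j. *)
Lemma isotropic_in_N j (F : {vspace V1}) : (j < n)%N -> (F <= N j)%VS ->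
  (forall x y, x \in F -> y \in F -> psi x y = 0) -> \dim F = j.+1 ->
  exists w, [/\ w \in N 0, w != 0 & F = (D j + <[w]>)%VS].
Proof.
move=> jn FN iso dF.
have orth x y : x \in D j -> y \in N j -> psi x y = 0.
  move=> xD; rewrite memNP // => yD.
  have -> : y = (y - ga y *: a1 - gb y *: b1) + gb y *: b1 + ga y *: a1.
    by rewrite !subrK.
  rewrite bilin_addr bilin_addr !bilin_scaler (psi_D jn jn xD yD) add0r (psi_anti x b1) (psi_anti x a1).
  have := gb_D jn xD; have := ga_D jn xD; rewrite /ga /gb opp_lfunE => -> ->.
  by rewrite oppr0 !mulr0 addr0.
have DF : (D j <= F)%VS.
  (* F is a hyperplane of N_j. If it missed part of the radical, F + D_j would be N_j, psi would
     vanish on N_j, and psi a1 b1 = 1 excludes this. *)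
  apply/negPn/negP => nDF.
  have GE : (F + D j)%VS = N j.
    apply/eqP; rewrite eqEdim subv_add FN D_sub_N dimN //= -dF.
    rewrite (ltn_leqif (dimv_leqif_eq (addvSl F (D j)))).
    by apply: contra nDF => /eqP->; rewrite addvSr.
  have b1N : b1 \in N j by rewrite (subvP (addvSr _ _)) ?memv_line.
  have a1N : a1 \in N j by rewrite (subvP (addvSl _ _)) // (subvP (addvSr _ _)) ?memv_line.
  move: (a1N) (b1N); rewrite -{1 2}GE => /memv_addP[x1 x1F [y1 y1D e1]] /memv_addP[x2 x2F [y2 y2D e2]].
  have /eqP := psi_a1b1; rewrite {1}e2 bilin_addr [psi a1 y2]psi_anti (orth _ _ y2D a1N) oppr0 addr0.
  rewrite {1}e1 bilin_addl (iso _ _ x1F x2F) add0r orth ?(subvP FN) //.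
  by rewrite eq_sym oner_eq0.
have [|w [wF wD FE]] := addv_line_exists DF; first by rewrite dF dimD.
(* w' is the part of w in <a1, b1>, congruent to w modulo D_j. *)
have wN := subvP FN _ wF; pose w' := ga w *: a1 + gb w *: b1.
have ww : w - 1 *: w' \in D j by rewrite scale1r opprD addrA -memNP.
exists w'; split.
- rewrite memNP ?(leq_ltn_trans _ jn) // /w' !lformD !lformZ ga_a1 ga_b1 gb_a1 gb_b1.
  by rewrite !mulr0 !mulr1 addr0 add0r -addrA -opprD subrr mem0v.
- by apply: contraNneq wD => w0; move: ww; rewrite w0 scaler0 subr0.
- by rewrite FE; apply: addv_lineC ww; rewrite oner_neq0.
Qed.

(** * Analysis of the fiber *)

Hypothesis charK : [pchar K] =i pred0.

(** Flags are indexed by all of [nat], with conditions only up to n, so that explicit families need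
    no ordinals. Isotropy of the last members includes that of all the others. *)
Record in_fiber (E : nat -> {vspace V0}) (F : nat -> {vspace V1}) : Prop := InFiber {
  fib_dimE : forall j, (j <= n)%N -> \dim (E j) = j;
  fib_dimF : forall j, (j <= n)%N -> \dim (F j) = j;
  fib_leE : forall i j, (i <= j)%N -> (j <= n)%N -> (E i <= E j)%VS;
  fib_leF : forall i j, (i <= j)%N -> (j <= n)%N -> (F i <= F j)%VS;
  fib_isoE : forall x y, x \in E n -> y \in E n -> phi x y = 0;
  fib_isoF : forall x y, x \in F n -> y \in F n -> psi x y = 0;
  fib_u : forall j, (j < n)%N -> (u @: E j.+1 <= F j)%VS;
  fib_us : forall j, (j <= n)%N -> (us @: F j <= E j)%VS }.

(* cond_S k and cond_C k are the closed conditions that cut the components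
   S_(k+1) and C_(k+1) out of the fiber. *)
Definition cond_S k (E : nat -> {vspace V0}) (F : nat -> {vspace V1}) : Prop :=
  [/\ forall j, (j <= k)%N -> (E j <= A j)%VS,
      forall j, (j <= k)%N -> (F j <= D j)%VS &
      (E k.+2 <= A k.+1 + <[a0]>)%VS].

(* Where E k.+2 = A k.+1 + <a0>, the inclusion of u (E k.+2) in F k.+1 no longer
   determines F k.+1.  The vanishing of this form on E k.+2 and F k.+1, which
   follows from isotropy elsewhere on the curve, cuts its closure there. *)
Definition tangency k (w : V0) (v : V1) : K :=
  phi (P n.-1) (P n.-1) * mu k.+1 w * nu k v + 2%:R * fa w * gb v.

Definition cond_C k (E : nat -> {vspace V0}) (F : nat -> {vspace V1}) : Prop :=
  [/\ forall j, (j <= k.+1)%N -> (E j <= A j)%VS,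
      forall j, (j <= k)%N -> (F j <= D j)%VS,
      ((k.+2 < n)%N -> (E k.+2 <= A k.+2 + <[b0]>)%VS) /\
      (k.+2 = n ->
        forall w v, w \in E k.+2 -> v \in F k.+1 -> tangency k w v = 0),
      forall j, (k.+2 < j)%N -> (j <= n)%N -> (E j <= A j.-1 + <[b0]>)%VS &
      forall j, (k.+1 < j)%N -> (j <= n)%N -> (F j <= D j.-1 + <[b1]>)%VS].

Lemma two_neq0 : (2%:R : K) != 0.
Proof. by rewrite ((pcharf0P K).1 charK). Qed.

Lemma phi_PP0 j : (j.+1 < n)%N -> phi (P j) (P j) = 0.
Proof.
move=> jn; apply: (sf_PP sf); rewrite ?(ltnW jn) //.
lia.
Qed.

(** A_j is orthogonal to M_(j+1), so phi is read on the classes of P_j, a0 and b0. The first term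
    survives only for j = n - 1. *)
Lemma phi_M j x y : (j < n)%N -> x \in M j.+1 -> y \in M j.+1 ->
  phi x y = mu j x * mu j y * phi (P j) (P j) + fa x * fb y + fb x * fa y.
Proof.
move=> jn; rewrite !memM_S // !memMP ?(ltnW jn) // !lformB !lformZ.
have [-> ->] : fa (P j) = 0 /\ fb (P j) = 0 by rewrite (sf_aP sf) ?(sf_bP sf).
rewrite !mulr0 !subr0; set x' := (_ - _) => xA; set y' := (_ - _) => yA.
have yE : y = y' + fb y *: b0 + fa y *: a0 + mu j y *: P j by rewrite !subrK.
have xE : x = x' + fb x *: b0 + fa x *: a0 + mu j x *: P j by rewrite !subrK.
clearbody x' y'; rewrite {1}xE {1}yE {xE yE}.
have PA : P j \in A j.+1 by apply: memA.
have jj : (j + j < 2 * n)%N by lia.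
have jj1 : (j + j.+1 < 2 * n)%N by lia.
have jj2 : (j.+1 + j < 2 * n)%N by rewrite addnC.
rewrite !(bilin_addl, bilin_addr, bilin_scalel, bilin_scaler).
rewrite (phi_A _ _ jj xA yA) ?(ltnW jn) // (phi_A _ _ jj1 xA PA) ?(ltnW jn) //.
rewrite (phi_A _ _ jj2 PA yA) ?(ltnW jn) //.
have oA w : w \in A j.+1 -> [/\ phi w a0 = 0, phi w b0 = 0, phi a0 w = 0 & phi b0 w = 0].
  move=> wA; rewrite [phi w a0](sf_sym sf) [phi w b0](sf_sym sf).
  by split; [exact: (fb_A jn)|exact: (fa_A jn)|exact: (fb_A jn)|exact: (fa_A jn)].
have AA := subvP (Aspace_le (leqnSn j)).
have [-> -> -> ->] := oA _ PA.
have [-> -> _ _] := oA _ (AA _ xA); have [_ _ -> ->] := oA _ (AA _ yA).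
rewrite phi_a0a0 phi_b0a0 (sf_ab sf) (sf_bb sf).
by ring.
Qed.

Lemma u_M j x : (j < n)%N -> x \in M j.+1 -> u x \in N j.
Proof.
move=> jn; rewrite memMP // => /(u_A jn).
rewrite memNP // ga_u gb_u scale0r subr0.
by rewrite !lfunB !lfunZ (sf_ua0 sf) (sf_ub0 sf) scaler0 subr0.
Qed.

Lemma nu_u j x : (j.+1 < n)%N -> x \in M j.+2 -> nu j (u x) = mu j.+1 x.
Proof.
move=> jn; rewrite memM_S // => /(u_M (ltnW jn))/(nu_N (ltnW jn)).
rewrite lfunB lfunZ (sf_uP sf) // lformB lformZ nu_Q // mulr1.
by move=> /eqP; rewrite subr_eq0 => /eqP.
Qed.

Section Analysis.
Variables (E : nat -> {vspace V0}) (F : nat -> {vspace V1}).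
Hypothesis EF : in_fiber E F.

Lemma fib_phi j x y : (j <= n)%N -> x \in E j -> y \in E j -> phi x y = 0.
Proof.
move=> jn xE yE; apply: (fib_isoE EF); exact: (subvP (fib_leE EF jn (leqnn n))).
Qed.

Lemma fib_psi j x y : (j <= n)%N -> x \in F j -> y \in F j -> psi x y = 0.
Proof.
move=> jn xF yF; apply: (fib_isoF EF); exact: (subvP (fib_leF EF jn (leqnn n))).
Qed.

Lemma fib_uP j x : (j < n)%N -> x \in E j.+1 -> u x \in F j.
Proof. by move=> jn xE; apply: (subvP (fib_u EF jn)); rewrite memv_img. Qed.

Lemma fib_usP j v : (j <= n)%N -> v \in F j -> us v \in E j.
Proof. by move=> jn vF; apply: (subvP (fib_us EF jn)); rewrite memv_img. Qed.

Lemma next_E j : (j < n)%N -> F j = D j -> (E j.+1 <= A j.+1 + <[a0]>)%VS.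
Proof.
move=> jn FD; apply/subvP => x /(fib_uP jn); rewrite FD => uxD.
rewrite mem_Aa // u_preimage ?(subvP (D_sub_N _)) //=.
by rewrite -(gb_u) (gb_D jn uxD).
Qed.

(** At the top level the square of the P_(n-1)-coefficient is multiplied by a nonzero number, so
    isotropy kills that coefficient. *)
Lemma last_step : (0 < n)%N -> E n.-1 = A n.-1 -> F n.-1 = D n.-1 ->
  (E n <= A n.-1 + <[a0]>)%VS.
Proof.
move=> n0 EA FD; have nn : n.-1.+1 = n by rewrite prednK.
have n1 : (n.-1 < n)%N by rewrite nn.
apply/subvP => x xE.
have := subvP (next_E n1 FD) x; rewrite nn xE mem_Aa // => /(_ isT)/andP[xM /eqP fbx].
have := fib_isoE EF xE xE; rewrite -[in M _]nn in xM.
rewrite (phi_M n1 xM xM) fbx mulr0 mul0r !addr0 => /eqP.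
rewrite mulf_eq0 (negPf (sf_Pn sf)) orbF mulf_eq0 orbb => /eqP m0.
rewrite mem_Aa ?(ltnW n1) // fbx eqxx andbT.
by move: xM; rewrite memM_S // m0 scale0r subr0.
Qed.

Lemma memN_us j v : (j < n)%N -> us v \in A j -> v \in (D j + <[b1]>)%VS.
Proof.
move=> jn usA; rewrite mem_Db // us_preimage ?(subvP (A_sub_M _)) //=.
by rewrite -(fa_us) (fa_A (ltnW jn) usA).
Qed.

Lemma fiber_step k : (k.+1 < n)%N ->
  (forall j, (j <= k)%N -> E j = A j /\ F j = D j) ->
  [\/ cond_S k E F, cond_C k E F | E k.+1 = A k.+1 /\ F k.+1 = D k.+1].
Proof.
move=> kn IH; have kn' := ltnW kn; have kn'' := ltnW kn'.
have EA j : (j <= k)%N -> (E j <= A j)%VS by move=> /IH[-> _].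
have FD j : (j <= k)%N -> (F j <= D j)%VS by move=> /IH[_ ->].
have [Ek Fk] := IH k (leqnn k).
have E1 := next_E kn' Fk.
have F1N : (F k.+1 <= N k.+1)%VS.
  apply/subvP => v /(fib_usP kn')/(subvP E1) H; apply: us_preimage => //.
  exact: (subvP (Aa_sub_M _)).
have E2M : (E k.+2 <= M k.+2)%VS.
  by apply/subvP => x /(fib_uP kn)/(subvP F1N); exact: u_preimage.

have [ES|nES] := boolP (E k.+2 <= A k.+1 + <[a0]>)%VS; first by constructor 1.
(* If E_(k+1) leaves A_(k+1), it contains a vector with a nonzero a0-coefficient. Isotropy then
   removes b0 from E_(k+2), and this case turns out to satisfy [cond_S] after all. *)
have [EA1|nEA1] := boolP (E k.+1 <= A k.+1)%VS; last first.
  have /subvPn[al alE alA] := nEA1; have := subvP E1 _ alE.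
  rewrite mem_Aa // => /andP[alM /eqP fbal].
  have faal : fa al != 0 by apply: contraNneq alA => faal; apply: mem_A.
  case/negP: nES; apply/subvP => w wE; have wM := subvP E2M _ wE.
  have alE2 := subvP (fib_leE EF (leqnSn k.+1) kn) _ alE.
  have := fib_phi kn alE2 wE.
  rewrite (phi_M kn (subvP (Mspace_le (leqnSn _)) _ alM) wM) (mu_M kn alM).
  rewrite fbal !mul0r add0r addr0 => /eqP; rewrite mulf_eq0 (negPf faal) /= => /eqP fbw.
  suff mw : mu k.+1 w = 0.
    rewrite mem_Aa // fbw eqxx andbT.
    by move: wM; rewrite memM_S // mw scale0r subr0.
  apply/eqP/negPn/negP => mw; case/negP: nEA1.
  (* A P_(k+1)-coefficient in E_(k+2) would put Q_k into F_(k+1); then F_(k+1) = D_(k+1), and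
     E_(k+1) would contain us D_(k+1) = A_(k+1). *)
  have FD1 : F k.+1 = D k.+1.
    apply/esym/eqP; rewrite eqEdim (fib_dimF EF) // dimD // leqnn andbT.
    rewrite DspaceS subv_add -{1}Fk (fib_leF EF) // -memvE.
    pose m := w - mu k.+1 w *: P k.+1.
    have mM : m \in M k.+1 by rewrite -(memM_S).
    have fbm : fb m = 0.
      by rewrite lformB lformZ fbw [fb (P _)](sf_aP sf) // mulr0 subr0.
    have umD : u m \in F k.+1.
      apply: (subvP (fib_leF EF (leqnSn k) kn')); rewrite Fk.
      have : m \in (A k.+1 + <[a0]>)%VS by rewrite mem_Aa // mM fbm eqxx.
      move=> /memv_addv_lineP[c /(u_A kn')].
      by rewrite lfunB lfunZ (sf_ua0 sf) scaler0 subr0.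
    have := fib_uP kn wE; rewrite -[w](subrK (mu k.+1 w *: P k.+1)) -/m.
    rewrite lfunD lfunZ (sf_uP sf) // rpredDl // => H.
    by rewrite -(scalerK mw (Q k)) memvZ.
  have <- : A k.+1 = E k.+1; last exact: subvv.
  apply/eqP; rewrite eqEdim (fib_dimE EF) // dimA // leqnn andbT.
  by rewrite -(limg_us_D kn) -FD1 (fib_us EF).
have {}EA1 : E k.+1 = A k.+1.
  by apply/eqP; rewrite eqEdim EA1 (fib_dimE EF) // dimA /=.
have F1 : (F k.+1 <= D k.+1 + <[b1]>)%VS.
  by apply/subvP => v /(fib_usP kn'); rewrite EA1; exact: memN_us.
have [FD1|/subvPn[v vF vD]] := boolP (F k.+1 <= D k.+1)%VS.
  by constructor 3; split=> //; apply/eqP; rewrite eqEdim FD1 (fib_dimF EF) // dimD /=.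
constructor 2.
have F1N' : (D k.+1 + <[b1]> <= N k.+1)%VS by rewrite addvS ?addvSl.
have vN := subvP F1N _ vF.
have gav : ga v = 0 by have := subvP F1 _ vF; rewrite mem_Db // => /andP[_ /eqP].
have gbv : gb v != 0 by apply: contraNneq vD => gbv; apply: mem_D.
have DkF : (D k <= F k.+1)%VS by rewrite -Fk (fib_leF EF).
have F1E : F k.+1 = (D k + <[v]>)%VS.
  apply: addv_line_dim => //; first by rewrite (fib_dimF EF) // dimD.
  by apply: contra vD; apply/subvP/Dspace_le.
have [w wE wAa] := subvPn nES.
have wM := subvP E2M _ wE.
have wA : w \notin A k.+1 by apply: contra wAa; apply/subvP/addvSl.
have AE2 : (A k.+1 <= E k.+2)%VS by rewrite -EA1 (fib_leE EF).
have E2E : E k.+2 = (A k.+1 + <[w]>)%VS.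
  by apply: addv_line_dim; rewrite ?(fib_dimE EF) ?dimA.
(* The scalar c compares the generators of E_(k+2) and F_(k+1): the b0- and P_(k+1)-coefficients of
   w are c times the b1- and Q_k-coefficients of v. *)
have /memv_addv_lineP[c uwD] : u w \in (D k + <[v]>)%VS by rewrite -F1E fib_uP.
have fbw : fb w = c * gb v.
  have := gb_D kn' uwD; rewrite lformB lformZ gb_u => /eqP.
  by rewrite subr_eq0 => /eqP.
have muw : mu k.+1 w = c * nu k v.
  have := nu_N kn' (subvP (D_sub_N _) _ uwD); rewrite lformB lformZ nu_u // => /eqP.
  by rewrite subr_eq0 => /eqP.
have c0 : c != 0.
  apply: contraNneq wAa => c0; rewrite mem_Aa // fbw c0 mul0r eqxx andbT.
  by move: wM; rewrite memM_S // muw c0 mul0r scale0r subr0.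
have fbw0 : fb w != 0 by rewrite fbw mulf_neq0.
have iso_w := fib_phi kn wE wE; rewrite (phi_M kn wM wM) in iso_w.
(* Values of [us] have no b0-coefficient and w has one, so us F_(k+2) falls back into A_(k+1). *)
have F2 : (F k.+2 <= D k.+1 + <[b1]>)%VS.
  apply/subvP => f /(fib_usP kn); rewrite E2E => /memv_addv_lineP[d usA].
  apply: memN_us => //; have := fb_A kn' usA.
  rewrite lformB lformZ fb_us sub0r => /eqP; rewrite oppr_eq0 mulf_eq0 (negPf fbw0) orbF.
  by move=> /eqP d0; move: usA; rewrite d0 scale0r subr0.
(* Below the last level P_(k+1) is isotropic, so isotropy of w reads 2 * fa w * fb w = 0. *)
have faw : (k.+2 < n)%N -> fa w = 0.
  move=> kn2; have /eqP := iso_w; rewrite phi_PP0 // mulr0 add0r [fb w * _]mulrC -mulr2n -mulr_natl.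
  by rewrite mulf_eq0 (negPf two_neq0) /= mulf_eq0 (negPf fbw0) orbF => /eqP.
(* Pairing with w, which has a b0- but no a0-coefficient, removes a0 from the next E, and then [us]
   removes a1 from the next F. *)
have later j : (k.+2 <= j)%N -> (j <= n)%N ->
    (F j <= D j.-1 + <[b1]>)%VS /\ ((k.+2 < j)%N -> (E j <= A j.-1 + <[b0]>)%VS).
  elim: j => // j IHj; rewrite leq_eqVlt => /orP[/eqP[<-] _|kj jn].
    by split=> //; rewrite ltnn.
  have [Fj _] := IHj kj (ltnW jn).
  have j1n : (j.-1 < n)%N := leq_ltn_trans (leq_pred j) jn.
  have jE : j = j.-1.+1 by rewrite prednK // (leq_trans _ (kj : (k.+1 < j)%N)).
  have kn2 : (k.+2 < n)%N :=
    leq_ltn_trans (kj : (k.+2 <= j)%N) jn.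
  have Ej : (E j.+1 <= A j + <[b0]>)%VS.
    apply/subvP => e eE; have eM : e \in M j.
      rewrite jE; apply: u_preimage => //.
      have := subvP Fj _ (fib_uP jn eE); apply/subvP.
      by rewrite addvS ?addvSl.
    have wMj : w \in M j by apply: subvP wM; apply: Mspace_le.
    have wEj : w \in E j.+1 by apply: (subvP (fib_leE EF _ jn)) wE; rewrite ltnW.
    rewrite mem_Ab ?(ltnW jn) // eM /=.
    have PP0 : phi (P j.-1) (P j.-1) = 0 by apply: phi_PP0; rewrite -jE.
    rewrite jE in eM wMj; have := fib_phi jn wEj eE.
    rewrite (phi_M j1n wMj eM) PP0 mulr0 add0r faw // mul0r add0r.
    by move=> /eqP; rewrite mulf_eq0 (negPf fbw0).
  split=> //.
  apply/subvP => f /(fib_usP jn)/(subvP Ej); rewrite mem_Ab ?(ltnW jn) // => /andP[usM /eqP fau].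
  by rewrite mem_Db // us_preimage //= -(fa_us) fau.
split=> //.
- move=> j; rewrite leq_eqVlt => /orP[/eqP->|]; last exact: EA.
  by rewrite EA1.
- split=> kn2.
    have wAb : w \in (A k.+2 + <[b0]>)%VS by rewrite mem_Ab // wM faw /=.
    rewrite E2E subv_add -memvE wAb andbT.
    by apply: subv_trans (addvSl _ _); apply: Aspace_le.
  move=> w' v'; rewrite E2E F1E => /memv_addv_lineP[d wA'] /memv_addv_lineP[d' vD'].
  (* Substituting c times the coefficients of v for one factor in each term shows that phi w w is c
     times [tangency k w v]. *)
  have tang : tangency k w v = 0.
    have nE : n.-1 = k.+1 by rewrite -kn2.
    apply: (mulfI c0); rewrite mulr0 -[RHS]iso_w /tangency nE muw fbw; ring.
  have m' : mu k.+1 w' = d * mu k.+1 w.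
    have := mu_M kn (subvP (A_sub_M _) _ wA').
    by rewrite lformB lformZ => /eqP; rewrite subr_eq0 => /eqP.
  have f' : fa w' = d * fa w.
    by have := fa_A kn' wA'; rewrite lformB lformZ => /eqP; rewrite subr_eq0 => /eqP.
  have n' : nu k v' = d' * nu k v.
    have := nu_N kn' (subvP (D_sub_N _) _ vD').
    by rewrite lformB lformZ => /eqP; rewrite subr_eq0 => /eqP.
  have g' : gb v' = d' * gb v.
    by have := gb_D kn' vD'; rewrite lformB lformZ => /eqP; rewrite subr_eq0 => /eqP.
  have -> : tangency k w' v' = d * d' * tangency k w v.
    by rewrite /tangency m' f' n' g'; ring.
  by rewrite tang mulr0.
- by move=> j kj jn; have [_ ->] := later j (ltnW kj) jn.
- by move=> j kj jn; have [] := later j kj jn.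
Qed.

(** If no level branches, the flags are standard up to n - 1, and [last_step] puts them into the
    last surface, k = n - 2. *)
Lemma fiber_decomposition : (1 < n)%N ->
  exists k, (k.+1 < n)%N /\ (cond_S k E F \/ cond_C k E F).
Proof.
move=> n1; apply: contrapT => H.
have all_AD k : (k < n)%N -> forall j, (j <= k)%N -> E j = A j /\ F j = D j.
  elim: k => [|k IH] kn j.
    rewrite leqn0 => /eqP->; rewrite Aspace0 Dspace0.
    by split; apply/eqP; rewrite -dimv_eq0 ?(fib_dimE EF) ?(fib_dimF EF).
  rewrite leq_eqVlt => /orP[/eqP->|]; last exact: IH (ltnW kn) j.
  by have [C|C|//] := fiber_step kn (IH (ltnW kn)); case: H; exists k; split; auto.
have nn : n.-2.+2 = n by clear -n1; lia.
apply: H; exists n.-2; split; first by rewrite nn.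
left; split.
- by move=> j jk; have [->] // := all_AD n.-2 (leq_trans (leqnSn _) (eq_leq nn)) j jk.
- by move=> j jk; have [_ ->] // := all_AD n.-2 (leq_trans (leqnSn _) (eq_leq nn)) j jk.
have n12 : n.-2.+1 = n.-1 by clear -n1; lia.
rewrite nn n12; have [|e f] := all_AD n.-1 _ n.-1 (leqnn _); first by rewrite prednK // ltnW.
by apply: last_step; rewrite // ltnW.
Qed.

End Analysis.

(** * Coordinates on the quotients that carry the parameters *)

Notation e3 := (e3 K).
Notation rc i := (rowcoef K (inord i : 'I_3)).
Notation rc2 i := (rowcoef K (inord i : 'I_2)).
Definition e2 (i : nat) : 'rV[K]_2 := delta_mx 0 (inord i).

(** [pr k] reads N_(k+1) modulo D_k in the basis b1, Q_k, a1, so that the centres b1 and Q_k of the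
    blow-up become [e3 0] and [e3 1]. [plift k] reads A_(k+1) + <a0> modulo A_k in the basis P_k,
    a0, numbered 1 and 2 so that [us] becomes the projection from [e3 0]; a line there amounts to a
    line of the projective plane through that centre. *)
Definition pr k : 'Hom(V1, 'rV[K]_3) :=
  rank_one gb (e3 0) + rank_one (nu k) (e3 1) + rank_one ga (e3 2).
Definition iota1 k : 'Hom('rV[K]_3, V1) :=
  rank_one (rc 0) b1 + rank_one (rc 1) (Q k) + rank_one (rc 2) a1.
Definition plift k : 'Hom(V0, 'rV[K]_3) :=
  rank_one (mu k) (e3 1) + rank_one fa (e3 2).
Definition iota0 k : 'Hom('rV[K]_3, V0) :=
  rank_one (rc 1) (P k) + rank_one (rc 2) a0.
Definition pr2 (V : vectType K) (l0 l1 : 'Hom(V, K^o)) : 'Hom(V, 'rV[K]_2) :=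
  rank_one l0 (e2 0) + rank_one l1 (e2 1).
Definition iota2 (V : vectType K) (v0 v1 : V) : 'Hom('rV[K]_2, V) :=
  rank_one (rc2 0) v0 + rank_one (rc2 1) v1.

Lemma prE k v : pr k v = gb v *: e3 0 + nu k v *: e3 1 + ga v *: e3 2.
Proof. by rewrite !add_lfunE !rank_oneE. Qed.
Lemma iota1E k r : iota1 k r = r 0 (inord 0) *: b1 + r 0 (inord 1) *: Q k + r 0 (inord 2) *: a1.
Proof. by rewrite !add_lfunE !rank_oneE !rowcoefE. Qed.
Lemma pliftE k x : plift k x = mu k x *: e3 1 + fa x *: e3 2.
Proof. by rewrite !add_lfunE !rank_oneE. Qed.
Lemma iota0E k r : iota0 k r = r 0 (inord 1) *: P k + r 0 (inord 2) *: a0.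
Proof. by rewrite !add_lfunE !rank_oneE !rowcoefE. Qed.
Lemma pr2E (V : vectType K) (l0 l1 : 'Hom(V, K^o)) v :
  pr2 l0 l1 v = (l0 v : K) *: e2 0 + (l1 v : K) *: e2 1.
Proof. by rewrite !add_lfunE !rank_oneE. Qed.
Lemma iota2E (V : vectType K) (v0 v1 : V) r :
  iota2 v0 v1 r = r 0 (inord 0) *: v0 + r 0 (inord 1) *: v1.
Proof. by rewrite !add_lfunE !rank_oneE !rowcoefE. Qed.

Lemma row3E (r : 'rV[K]_3) :
  r = r 0 (inord 0) *: e3 0 + r 0 (inord 1) *: e3 1 + r 0 (inord 2) *: e3 2.
Proof.
apply: row3P => -[|[|[|//]]] _; rewrite !mxE -!val_eqE /= !inordK //=;
by rewrite !mulr0 ?mulr1 ?addr0 ?add0r.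
Qed.

Lemma row2P (x y : 'rV[K]_2) :
  (forall j, (j < 2)%N -> x 0 (inord j) = y 0 (inord j)) -> x = y.
Proof. by move=> H; apply/rowP => j; rewrite -(inord_val j) H. Qed.

Lemma row2E (r : 'rV[K]_2) : r = r 0 (inord 0) *: e2 0 + r 0 (inord 1) *: e2 1.
Proof.
apply: row2P => -[|[|//]] _; rewrite !mxE -!val_eqE /= !inordK //=;
by rewrite !mulr0 ?mulr1 ?addr0 ?add0r.
Qed.

Lemma pr2K (V : vectType K) (l0 l1 : 'Hom(V, K^o)) (v0 v1 : V) :
  l0 v0 = 1 -> l0 v1 = 0 -> l1 v0 = 0 -> l1 v1 = 1 ->
  cancel (iota2 v0 v1) (pr2 l0 l1).
Proof.
move=> e1 e2' e3' e4 r; rewrite pr2E iota2E !lformD !lformZ e1 e2' e3' e4.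
by rewrite !mulr0 !mulr1 addr0 add0r -row2E.
Qed.

Lemma b1_N j : b1 \in N j.
Proof. by rewrite (subvP (addvSr _ _)) ?memv_line. Qed.
Lemma a1_N j : a1 \in N j.
Proof. by rewrite (subvP (addvSl _ _)) // (subvP (addvSr _ _)) ?memv_line. Qed.
Lemma b0_M j : b0 \in M j.
Proof. by rewrite (subvP (addvSr _ _)) ?memv_line. Qed.
Lemma a0_M j : a0 \in M j.
Proof. by rewrite (subvP (addvSl _ _)) // (subvP (addvSr _ _)) ?memv_line. Qed.
Lemma a0_neq0 : a0 != 0.
Proof. by apply: contra_eqN (sf_ab sf) => /eqP->; rewrite bilin_zerol eq_sym oner_eq0. Qed.
Lemma b0_neq0 : b0 != 0.
Proof. by apply: contra_eqN phi_b0a0 => /eqP->; rewrite bilin_zerol eq_sym oner_eq0. Qed.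
Lemma b1_neq0 : b1 != 0.
Proof. by apply: contra_eqN psi_a1b1 => /eqP->; rewrite linear0 eq_sym oner_eq0. Qed.

Lemma fa_P j : (j < n)%N -> fa (P j) = 0. Proof. exact: (sf_bP sf). Qed.
Lemma fb_P j : (j < n)%N -> fb (P j) = 0. Proof. exact: (sf_aP sf). Qed.
Lemma ga_Q j : (j.+1 < n)%N -> ga (Q j) = 0.
Proof. by move=> jn; apply: (ga_D jn); apply: memD. Qed.
Lemma gb_Q j : (j.+1 < n)%N -> gb (Q j) = 0.
Proof. by move=> jn; apply: (gb_D jn); apply: memD. Qed.

Section Level.
Variable k : nat.
Hypothesis kn : (k.+1 < n)%N.
Let kn' := ltnW kn.

Lemma iota1K : cancel (iota1 k) (pr k).
Proof.
move=> r; rewrite prE iota1E !lformD !lformZ gb_b1 gb_Q // gb_a1.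
rewrite nu_Q // !(nu_N kn') ?b1_N ?a1_N // ga_b1 ga_Q // ga_a1.
by rewrite !mulr0 !mulr1 !addr0 !add0r -row3E.
Qed.

Lemma pr_D v : v \in D k -> pr k v = 0.
Proof.
move=> vD; rewrite prE (gb_D kn' vD) (ga_D kn' vD).
by rewrite (nu_N kn' (subvP (D_sub_N _) _ vD)) !scale0r !addr0.
Qed.

Lemma iota1_pr v : v \in N k.+1 -> v - iota1 k (pr k v) \in D k.
Proof.
move=> vN; rewrite iota1E prE; have := vN; rewrite memN_S // memNP //.
rewrite !lformB !lformZ ga_Q // gb_Q // !mulr0 !subr0.
rewrite !mxE -!val_eqE /= !inordK //= !mulr0 !mulr1 !addr0 !add0r.
by rewrite !opprD !addrA (addrAC v) (addrAC (v + _)).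
Qed.

Lemma iota0_lift x : x \in (A k.+1 + <[a0]>)%VS -> x - iota0 k (plift k x) \in A k.
Proof.
rewrite (mem_Aa _ kn') (memM_S _ kn') (memMP _ (ltnW kn')) => /andP[+ /eqP fb0].
rewrite iota0E pliftE !lformB !lformZ fa_P // fb_P // fb0 !mulr0 !subr0 scale0r subr0.
by rewrite !mxE -!val_eqE /= !inordK //= !mulr0 !mulr1 !addr0 !add0r opprD addrA.
Qed.

Lemma plift_A x : x \in A k -> plift k x = 0.
Proof.
move=> xA; rewrite pliftE (fa_A (ltnW kn') xA).
by rewrite (mu_M kn' (subvP (A_sub_M _) _ xA)) !scale0r !addr0.
Qed.

Lemma pliftK r : plift k (iota0 k r) = r - r 0 (inord 0) *: e3 0.
Proof.
rewrite pliftE iota0E !lformD !lformZ mu_P // (mu_M kn' (a0_M _)).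
rewrite fa_P // fa_a0 !mulr0 !mulr1 addr0 add0r {3}[r]row3E.
by rewrite -(addrA (_ *: e3 0)) [RHS]addrAC subrr add0r.
Qed.

(** This turns us F_(k+1) <= E_(k+1) into the incidence of the point with its line through
    [e3 0]. *)
Lemma pr_us v : pr k v = gb v *: e3 0 + plift k (us v).
Proof. by rewrite prE pliftE fa_us comp_lfunE addrA. Qed.

End Level.

(** Only the sums with the A or D matter, so U1, U2, U3 and the W of [mkF] need not be lines:
    [iota1 k @: Y], for instance, is a plane containing Q_k, which D_(k+1) absorbs. *)
Definition mkE k (U1 U2 U3 : {vspace V0}) j : {vspace V0} :=
  if (j <= k)%N then A j else if j == k.+1 then (A k + U1)%VS else
  if j == k.+2 then (A k.+1 + U2)%VS else (A j.-1 + U3)%VS.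

Definition mkF k (W1 W2 : {vspace V1}) j : {vspace V1} :=
  if (j <= k)%N then D j else if j == k.+1 then (D k + W1)%VS else
  (D j.-1 + W2)%VS.

Lemma mkE_low k U1 U2 U3 j : (j <= k)%N -> mkE k U1 U2 U3 j = A j.
Proof. by rewrite /mkE => ->. Qed.
Lemma mkE1 k U1 U2 U3 : mkE k U1 U2 U3 k.+1 = (A k + U1)%VS.
Proof. by rewrite /mkE ltnn eqxx. Qed.
Lemma mkE2 k U1 U2 U3 : mkE k U1 U2 U3 k.+2 = (A k.+1 + U2)%VS.
Proof. by rewrite /mkE ltnNge leqnSn eqn_leq ltnn /= eqxx. Qed.
Lemma mkE_high k U1 U2 U3 j : (k.+2 < j)%N -> mkE k U1 U2 U3 j = (A j.-1 + U3)%VS.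
Proof. by move=> kj; rewrite /mkE leqNgt (ltn_trans _ kj) // !gtn_eqF // ltnW. Qed.

Lemma mkF_low k W1 W2 j : (j <= k)%N -> mkF k W1 W2 j = D j.
Proof. by rewrite /mkF => ->. Qed.
Lemma mkF1 k W1 W2 : mkF k W1 W2 k.+1 = (D k + W1)%VS.
Proof. by rewrite /mkF ltnn eqxx. Qed.
Lemma mkF_high k W1 W2 j : (k.+1 < j)%N -> mkF k W1 W2 j = (D j.-1 + W2)%VS.
Proof. by move=> kj; rewrite /mkF leqNgt (ltn_trans _ kj) // gtn_eqF. Qed.

Lemma mkE_ext (E : nat -> {vspace V0}) k U1 U2 U3 j :
  (forall i, (i <= k)%N -> E i = A i) -> E k.+1 = (A k + U1)%VS ->
  E k.+2 = (A k.+1 + U2)%VS -> ((k.+2 < j)%N -> E j = (A j.-1 + U3)%VS) ->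
  E j = mkE k U1 U2 U3 j.
Proof.
move=> E0 E1 E2 E3; case: (leqP j k) => [jk|]; first by rewrite mkE_low ?E0.
rewrite leq_eqVlt => /orP[/eqP<-|]; first by rewrite mkE1.
rewrite leq_eqVlt => /orP[/eqP<-|kj]; first by rewrite mkE2.
by rewrite mkE_high ?E3.
Qed.

Lemma mkF_ext (F : nat -> {vspace V1}) k W1 W2 j :
  (forall i, (i <= k)%N -> F i = D i) -> F k.+1 = (D k + W1)%VS ->
  ((k.+1 < j)%N -> F j = (D j.-1 + W2)%VS) ->
  F j = mkF k W1 W2 j.
Proof.
move=> F0 F1 F2; case: (leqP j k) => [jk|]; first by rewrite mkF_low ?F0.
rewrite leq_eqVlt => /orP[/eqP<-|kj]; first by rewrite mkF1.
by rewrite mkF_high ?F2.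
Qed.

Lemma iota0_e0 k : iota0 k (e3 0) = 0.
Proof. by rewrite iota0E !e3E // !scale0r addr0. Qed.

Definition prC k : 'Hom(V1, 'rV[K]_2) := pr2 gb (nu k).
Definition iotaC k : 'Hom('rV[K]_2, V1) := iota2 b1 (Q k).
Definition prT : 'Hom(V1, 'rV[K]_2) := pr2 gb ga.
Definition iotaT : 'Hom('rV[K]_2, V1) := iota2 b1 a1.

(* For k.+2 = n the form is anisotropic on P k.+1, so that the isotropic lines
   of <P k.+1, a0, b0> form a conic, parametrised here. *)
Definition betav k (r : 'rV[K]_2) : V0 :=
  if (k.+2 < n)%N then r 0 (inord 1) *: P k.+1 + r 0 (inord 0) *: b0
  else (r 0 (inord 0) * r 0 (inord 1)) *: P k.+1 + r 0 (inord 0) ^+ 2 *: b0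
       - (phi (P n.-1) (P n.-1) / 2%:R * r 0 (inord 1) ^+ 2) *: a0.

Lemma prC_D k v : (k < n)%N -> v \in D k -> prC k v = 0.
Proof.
move=> kn vD; rewrite pr2E (gb_D kn vD).
by rewrite (nu_N kn (subvP (D_sub_N _) _ vD)) !scale0r !addr0.
Qed.

Lemma iotaC_pr k v : (k.+1 < n)%N -> v \in (D k.+1 + <[b1]>)%VS ->
  v - iotaC k (prC k v) \in D k.
Proof.
move=> kn; rewrite mem_Db // => /andP[vN /eqP gav].
have := iota1_pr kn vN; rewrite iota1E prE iota2E pr2E gav.
by rewrite !mxE -!val_eqE /= !inordK //= !mulr0 !mulr1 ?mul0r !addr0 !add0r scale0r addr0.
Qed.

Lemma memM_coord j x : (j < n)%N -> x \in M j.+1 ->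
  x - mu j x *: P j - fb x *: b0 - fa x *: a0 \in A j.
Proof.
move=> jn; rewrite (memM_S _ jn) (memMP _ (ltnW jn)).
by rewrite !lformB !lformZ fa_P // fb_P // !mulr0 !subr0 addrAC.
Qed.

Section Fiber.
Variables (E : nat -> {vspace V0}) (F : nat -> {vspace V1}).
Hypothesis EF : in_fiber E F.
Variable k : nat.
Hypothesis kn : (k.+1 < n)%N.
Let kn' := ltnW kn.

Lemma fib_E_le j : (j <= n)%N -> (E j <= A j)%VS -> E j = A j.
Proof. by move=> jn EA; apply/eqP; rewrite eqEdim EA (fib_dimE EF) // dimA /=. Qed.

Lemma fib_F_le j : (j < n)%N -> (F j <= D j)%VS -> F j = D j.
Proof. by move=> jn FD; apply/eqP; rewrite eqEdim FD (fib_dimF EF) ?dimD ?(ltnW jn) /=. Qed.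

Lemma fib_E_line j x : (j < n)%N -> x \in M 0 -> x != 0 -> (E j.+1 <= A j + <[x]>)%VS ->
  E j.+1 = (A j + <[x]>)%VS.
Proof.
move=> jn xM x0 EA; apply/eqP; rewrite eqEdim EA (fib_dimE EF) //.
by have [_ ->] := dim_A_line (ltnW jn) xM x0; rewrite /=.
Qed.

Lemma fib_F_line j x : (j < n)%N -> x \in N 0 -> x != 0 -> (F j.+1 <= D j + <[x]>)%VS ->
  F j.+1 = (D j + <[x]>)%VS.
Proof.
move=> jn xN x0 FD; apply/eqP; rewrite eqEdim FD (fib_dimF EF) //.
by have [_ ->] := dim_D_line jn xN x0; rewrite /=.
Qed.

Section S.
Hypothesis condS : cond_S k E F.

Lemma S_low j : (j <= k)%N -> E j = A j /\ F j = D j.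
Proof.
move=> jk; have [EA FD _] := condS; have jn := leq_ltn_trans jk kn'.
by split; [apply: fib_E_le; rewrite ?(ltnW jn) ?EA|apply: fib_F_le; rewrite ?FD].
Qed.

(** As a0 lies in E_j, isotropy removes b0 from E_(j+1), which stays in A_j + <a0>. Hence F_(j+1)
    lies in N_j, is isotropic there and so is D_j plus one line; as F_(k+2) already contains w, that
    line can always be taken to be <w>. *)
Lemma S_high : exists w, [/\ w \in N 0, w != 0 & forall j, (k.+1 < j)%N -> (j <= n)%N ->
  E j = (A j.-1 + <[a0]>)%VS /\ F j = (D j.-1 + <[w]>)%VS].
Proof.
have [_ _ E2] := condS.
have FN j : (j < n)%N -> (E j.+1 <= A j + <[a0]>)%VS -> (F j.+1 <= N j)%VS.
  move=> jn Ej; apply/subvP => v /(fib_usP EF jn)/(subvP Ej) H.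
  by apply: us_preimage => //; apply: (subvP (Aa_sub_M _)).
have Fex j : (j < n)%N -> (F j.+1 <= N j)%VS ->
    exists w, [/\ w \in N 0, w != 0 & F j.+1 = (D j + <[w]>)%VS].
  move=> jn FNj; apply: (isotropic_in_N jn FNj); last by rewrite (fib_dimF EF).
  by move=> x y; apply: (fib_psi EF).
have [w [wN w0 F2]] := Fex _ kn (FN _ kn E2).
exists w; split=> // j; elim: j => // j IHj kj jn.
have {}kj : (k.+1 <= j)%N := kj.
have Ej : (E j.+1 <= A j + <[a0]>)%VS.
  move: kj; rewrite leq_eqVlt => /orP[/eqP<-//|kj].
  have [Ej Fj] := IHj kj (ltnW jn).
  have j1n : (j.-1 < n)%N := leq_ltn_trans (leq_pred j) jn.
  have jE : j = j.-1.+1 by rewrite prednK // (leq_trans _ kj).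
  apply/subvP => x xE; rewrite mem_Aa ?(ltnW jn) //; apply/andP; split.
    rewrite jE; apply: u_preimage => //; have := fib_uP EF jn xE; rewrite Fj.
    apply/subvP; rewrite subv_add D_sub_N -memvE.
    by apply: (subvP (Nspace_le (leq0n _))).
  apply/eqP; apply: (fib_phi EF jn) xE; apply: (subvP (fib_leE EF (leqnSn j) jn)).
  by rewrite Ej (subvP (addvSr _ _)) ?memv_line.
split; first by apply: fib_E_line; rewrite ?a0_M ?a0_neq0.
have FNj := FN _ jn Ej.
have [w' [wN' w0' Fj']] := Fex _ jn FNj.
rewrite Fj'; have wF : w \in F j.+1.
  apply: (subvP (fib_leF EF (_ : k.+2 <= j.+1)%N jn)) => //.
  by rewrite F2 (subvP (addvSr _ _)) ?memv_line.
have [wD _] := dim_D_line jn wN w0.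
rewrite -Fj'; apply: addv_line_dim => //; first by rewrite Fj' addvSl.
by rewrite (fib_dimF EF) // dimD.
Qed.

Lemma S_struct : let x := (pr k @: F k.+1)%VS in
  let X := (<[e3 0]> + plift k @: E k.+1)%VS in
  let Y := (pr k @: F k.+2)%VS in
  @incidence K (x, (X, Y)) /\ forall j, (j <= n)%N ->
    E j = mkE k (iota0 k @: X) <[a0]> <[a0]> j /\
    F j = mkF k (iota1 k @: x) (iota1 k @: Y) j.
Proof.
move=> x X Y; have [w [wN w0 high]] := S_high.
have [Ek Fk] := S_low (leqnn k).
have [E2 F2] := high _ (ltnSn _) kn.
have E1le : (E k.+1 <= A k.+1 + <[a0]>)%VS by rewrite -E2 (fib_leE EF).
have F2le : (F k.+2 <= N k.+1)%VS.
  rewrite F2 subv_add D_sub_N -memvE.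
  by apply: (subvP (Nspace_le (leq0n _))).
have F1le : (F k.+1 <= N k.+1)%VS by apply: subv_trans (fib_leF EF _ _) F2le.
have AE : (A k <= E k.+1)%VS by rewrite -Ek (fib_leE EF).
have DF1 : (D k <= F k.+1)%VS by rewrite -Fk (fib_leF EF).
have DF2 : (D k <= F k.+2)%VS by rewrite -Fk (fib_leF EF) // leqW.
have s0 v : v \in E k.+1 -> v - iota0 k (plift k v) \in A k.
  by move=> vE; apply: (iota0_lift kn); apply: (subvP E1le).
have s1 v : v \in F k.+1 -> v - iota1 k (pr k v) \in D k.
  by move=> vF; apply: (iota1_pr kn); apply: (subvP F1le).
have s2 v : v \in F k.+2 -> v - iota1 k (pr k v) \in D k.
  by move=> vF; apply: (iota1_pr kn); apply: (subvP F2le).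
have p1 v : v \in D k -> pr k v = 0 by exact: (pr_D kn).
have p0 v : v \in A k -> plift k v = 0 by exact: (plift_A kn).
(* The image of [plift] has no [e3 0] component, so adding that centre to this line gives a
   plane. *)
have dL : \dim (plift k @: E k.+1) = 1%N.
  by rewrite (section_dim AE s0 p0) (fib_dimE EF) // dimA 1?ltnW // subSnn.
have c0 v : v \in (plift k @: E k.+1)%VS -> v 0 (inord 0) = 0.
  case/memv_imgP => y _ ->; rewrite pliftE !mxE -!val_eqE /= !inordK //=.
  by rewrite !mulr0 addr0.
split.
  split; split=> /=.
  - by rewrite (section_dim DF1 s1 p1) (fib_dimF EF) // dimD // subSnn.
  - have [v v0 LE] := vline_exists dL; rewrite /X LE dim_two_lines ?e3_neq0 //.
    have /c0 v00 : v \in (plift k @: E k.+1)%VS by rewrite LE memv_line.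
    apply/negP => /vlineP[c vE]; move: v00; rewrite vE mxE e3E // mulr1 => cE.
    by move: v0; rewrite vE cE scale0r eqxx.
  - by rewrite (section_dim DF2 s2 p1) (fib_dimF EF) // dimD // -addn2 addKn.
  - apply/subvP => _ /memv_imgP[v vF ->]; rewrite pr_us memv_add ?memvZ ?memv_line //.
    by rewrite memv_img // (fib_usP EF).
  - by rewrite limgS // (fib_leF EF).
  - by rewrite (subvP (addvSl _ _)) ?memv_line.
  - apply/memv_imgP; exists (Q k).
      by rewrite F2 (subvP (addvSl _ _)) // memD.
    rewrite prE gb_Q // ga_Q // nu_Q // !scale0r add0r addr0 scale1r //.
have F2E : F k.+2 = (D k.+1 + iota1 k @: Y)%VS.
  apply: (section_eq (U := D k.+1)); first by rewrite F2 addvSl.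
  by move=> v /s2; apply/subvP/Dspace_le.
move=> j jn; split.
  apply: mkE_ext => //; first by move=> i /S_low[].
    rewrite /X limgD limg_line iota0_e0 [LHS](section_eq AE s0); congr (_ + _)%VS.
    by apply/esym/addv_idPr; rewrite -memvE mem0v.
  by move=> kj; have [-> _] := high j (ltnW kj) jn.
apply: mkF_ext; first by move=> i /S_low[].
  exact: section_eq.
move=> kj; have [_ ->] := high j kj jn.
(* D_(j-1) contains D_(k+1), so the plane Y found at level k + 2 describes all the higher F_j as
   well. *)
have /addv_idPl DE : (D k.+1 <= D j.-1)%VS.
  by apply: Dspace_le; rewrite -ltnS prednK // (leq_trans _ kj).
by rewrite -DE -addvA -F2 F2E addvA.
Qed.

End S.

Hypothesis condC : cond_C k E F.

Lemma C_low j : (j <= k)%N -> E j = A j /\ F j = D j.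
Proof.
move=> jk; have [EA FD _ _ _] := condC; have jn := leq_ltn_trans jk kn'.
by split; [apply: fib_E_le; rewrite ?(ltnW jn) ?EA // leqW|apply: fib_F_le; rewrite ?FD].
Qed.

Lemma C_struct : let y := (prC k @: F k.+1)%VS in
  \dim y = 1%N /\ forall j, (j <= n)%N ->
    E j = mkE k <[P k]> <[betav k (vpick y)]> <[b0]> j /\
    F j = mkF k (iotaC k @: y) <[b1]> j.
Proof.
move=> y; have [EA _ [C1 C2] Ehi Fhi] := condC.
have [Ek Fk] := C_low (leqnn k).
have Ek1 : E k.+1 = A k.+1 by apply: fib_E_le => //; apply: EA.
have F1le : (F k.+1 <= D k.+1 + <[b1]>)%VS.
  by apply/subvP => v /(fib_usP EF kn'); rewrite Ek1; exact: memN_us.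
have F1N : (F k.+1 <= N k.+1)%VS.
  by apply: subv_trans F1le _; rewrite addvS ?addvSl.
have DF1 : (D k <= F k.+1)%VS by rewrite -Fk (fib_leF EF).
have s1 v : v \in F k.+1 -> v - iotaC k (prC k v) \in D k.
  by move=> vF; apply: iotaC_pr => //; apply: (subvP F1le).
have p1 v : v \in D k -> prC k v = 0 by exact: prC_D.
have dy : \dim y = 1%N.
  by rewrite (section_dim DF1 s1 p1) (fib_dimF EF) // dimD // subSnn.
split=> // j jn; split; last first.
  apply: mkF_ext; first by move=> i /C_low[].
    exact: section_eq.
  move=> kj; have j0 : j = j.-1.+1 by rewrite prednK // (leq_trans _ kj).
  rewrite [in LHS]j0; apply: fib_F_line; rewrite -?j0 ?b1_N ?b1_neq0 ?Fhi //.
apply: mkE_ext.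
- by move=> i /C_low[].
- by rewrite Ek1 AspaceS.
- set r := vpick y; have r0 : r != 0 by rewrite vpick0 -dimv_eq0 dy.
  have yE : y = <[r]>%VS.
    by apply: subv_dim_eq; rewrite ?dy ?dim_vline ?r0 // -memvE memv_pick.
  have E2M : (E k.+2 <= M k.+2)%VS.
    by apply/subvP => x /(fib_uP EF kn)/(subvP F1N); exact: u_preimage.
  have AE2 : (A k.+1 <= E k.+2)%VS by rewrite -Ek1 (fib_leE EF).
  have [|w [wE wA ->]] := addv_line_exists AE2.
    by rewrite (fib_dimE EF) // dimA.
  have wM := subvP E2M _ wE.
  have uwF := fib_uP EF kn wE.
  have : prC k (u w) \in y by rewrite memv_img.
  rewrite yE => /vlineP[l]; rewrite pr2E gb_u nu_u //.
  move=> /rowP prw; have := prw (inord 0); have := prw (inord 1).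
  rewrite !mxE -!val_eqE /= !inordK //= !mulr0 !mulr1 ?add0r ?addr0 => muw fbw.
  (* Coefficients proportional to those of w modulo A_(k+1) determine E_(k+2); the factor c cannot
     vanish because w is outside A_(k+1). *)
  have key (c p b a : K) : mu k.+1 w = c * p -> fb w = c * b -> fa w = c * a ->
      (A k.+1 + <[w]> = A k.+1 + <[p *: P k.+1 + b *: b0 + a *: a0]>)%VS.
    move=> mE bE aE; have wc := memM_coord kn wM; rewrite mE bE aE in wc.
    have cE : w - c *: (p *: P k.+1 + b *: b0 + a *: a0) \in A k.+1.
      by rewrite !scalerDr !scalerA !opprD !addrA.
    apply: addv_lineC cE; apply: contraNneq wA => c0.
    by move: wc; rewrite c0 !mul0r !scale0r !subr0.
  rewrite /betav; case: ifPn => [kn2|].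
    rewrite -[_ + _ *: b0]addr0 -(scale0r a0); apply: (key l) => //.
    have := subvP (C1 kn2) _ wE; rewrite mem_Ab // => /andP[_ /eqP->].
    by rewrite mulr0.
  rewrite -leqNgt => nk; have nE : k.+2 = n by apply/eqP; rewrite eqn_leq kn nk.
  have nE' : n.-1 = k.+1 by rewrite -nE.
  have kap : phi (P n.-1) (P n.-1) != 0 := sf_Pn sf.
  have two0 := two_neq0.
  have : r \in y by rewrite memv_pick.
  case/memv_imgP => v vF; rewrite pr2E => /rowP rE; have := rE (inord 0); have := rE (inord 1).
  rewrite !mxE -!val_eqE /= !inordK //= !mulr0 !mulr1 ?add0r ?addr0 => r1E r0E.
  have := C2 nE _ _ wE vF; rewrite /tangency -r1E -r0E muw => tang.
  (* Off the point <a0> of the conic the tangency equation is solved for [fa w], and w is l / r_0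
     times [betav k r]. *)
  rewrite -scaleNr; have [rz|rz] := eqVneq (r 0 (inord 0)) 0; last first.
    have faE : fa w = - (phi (P n.-1) (P n.-1) * l * r 0 (inord 1) ^+ 2) / (2%:R * r 0 (inord 0)).
      apply: (canRL (mulfK _)); first by rewrite mulf_neq0.
      apply/eqP; rewrite -addr_eq0; apply/eqP; rewrite -[RHS]tang; ring.
    apply: (key (l / r 0 (inord 0))); rewrite ?muw ?fbw ?faE; field; rewrite ?rz ?two0 //.
  have r1z : r 0 (inord 1) != 0.
    apply: contraNneq r0 => r1z; apply/eqP; apply: row2P => -[|[|//]] _.
      by rewrite rz mxE.
    by rewrite r1z mxE.
  (* At r_0 = 0 the tangency equation forces l = 0, so modulo A_(k+1) only a multiple of a0 is left
     in w, as in [betav k r]. *)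
  have lz : l = 0.
    move: tang; rewrite rz mulr0 addr0 => /eqP; rewrite !mulf_eq0 (negPf kap) (negPf r1z) !orbF /=.
    by move/eqP.
  rewrite rz expr0n /= mul0r.
  apply: (key (- (fa w / (phi (P n.-1) (P n.-1) / 2%:R * r 0 (inord 1) ^+ 2)))).
  - by rewrite muw lz mul0r mulr0.
  - by rewrite fbw rz !mulr0.
  - by field; rewrite ?r1z ?two0 ?kap.
move=> kj; have j0 : j = j.-1.+1 by rewrite prednK // (leq_trans _ kj).
by rewrite [in LHS]j0; apply: fib_E_line; rewrite -?j0 ?b0_M ?b0_neq0 ?Ehi.
Qed.

End Fiber.
(** Membership in the second surface makes the flags standard up to level k + 1, and membership in
    the first puts a0 into E_(k+2); only the line F_(k+2) / D_(k+1) in <b1, a1> remains free. *)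
Lemma T_struct (E : nat -> {vspace V0}) (F : nat -> {vspace V1}) k :
  in_fiber E F -> (k.+2 < n)%N ->
  cond_S k E F -> cond_S k.+1 E F ->
  let y := (prT @: F k.+2)%VS in
  \dim y = 1%N /\ forall j, (j <= n)%N ->
    E j = mkE k <[P k]> <[a0]> <[a0]> j /\
    F j = mkF k <[Q k]> (iotaT @: y) j.
Proof.
move=> EF kn2 S1 S2 y; have kn := ltnW kn2.
have [w [wN w0 high]] := S_high EF kn S1.
have low := S_low EF kn2 S2.
have [E2 F2] := high _ (ltnSn _) kn.
have DF : (D k.+1 <= F k.+2)%VS by rewrite F2 addvSl.
have s2 v : v \in F k.+2 -> v - iotaT (prT v) \in D k.+1.
  move=> vF; have : v \in N k.+1.
    apply: subvP vF; rewrite F2 subv_add D_sub_N -memvE.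
    by apply: (subvP (Nspace_le (leq0n _))).
  rewrite (memNP _ kn) iota2E pr2E !mxE -!val_eqE /= !inordK //=.
  by rewrite !mulr0 !mulr1 addr0 add0r opprD addrA addrAC.
have p2 v : v \in D k.+1 -> prT v = 0.
  by move=> vD; rewrite pr2E (gb_D kn vD) (ga_D kn vD) !scale0r addr0.
split.
  by rewrite (section_dim DF s2 p2) (fib_dimF EF) // dimD // subSnn.
have F2E := section_eq DF s2; rewrite -/y in F2E.
move=> j jn; split.
  apply: mkE_ext => // [i ik||].
  - by have [] := low i (leqW ik).
  - by have [-> _] := low _ (leqnn _); rewrite AspaceS.
  - by move=> kj; have [] := high _ (ltnW kj) jn.
apply: mkF_ext => [i ik||].
- by have [] := low i (leqW ik).
- by have [_ ->] := low _ (leqnn _); rewrite DspaceS.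
move=> kj; have [_ ->] := high j kj jn.
have /addv_idPl DE : (D k.+1 <= D j.-1)%VS.
  by apply: Dspace_le; rewrite -ltnS prednK // (leq_trans _ kj).
by rewrite -DE -addvA -F2 F2E addvA.
Qed.

(** * Explicit flags in the fiber *)

(** Each step raises the dimension by at most one, and n steps reach n, so every step raises it by
    exactly one. *)
Lemma chain_dim (V : vectType K) (E : nat -> {vspace V}) (e : nat -> V) :
  E 0%N = 0%VS -> (forall j, (j < n)%N -> E j.+1 = E j + <[e j]>)%VS ->
  \dim (E n) = n ->
  (forall j, (j <= n)%N -> \dim (E j) = j) /\
  (forall i j, (i <= j)%N -> (j <= n)%N -> (E i <= E j)%VS).
Proof.
move=> E0 ES dE.
have le1 j : (j < n)%N -> (\dim (E j.+1) <= (\dim (E j)).+1)%N.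
  move=> jn; rewrite ES //; apply: leq_trans (dimv_add_leqif _ _) _.
  by rewrite dim_vline -addn1 leq_add2l; case: (_ != 0).
split=> [j jn|i j ij].
  apply/eqP; rewrite eqn_leq; apply/andP; split.
    by elim: j jn => [|j IH] jn; [rewrite E0 dimv0|apply: leq_trans (le1 _ jn) _; exact: IH (ltnW jn)].
  suff H m : (j + m <= n)%N -> (\dim (E (j + m)) <= \dim (E j) + m)%N.
    by have := H (n - j)%N; rewrite subnKC // dE => /(_ (leqnn n)); clear -jn; lia.
  elim: m => [|m IH]; first by rewrite !addn0.
  rewrite !addnS => jm; apply: leq_trans (le1 _ jm) _.
  by rewrite ltnS IH // ltnW.
elim: j ij => [|j IH]; first by rewrite leqn0 => /eqP->.
rewrite leq_eqVlt => /orP[/eqP->//|ij] jn; apply: subv_trans (IH ij (ltnW jn)) _.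
by rewrite ES // addvSl.
Qed.

(** The vector added in passing from level j to level j + 1. Beyond the exceptional levels it is
    P_(j-1) and not P_j, since the exceptional line has taken up one dimension. *)
Definition stepE k (al be ga : V0) j : V0 :=
  if (j < k)%N then P j else if j == k then al else
  if j == k.+1 then be else if j == k.+2 then ga else P j.-1.

Definition stepF k (w1 w2 : V1) j : V1 :=
  if (j < k)%N then Q j else if j == k then w1 else
  if j == k.+1 then w2 else Q j.-1.

Section Level.
Variable k : nat.
Hypothesis kn : (k.+1 < n)%N.
Let kn' := ltnW kn.

Lemma mkE_step U1 U2 U3 al be ga j : (j < n)%N ->
  (A k + U1 = A k + <[al]>)%VS -> (A k.+1 + U2 = A k + U1 + <[be]>)%VS ->
  ((k.+2 < n)%N -> A k.+2 + U3 = A k.+1 + U2 + <[ga]>)%VS ->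
  mkE k U1 U2 U3 j.+1 = (mkE k U1 U2 U3 j + <[stepE k al be ga j]>)%VS.
Proof.
move=> jn h1 h2 h3; rewrite /stepE; case: (ltngtP j k) => [jk|kj|->].
- by rewrite !mkE_low // ?AspaceS // ltnW.
- have [->|j1] := eqVneq j k.+1; first by rewrite mkE1 mkE2.
  have [jE|j2] := eqVneq j k.+2.
    by rewrite jE in jn *; rewrite mkE2 mkE_high //= h3.
  have kj2 : (k.+2 < j)%N by rewrite ltn_neqAle eq_sym j2 ltn_neqAle eq_sym j1.
  rewrite !mkE_high // ?(ltn_trans kj2) //= -{1}[j]prednK ?(leq_trans _ kj2) // AspaceS.
  by rewrite -!addvA [(_ + U3)%VS]addvC.
- by rewrite mkE1 mkE_low.
Qed.

Lemma mkF_step W1 W2 w1 w2 j : (j < n)%N ->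
  (D k + W1 = D k + <[w1]>)%VS -> (D k.+1 + W2 = D k + W1 + <[w2]>)%VS ->
  mkF k W1 W2 j.+1 = (mkF k W1 W2 j + <[stepF k w1 w2 j]>)%VS.
Proof.
move=> jn h1 h2; rewrite /stepF; case: (ltngtP j k) => [jk|kj|->].
- by rewrite !mkF_low // ?DspaceS // ltnW.
- have [->|j1] := eqVneq j k.+1; first by rewrite mkF1 mkF_high.
  have kj1 : (k.+1 < j)%N by rewrite ltn_neqAle eq_sym j1.
  rewrite !mkF_high // ?(ltn_trans kj1) //= -{1}[j]prednK ?(leq_trans _ kj1) // DspaceS.
  by rewrite -!addvA [(_ + W2)%VS]addvC.
- by rewrite mkF1 mkF_low.
Qed.

Definition frameE al be ga : {ffun 'I_n -> V0} :=
  [ffun i : 'I_n => stepE k al be ga i].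
Definition frameF w1 w2 : {ffun 'I_n -> V1} :=
  [ffun i : 'I_n => stepF k w1 w2 i].

Lemma mkE_frame U1 U2 U3 al be ga :
  (A k + U1 = A k + <[al]>)%VS -> (A k.+1 + U2 = A k + U1 + <[be]>)%VS ->
  ((k.+2 < n)%N -> A k.+2 + U3 = A k.+1 + U2 + <[ga]>)%VS ->
  \dim (mkE k U1 U2 U3 n) = n ->
  zframe (frameE al be ga : zcoord (flag_variety n V0)) /\
  @zcls _ (flag_variety n V0) (frameE al be ga) =
    [ffun i : 'I_n.+1 => mkE k U1 U2 U3 i].
Proof.
move=> h1 h2 h3 dE; apply: (flag_of_frame (E := mkE k U1 U2 U3)) dE.
  by rewrite mkE_low ?Aspace0.
by move=> i; rewrite ffunE (mkE_step _ h1 h2 h3).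
Qed.

Lemma mkF_frame W1 W2 w1 w2 :
  (D k + W1 = D k + <[w1]>)%VS -> (D k.+1 + W2 = D k + W1 + <[w2]>)%VS ->
  \dim (mkF k W1 W2 n) = n ->
  zframe (frameF w1 w2 : zcoord (flag_variety n V1)) /\
  @zcls _ (flag_variety n V1) (frameF w1 w2) =
    [ffun i : 'I_n.+1 => mkF k W1 W2 i].
Proof.
move=> h1 h2 dF; apply: (flag_of_frame (E := mkF k W1 W2)) dF.
  by rewrite mkF_low ?Dspace0.
by move=> i; rewrite ffunE (mkF_step _ h1 h2).
Qed.

(** On the standard parts the inclusions are u A_(j+1) = D_j and us D_j = A_j, so only those for the
    U and W remain. Isotropy is tested on the last members, which are A_(n-1) and D_(n-1) extended
    by one vector orthogonal to them. *)
Lemma mk_in_fiber U1 U2 U3 al be ga W1 W2 w1 w2 x w :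
  (A k + U1 = A k + <[al]>)%VS -> (A k.+1 + U2 = A k + U1 + <[be]>)%VS ->
  ((k.+2 < n)%N -> A k.+2 + U3 = A k.+1 + U2 + <[ga]>)%VS ->
  mkE k U1 U2 U3 n = (A n.-1 + <[x]>)%VS -> x \notin A n.-1 -> x \in M n ->
  phi x x = 0 ->
  (D k + W1 = D k + <[w1]>)%VS -> (D k.+1 + W2 = D k + W1 + <[w2]>)%VS ->
  mkF k W1 W2 n = (D n.-1 + <[w]>)%VS -> w \in N 0 -> w != 0 ->
  (u @: U1 <= D k)%VS -> (u @: U2 <= D k + W1)%VS -> (u @: U3 <= W2)%VS ->
  (us @: W1 <= A k + U1)%VS -> (us @: W2 <= A k.+1 + U2)%VS ->
  ((k.+2 < n)%N -> us @: W2 <= A k.+2 + U3)%VS ->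
  in_fiber (mkE k U1 U2 U3) (mkF k W1 W2).
Proof.
move=> h1 h2 h3 En xA xM xx g1 g2 Fn wN w0 uU1 uU2 uU3 usW1 usW2 usW2'.
have n0 : n = n.-1.+1 by rewrite prednK // (leq_ltn_trans _ kn).
have n1 : (n.-1 < n)%N by rewrite {2}n0.
have dE : \dim (mkE k U1 U2 U3 n) = n by rewrite En dim_addv_line // dimA // ltnW.
have dF : \dim (mkF k W1 W2 n) = n.
  by rewrite Fn; have [_ ->] := dim_D_line n1 wN w0.
have mkE0 : mkE k U1 U2 U3 0%N = 0%VS by rewrite mkE_low // Aspace0.
have mkF0 : mkF k W1 W2 0%N = 0%VS by rewrite mkF_low // Dspace0.
have [dimE leE] := chain_dim mkE0 (fun j jn => mkE_step jn h1 h2 h3) dE.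
have [dimF leF] := chain_dim mkF0 (fun j jn => mkF_step jn g1 g2) dF.
have pA y : y \in A n.-1 -> phi x y = 0.
  move=> yA; rewrite n0 in xM; have yM := subvP (Mspace_le (leqnSn n.-1)) _
    (subvP (A_sub_M _) _ yA).
  rewrite (phi_M n1 xM yM) (mu_M n1 (subvP (A_sub_M _) _ yA)).
  by rewrite (fa_A (ltnW n1) yA) (fb_A (ltnW n1) yA) !mulr0 mul0r !addr0.
have pD v : v \in D n.-1 -> psi w v = 0.
  move=> vD; rewrite (memNP _ (leq_ltn_trans (leq0n _) n1)) Dspace0 memv0 in wN.
  have := wN; rewrite subr_eq0 => /eqP/(canRL (subrK _)) ->.
  rewrite bilin_addl !bilin_scalel.
  have -> : psi a1 v = 0 := gb_D n1 vD.
  have := ga_D n1 vD; rewrite opp_lfunE => /eqP; rewrite oppr_eq0 => /eqP ->.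
  by rewrite !mulr0 addr0.
have isoA y z : y \in A n.-1 -> z \in A n.-1 -> phi y z = 0.
  by apply: phi_A; clear -n0; lia.
split=> //.
- move=> y z; rewrite En => /memv_addv_lineP[c yA] /memv_addv_lineP[d zA].
  rewrite -[y](subrK (c *: x)) -[z](subrK (d *: x)).
  move: (y - _) (z - _) yA zA => y' z' yA zA.
  rewrite !(bilin_addl, bilin_addr, bilin_scalel, bilin_scaler) xx isoA //.
  by rewrite (sf_sym sf _ x) !pA // !mulr0 !addr0.
- move=> y z; rewrite Fn => /memv_addv_lineP[c yD] /memv_addv_lineP[d zD].
  rewrite -[y](subrK (c *: w)) -[z](subrK (d *: w)).
  move: (y - _) (z - _) yD zD => y' z' yD zD.
  rewrite !(bilin_addl, bilin_addr, bilin_scalel, bilin_scaler) (sf_alt sf).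
  by rewrite (psi_anti _ w) !pD // (psi_D n1 n1 yD zD) oppr0 !mulr0 !addr0.
- have uA j : (j < n)%N -> (u @: A j.+1 <= D j)%VS by move=> jn; rewrite limg_u_A.
  move=> j jn; case: (ltngtP j k) => [jk|kj|jE].
  + by rewrite mkE_low ?mkF_low ?uA // ltnW.
  + move: kj; rewrite leq_eqVlt => /orP[/eqP<-|kj].
      by rewrite mkE2 mkF1 limgD subv_add uU2 (subv_trans (uA _ kn')) ?addvSl.
    have jE : j = j.-1.+1 by rewrite prednK // (leq_trans _ kj).
    rewrite mkE_high // mkF_high // limgD /= {1}jE addvS //.
    by rewrite uA // (leq_ltn_trans (leq_pred _) jn).
  + rewrite jE mkE1 mkF_low // limgD subv_add uU1 andbT.
    by apply: subv_trans (uA _ kn'); rewrite limgS // Aspace_le.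
- have usD j : (j < n)%N -> (us @: D j <= A j)%VS by move=> jn; rewrite limg_us_D.
  move=> j jn; case: (leqP j k) => [jk|].
    by rewrite mkE_low // mkF_low // usD // (leq_ltn_trans jk).
  rewrite leq_eqVlt => /orP[/eqP<-|].
    rewrite mkE1 mkF1 limgD subv_add usW1 andbT.
    by apply: subv_trans (usD _ kn') _; rewrite addvSl.
  rewrite leq_eqVlt => /orP[/eqP<-|kj].
    rewrite mkE2 mkF_high // limgD subv_add usW2 andbT.
    by apply: subv_trans (usD _ kn) _; rewrite addvSl.
  have kn2 := leq_trans kj jn.
  rewrite mkE_high ?mkF_high ?(ltnW kj) // limgD subv_add; apply/andP; split.
    apply: subv_trans (usD _ _) (addvSl _ _).
    by rewrite -ltnS prednK ?(leq_trans _ kj) // ltnS.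
  apply: subv_trans (usW2' kn2) _; rewrite addvS // Aspace_le //.
  by rewrite -ltnS prednK ?(leq_trans _ kj).
Qed.

End Level.

(** * Components as varieties *)

Hypothesis usE : us = adjoint_lfun phi psi u.

Local Notation RS := (resolution_space V0 V1 n).
Local Notation X := (odd_end phi psi u).

Definition flagE (z : zpt RS) j : {vspace V0} := z.2.1 (inord j).
Definition flagF (z : zpt RS) j : {vspace V1} := z.2.2 (inord j).
Definition flag_point (E : nat -> {vspace V0}) (F : nat -> {vspace V1}) : zpt RS :=
  (u, ([ffun i : 'I_n.+1 => E i], [ffun i : 'I_n.+1 => F i])).

Lemma flagE_point E F j : (j <= n)%N -> flagE (flag_point E F) j = E j.
Proof. by move=> jn; rewrite /flagE /= ffunE inordK. Qed.
Lemma flagF_point E F j : (j <= n)%N -> flagF (flag_point E F) j = F j.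
Proof. by move=> jn; rewrite /flagF /= ffunE inordK. Qed.

Lemma flag_point_eta (z : zpt RS) E F : z.1 = u ->
  (forall j, (j <= n)%N -> flagE z j = E j /\ flagF z j = F j) -> z = flag_point E F.
Proof.
case: z => u' [Ez Fz] /= -> H; congr (_, (_, _)); apply/ffunP => i; rewrite ffunE.
  by have [<- _] := H i (ltn_ord i); rewrite /flagE /= inord_val.
by have [_ <-] := H i (ltn_ord i); rewrite /flagF /= inord_val.
Qed.

Lemma odd_end_inj v : odd_end phi psi v = X -> v = u.
Proof.
move=> E; apply/lfunP => x; have := odd_endE phi psi v (x, 0).
by rewrite E odd_endE => -[].
Qed.

Lemma springer_fiberP (z : zpt RS) : springer_fiber phi psi X z <->
  z.1 = u /\ in_fiber (flagE z) (flagF z).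
Proof.
case: z => u' [Ez Fz]; split=> [[[[dE mE iE] [dF mF iF] H] /odd_end_inj/= uE]|[/= uE H]].
  subst u'; split=> //; split; rewrite /flagE /flagF /=.
  - by move=> j jn; rewrite dE inordK.
  - by move=> j jn; rewrite dF inordK.
  - by move=> i j ij jn; rewrite mE // !inordK // ltnS (leq_trans ij).
  - by move=> i j ij jn; rewrite mF // !inordK // ltnS (leq_trans ij).
  - by move=> x y; apply: iE.
  - by move=> x y; apply: iF.
  - by move=> j jn; have [|? _] := H j.+1.
  - move=> j jn; rewrite usE; case: j jn => [|j] jn; last by have [|_] := H j.+1.
    have -> : Fz (inord 0) = 0%VS by apply/eqP; rewrite -dimv_eq0 dF inordK.
    by rewrite limg0 sub0v.
subst u'; case: H => dE dF mE mF iE iF hu hus; split; last by [].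
have Ei i : Ez i = flagE (u, (Ez, Fz)) i by rewrite /flagE /= inord_val.
have Fi i : Fz i = flagF (u, (Ez, Fz)) i by rewrite /flagF /= inord_val.
split.
- split=> [i|i j ij|i x y xE yE].
  + by rewrite Ei dE // -ltnS.
  + by rewrite !Ei mE // -ltnS.
  + rewrite Ei in xE yE; have le := subvP (mE i n (leq_ord i) (leqnn n)).
    by apply: iE; apply: le.
- split=> [i|i j ij|i x y xE yE].
  + by rewrite Fi dF // -ltnS.
  + by rewrite !Fi mF // -ltnS.
  + rewrite Fi in xE yE; have le := subvP (mF i n (leq_ord i) (leqnn n)).
    by apply: iF; apply: le.
- case=> // j /andP[_ jn]; split; first exact: hu.
  by rewrite -usE; apply: hus.
Qed.

Lemma in_fiber_ext E F E' F' :
  (forall j, (j <= n)%N -> E j = E' j /\ F j = F' j) ->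
  in_fiber E F -> in_fiber E' F'.
Proof.
move=> H [dE dF mE mF iE iF hu hus]; split.
- by move=> j jn; have [<- _] := H j jn; apply: dE.
- by move=> j jn; have [_ <-] := H j jn; apply: dF.
- move=> i j ij jn; have [<- _] := H j jn; have [<- _] := H i (leq_trans ij jn).
  exact: mE.
- move=> i j ij jn; have [_ <-] := H j jn; have [_ <-] := H i (leq_trans ij jn).
  exact: mF.
- by have [<- _] := H n (leqnn n).
- by have [_ <-] := H n (leqnn n).
- move=> j jn; have [<- _] := H j.+1 jn; have [_ <-] := H j (ltnW jn); exact: hu.
- move=> j jn; have [<- <-] := H j jn; exact: hus.
Qed.

Lemma springer_fiber_point E F : in_fiber E F ->
  springer_fiber phi psi X (flag_point E F).
Proof.
move=> H; apply/springer_fiberP; split=> //; apply: in_fiber_ext H => j jn.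
by rewrite flagE_point ?flagF_point.
Qed.

(** * The candidate components and their closed conditions *)

Definition Sset k : set (zpt RS) :=
  [set z | springer_fiber phi psi X z /\ cond_S k (flagE z) (flagF z)].
Definition Cset k : set (zpt RS) :=
  [set z | springer_fiber phi psi X z /\
     cond_C k (flagE z) (flagF z)].

(** The kernel of 1 - [projv U] is U, so the inclusion is a set of linear equations in the frame
    vectors of index below j. *)
Lemma zclosed_flag_sub (V : vectType K) (j : 'I_n.+1) (U : {vspace V}) :
  zclosed ([set E | (E j <= U)%VS] : set (zpt (flag_variety n V))).
Proof.
pose L := (\1 - projv U)%VF : 'End(V).
exists [set p | exists (l : 'Hom(V, K^o)) (i : 'I_n), (i < j)%N /\
    p = (fun e : {ffun 'I_n -> V} => l (L (e i)))].
  move=> _ [l [i [_ ->]]]; apply: (polymap_hom L).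
  exact/polymap_eval/polymap_id.
move=> e fe /=; rewrite ffunE; split.
  move=> /subv_sumP H _ [l [i [ij ->]]]; rewrite add_lfunE opp_lfunE id_lfunE.
  by rewrite projv_id ?subrr ?linear0 // memvE H.
move=> H; apply/subv_sumP => i ij; rewrite -memvE.
have : L (e i) = 0.
  apply/eqP/negPn/negP => Ln; have : L (e i) \notin (0 : {vspace V})%VS by rewrite memv0.
  move=> /sep_formP[s1 _]; have := H _ (ex_intro _ _ (ex_intro _ i (conj ij erefl))).
  by move: s1 => /[swap] -> /eqP; rewrite eq_sym oner_eq0.
by rewrite add_lfunE opp_lfunE id_lfunE => /eqP; rewrite subr_eq0 => /eqP->; exact: memv_proj.
Qed.

Lemma zclosed_flagE j U : (j <= n)%N -> zclosed [set z : zpt RS | (flagE z j <= U)%VS].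
Proof.
move=> jn; have c := @zclosed_fst _ (flag_variety n V0) (flag_variety n V1) _
  (zclosed_flag_sub (inord j) U).
exact: (@zclosed_snd _ (affine 'Hom(V0, V1)) _ _ c).
Qed.

Lemma zclosed_flagF j U : (j <= n)%N -> zclosed [set z : zpt RS | (flagF z j <= U)%VS].
Proof.
move=> jn; have c := @zclosed_snd _ (flag_variety n V0) (flag_variety n V1) _
  (zclosed_flag_sub (inord j) U).
exact: (@zclosed_snd _ (affine 'Hom(V0, V1)) _ _ c).
Qed.

Lemma zclosed_cond_S k : (k.+1 < n)%N ->
  zclosed [set z : zpt RS | cond_S k (flagE z) (flagF z)].
Proof.
move=> kn; rewrite (_ : mkset _ =
  [set z | forall j, (j <= k)%N -> (flagE z j <= A j)%VS] `&`
  [set z | forall j, (j <= k)%N -> (flagF z j <= D j)%VS] `&`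
  [set z | (flagE z k.+2 <= A k.+1 + <[a0]>)%VS]); last first.
  by apply/seteqP; split=> [z []|z [[]]].
have jn j : (j <= k)%N -> (j <= n)%N by move=> jk; rewrite (leq_trans jk) // ltnW // ltnW.
apply: zclosed_cap; last exact: zclosed_flagE.
apply: zclosed_cap; apply: zclosed_forall => j; apply: zclosed_imply => /jn jk.
  exact: zclosed_flagE.
exact: zclosed_flagF.
Qed.

Lemma zclosed_tangency k : (k.+1 < n)%N -> zclosed [set z : zpt RS |
  forall w v, w \in flagE z k.+2 -> v \in flagF z k.+1 ->
    tangency k w v = 0].
Proof.
move=> kn; pose t w v := tangency k w v.
exists [set p | exists i j : 'I_n, [/\ (i < k.+2)%N, (j < k.+1)%N &
    p = (fun w : zcoord RS => t (w.2.1 i) (w.2.2 j))]].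
  move=> _ [i [j [_ _ ->]]]; have pid := @polymap_id K (zcoord RS).
  have p1 := polymap_eval i (polymap_fst (polymap_snd pid)).
  have p2 := polymap_eval j (polymap_snd (polymap_snd pid)).
  apply: polyfun_add; apply: polyfun_mul.
  - by apply: polyfun_scale; apply: p1.
  - by apply: p2.
  - by apply: polyfun_scale; apply: p1.
  - by apply: p2.
move=> w fw; rewrite /= /flagE /flagF /= !ffunE !inordK ?(ltnW kn) // ?ltnS ?(ltnW kn) //.
split=> [H _ [i [j [ik jk ->]]]|H x y].
  by apply: H; rewrite memvE; [rewrite (sumv_sup i)|rewrite (sumv_sup j)].
move=> /memv_sum_lineP[c c0 ->] /memv_sum_lineP[d d0 ->].
(* The form is bilinear in w and v, so it vanishes on both spaces once it does on their frame
   vectors. *)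
have tl v : (forall i : 'I_n, (i < k.+2)%N -> t (w.2.1 i) v = 0) ->
   t (\sum_i c i *: w.2.1 i) v = 0.
  move=> tv; rewrite /t /tangency !linear_sum /= !(mulr_sumr, mulr_suml) -big_split /=.
  apply: big1 => i _; rewrite !lformZ.
  have [/tv|/c0->] := boolP (i < k.+2)%N; last by rewrite !(mul0r, mulr0) addr0.
  rewrite /t /tangency => ti; transitivity (c i * 0); last by rewrite mulr0.
  by rewrite -ti; ring.
have tr x' : (forall i : 'I_n, (i < k.+1)%N -> t x' (w.2.2 i) = 0) ->
   t x' (\sum_i d i *: w.2.2 i) = 0.
  move=> tv; rewrite /t /tangency !linear_sum /= !(mulr_sumr, mulr_suml) -big_split /=.
  apply: big1 => i _; rewrite !lformZ.
  have [/tv|/d0->] := boolP (i < k.+1)%N; last by rewrite !(mul0r, mulr0) addr0.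
  rewrite /t /tangency => ti; transitivity (d i * 0); last by rewrite mulr0.
  by rewrite -ti; ring.
apply: tl => i ik; apply: tr => j jk.
by have := H (fun w : zcoord RS => t (w.2.1 i) (w.2.2 j)); apply; exists i, j.
Qed.

Lemma zclosed_cond_C k : (k.+1 < n)%N -> zclosed [set z : zpt RS |
  cond_C k (flagE z) (flagF z)].
Proof.
move=> kn; rewrite (_ : mkset _ =
  [set z | forall j, (j <= k.+1)%N -> (flagE z j <= A j)%VS] `&`
  [set z | forall j, (j <= k)%N -> (flagF z j <= D j)%VS] `&`
  [set z | (k.+2 < n)%N -> (flagE z k.+2 <= A k.+2 + <[b0]>)%VS] `&`
  [set z | k.+2 = n -> forall w v, w \in flagE z k.+2 -> v \in flagF z k.+1 ->
    tangency k w v = 0] `&`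
  [set z | forall j, (k.+2 < j)%N -> (j <= n)%N -> (flagE z j <= A j.-1 + <[b0]>)%VS] `&`
  [set z | forall j, (k.+1 < j)%N -> (j <= n)%N -> (flagF z j <= D j.-1 + <[b1]>)%VS]);
  last first.
  by apply/seteqP; split=> [z [? ? [? ?] ? ?]|z [[[[[? ?] ?] ?] ?] ?]]; do !split.
have jn j : (j <= k.+1)%N -> (j <= n)%N by move=> jk; rewrite (leq_trans jk) // ltnW.
apply: zclosed_cap; [apply: zclosed_cap; [apply: zclosed_cap; [apply: zclosed_cap;
  [apply: zclosed_cap|]|]|]|].
- by apply: zclosed_forall => j; apply: zclosed_imply => /jn jk; apply: zclosed_flagE.
- apply: zclosed_forall => j; apply: zclosed_imply => jk; apply: zclosed_flagF.
  by apply: jn; rewrite leqW.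
- by apply: zclosed_imply => _; apply: zclosed_flagE.
- by apply: zclosed_imply => _; apply: zclosed_tangency.
- apply: zclosed_forall => j; apply: zclosed_imply => _; apply: zclosed_imply => ?.
  exact: zclosed_flagE.
- apply: zclosed_forall => j; apply: zclosed_imply => _; apply: zclosed_imply => ?.
  exact: zclosed_flagF.
Qed.

Local Notation rmap k al be ga w1 w2 :=
  ((u, (frameE k al be ga, frameF k w1 w2)) : zcoord RS).

Lemma vlineZ (V : vectType K) c (v : V) : c != 0 -> <[c *: v]>%VS = <[v]>%VS.
Proof.
move=> c0; apply/eqP; rewrite eqEsubv -!memvE memvZ ?memv_line //=.
by rewrite -{1}(scalerK c0 v) memvZ ?memv_line.
Qed.

Lemma vline_exchange (V : vectType K) (U : {vspace V}) s t (v w : V) : s != 0 ->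
  (U + <[s *: v + t *: w]> + <[w]> = U + <[v]> + <[w]>)%VS.
Proof.
move=> s0; rewrite -!addvA; congr (_ + _)%VS; rewrite addvC [RHS]addvC.
by apply: (addv_lineC s0); rewrite addrAC subrr add0r memvZ ?memv_line.
Qed.

Lemma vline_exchange' (V : vectType K) (U : {vspace V}) s t (v w : V) : t != 0 ->
  (U + <[s *: v + t *: w]> + <[v]> = U + <[v]> + <[w]>)%VS.
Proof. by move=> t0; rewrite addrC vline_exchange // -!addvA [(<[w]> + _)%VS]addvC. Qed.

Lemma polymap_rmap (W : vectType K) k (al be ga : W -> V0) (w1 w2 : W -> V1) :
  polymap al -> polymap be -> polymap ga -> polymap w1 -> polymap w2 ->
  polymap (fun w => rmap k (al w) (be w) (ga w) (w1 w) (w2 w)).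
Proof.
move=> p1 p2 p3 q1 q2; apply: polymap_pair; first exact: polymap_const.
apply: polymap_pair; apply: polymap_ffun => i.
  apply: (@polymap_ext _ _ _ (fun w => stepE k (al w) (be w) (ga w) i)).
    by move=> w; rewrite ffunE.
  rewrite /stepE; case: (_ < k)%N; first exact: polymap_const.
  by case: (_ == k) => //; case: (_ == k.+1) => //; case: (_ == k.+2) => //;
    exact: polymap_const.
apply: (@polymap_ext _ _ _ (fun w => stepF k (w1 w) (w2 w) i)).
  by move=> w; rewrite ffunE.
rewrite /stepF; case: (_ < k)%N; first exact: polymap_const.
by case: (_ == k) => //; case: (_ == k.+1) => //; exact: polymap_const.
Qed.

Lemma zhomogeneous_RS : zhomogeneous RS.
Proof.
apply: zhomogeneous_prod; first exact: zhomogeneous_affine.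
by apply: zhomogeneous_prod; apply: zhomogeneous_flag.
Qed.

Lemma rmap_frame k U1 U2 U3 W1 W2 al be ga w1 w2 : (k.+1 < n)%N ->
  (A k + U1 = A k + <[al]>)%VS -> (A k.+1 + U2 = A k + U1 + <[be]>)%VS ->
  ((k.+2 < n)%N -> A k.+2 + U3 = A k.+1 + U2 + <[ga]>)%VS ->
  (D k + W1 = D k + <[w1]>)%VS -> (D k.+1 + W2 = D k + W1 + <[w2]>)%VS ->
  in_fiber (mkE k U1 U2 U3) (mkF k W1 W2) ->
  zframe (rmap k al be ga w1 w2) /\
  zcls (rmap k al be ga w1 w2) = flag_point (mkE k U1 U2 U3) (mkF k W1 W2).
Proof.
move=> kn h1 h2 h3 g1 g2 H.
have [fE cE] := mkE_frame h1 h2 h3 (fib_dimE H (leqnn n)).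
have [fF cF] := mkF_frame g1 g2 (fib_dimF H (leqnn n)).
by split; [|rewrite /flag_point -cE -cF].
Qed.

Lemma flagE_zcls (w : zcoord RS) (i : 'I_n) :
  flagE (zcls w) i.+1 = (flagE (zcls w) i + <[w.2.1 i]>)%VS.
Proof.
rewrite /flagE /= !ffunE !inordK ?ltnS // ?(ltnW (ltn_ord i)) //.
rewrite (bigD1 i) //= addvC; congr (_ + _)%VS; apply: eq_bigl => j.
by rewrite ltnS -val_eqE /= ltn_neqAle andbC.
Qed.

Lemma flagF_zcls (w : zcoord RS) (i : 'I_n) :
  flagF (zcls w) i.+1 = (flagF (zcls w) i + <[w.2.2 i]>)%VS.
Proof.
rewrite /flagF /= !ffunE !inordK ?ltnS // ?(ltnW (ltn_ord i)) //.
rewrite (bigD1 i) //= addvC; congr (_ + _)%VS; apply: eq_bigl => j.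
by rewrite ltnS -val_eqE /= ltn_neqAle andbC.
Qed.

(** * The surfaces are isomorphic to the blow-up *)

Section Level.
Variable k : nat.
Hypothesis kn : (k.+1 < n)%N.
Let kn' := ltnW kn.

Definition fS (z : zpt RS) : zpt (blowup2_space K) :=
  (pr k @: flagF z k.+1, (<[e3 0]> + plift k @: flagE z k.+1, pr k @: flagF z k.+2))%VS.
Definition gS (y : zpt (blowup2_space K)) : zpt RS :=
  flag_point (mkE k (iota0 k @: y.2.1) <[a0]> <[a0]>)
             (mkF k (iota1 k @: y.1) (iota1 k @: y.2.2)).

Lemma fS_Sset z : Sset k z -> incidence (fS z) /\ gS (fS z) = z.
Proof.
move=> [/springer_fiberP[z1 H] S]; have [inc E] := S_struct H kn S.
by split=> //; apply: esym; apply: flag_point_eta.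
Qed.

(** p lifts the line E_(k+1) / A_k, and c records whether its P_k- or its a0-coefficient is known to
    be nonzero; the other of the two vectors then completes E_(k+1) to A_(k+1) + <a0>. *)
Lemma S_chart (c : bool) r (Y1 Y2 : {vspace 'rV[K]_3}) (p q : 'rV[K]_3) :
  incidence ((<[r]>, (Y1, Y2))%VS : zpt (blowup2_space K)) ->
  p \in Y1 -> q \in Y2 -> q \notin <[r]>%VS ->
  p 0 (if c then inord 1 else inord 2) != 0 ->
  [/\ (A k + iota0 k @: Y1 = A k + <[iota0 k p]>)%VS,
      (A k.+1 + <[a0]> = A k + iota0 k @: Y1 + <[if c then a0 else P k]>)%VS,
      (D k + iota1 k @: <[r]> = D k + <[iota1 k r]>)%VS &
      (D k.+1 + iota1 k @: Y2 = D k + iota1 k @: <[r]> + <[iota1 k q]>)%VS].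
Proof.
move=> [/= [dr dY1 dY2] [rY1 rY2 eY1 eY2]] pY1 qY2 qr sp.
have [x [x0 nx Y1E]] := plane_line_coef (isT : (0 < 3)%N) dY1 eY1.
have iY1 : (iota0 k @: Y1 = <[iota0 k p]>)%VS.
  rewrite Y1E limgD !limg_line iota0_e0.
  have /addv_idPr -> : (<[0 : V0]> <= <[iota0 k x]>)%VS by rewrite -memvE mem0v.
  move: pY1; rewrite Y1E => /memv_addv_lineP[d /vlineP[l pE]].
  have {}pE : p = l *: e3 0 + d *: x by rewrite -pE subrK.
  have d0 : d != 0.
    apply: contraTneq sp => d0; rewrite pE d0 scale0r addr0 negbK mxE.
    by case: c => /=; rewrite e3E // mulr0.
  by rewrite pE lfunD !lfunZ iota0_e0 scaler0 add0r vlineZ.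
split.
- by rewrite iY1.
- rewrite iY1 iota0E AspaceS; case: c sp => sp; first by rewrite vline_exchange.
  by rewrite vline_exchange'.
- by rewrite limg_line.
have r0 : r != 0 by move: dr; rewrite dim_vline; case: (r != 0).
have Y2E : Y2 = (<[r]> + <[q]>)%VS.
  by apply: addv_line_dim; rewrite ?dY2 ?dr.
rewrite -addvA -limg_line -limgD -Y2E DspaceS -addvA.
suff /addv_idPr -> : (<[Q k]> <= iota1 k @: Y2)%VS by [].
rewrite -memvE; apply/memv_imgP; exists (e3 1) => //.
by rewrite iota1E !e3E // !scale0r scale1r add0r addr0.
Qed.

Lemma det_rows3_notin (z r q : 'rV[K]_3) : \det (rows3 z r q) != 0 -> q \notin <[r]>%VS.
Proof.
apply: contraNN => /vlineP[l ->].
apply/det0P; exists (l *: e3 1 - e3 2).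
  apply/eqP => /rowP/(_ (inord 2)); rewrite [RHS]mxE !mxE -!val_eqE /= !inordK //=.
  by rewrite mulr0 sub0r => /eqP; rewrite oppr_eq0 oner_eq0.
rewrite mul_rows3 !mxE -!val_eqE /= !inordK //=.
by rewrite !mulr0 !mulr1 !subr0 sub0r scale0r add0r scaleNr scale1r subrr.
Qed.

(** The charts cover everything. The condition that q_j is not in <r> is certified by a determinant
    with an auxiliary row z outside the plane, because a chart must be given by one polynomial. *)
Lemma S_chart_exists (r : 'rV[K]_3) (p q : {ffun 'I_2 -> 'rV[K]_3}) :
  incidence ((<[r]>, (<<codom p>>, <<codom q>>))%VS : zpt (blowup2_space K)) ->
  exists (c : bool) (i j : 'I_2) z,
    p i 0 (if c then inord 1 else inord 2) != 0 /\ \det (rows3 z r (q j)) != 0.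
Proof.
move=> [/= [dr dY1 dY2] [rY1 rY2 eY1 eY2]].
have ex (f : {ffun 'I_2 -> 'rV[K]_3}) v : \dim <<codom f>> = 2%N ->
    exists i, f i \notin <[v]>%VS.
  move=> df; apply: contrapT => H.
  have : (<<codom f>> <= <[v]>)%VS.
    rewrite span_codom; apply/subv_sumP => i _; rewrite -memvE.
    by apply/negPn/negP => fi; apply: H; exists i.
  by move=> /dimvS; rewrite df dim_vline; case: (v != 0).
have [i pi] := ex p (e3 0) dY1; have [j qj] := ex q r dY2.
have [c pc] : exists c : bool, p i 0 (if c then inord 1 else inord 2) != 0.
  have [p1|p1] := eqVneq (p i 0 (inord 1)) 0; last by exists true.
  have [p2|p2] := eqVneq (p i 0 (inord 2)) 0; last by exists false.
  by case/negP: pi; rewrite [p i]row3E p1 p2 !scale0r !addr0 memvZ ?memv_line.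
have rq : <<codom q>>%VS = (<[r]> + <[q j]>)%VS.
  by apply: addv_line_dim; rewrite ?dY2 ?dr // memv_span // codom_f.
have [z _ zn] : exists2 z, z \in fullv & z \notin <<codom q>>%VS.
  apply/subvPn/negP => /dimvS.
  by rewrite dY2 dimvf dim_matrix.
exists c, i, j, z; split=> //; apply: contraNneq zn => d0; rewrite rq.
by apply/det_rows3_eq0; rewrite -?rq.
Qed.

Lemma incidence_frame (w : zcoord (blowup2_space K)) : zframe w ->
  zcls w = (<[w.1 ord0]>, (<<codom w.2.1>>, <<codom w.2.2>>))%VS.
Proof. by move=> _; rewrite /= {1}[w.1]frame1_eta span_frame1. Qed.

(** Y is spanned by [e3 1], sent to Q_k and absorbed by D_j, and by a vector without that component,
    sent into <b1, a1>. *)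
Lemma S_top (Y : {vspace 'rV[K]_3}) : \dim Y = 2%N -> e3 1 \in Y ->
  exists w, [/\ w \in N 0, w != 0 &
    forall j, (k < j)%N -> (D j + iota1 k @: Y = D j + <[w]>)%VS].
Proof.
move=> dY eY; have [y [y1 ny YE]] := plane_line_coef (isT : (1 < 3)%N) dY eY.
have y0 : y != 0 by apply: contraNneq ny => ->; exact: mem0v.
exists (iota1 k y); split.
- rewrite iota1E y1 scale0r addr0.
  by rewrite memvD ?memvZ ?b1_N ?a1_N.
- by apply: contraNneq y0 => i0; rewrite -(iota1K kn y) i0 linear0.
move=> j kj; rewrite YE limgD !limg_line addvA; congr (_ + _)%VS.
apply/addv_idPl; rewrite -memvE iota1E !e3E // !scale0r scale1r add0r addr0.
exact: memD.
Qed.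

Lemma limg_cancel (V W : vectType K) (i : 'Hom(W, V)) (p : 'Hom(V, W)) U :
  cancel i p -> (p @: (i @: U) = U)%VS.
Proof.
move=> ip; rewrite -limg_comp; have -> : (p \o i)%VF = \1%VF; last exact: lim1g.
by apply/lfunP => x; rewrite comp_lfunE id_lfunE ip.
Qed.

Lemma limg_zero (V W : vectType K) (p : 'Hom(V, W)) (U : {vspace V}) :
  (forall x, x \in U -> p x = 0) -> (p @: U = 0)%VS.
Proof.
move=> p0; apply/eqP; rewrite -lkerE; apply/subvP => x /p0 px.
by rewrite memv_ker px.
Qed.

Lemma gS_fiber (w : zcoord (blowup2_space K)) : zframe w -> incidence (zcls w) ->
  in_fiber
    (mkE k (iota0 k @: (zcls w).2.1) <[a0]> <[a0]>)
    (mkF k (iota1 k @: (zcls w).1) (iota1 k @: (zcls w).2.2)).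
Proof.
move=> fw inc; rewrite (incidence_frame fw) in inc *.
set r := w.1 ord0 in inc *.
have [c [i [j [z [pc dz]]]]] := S_chart_exists inc.
have [h1 h2 g1 g2] := S_chart inc (memv_span (codom_f _ i)) (memv_span (codom_f _ j))
  (det_rows3_notin dz) pc.
have [/= [dr dY1 dY2] [rY1 rY2 eY1 eY2]] := inc.
have [v [vN v0 vE]] := S_top dY2 eY2.
have h3 : ((k.+2 < n)%N -> A k.+2 + <[a0]> = A k.+1 + <[a0]> + <[P k.+1]>)%VS.
  by move=> _; rewrite AspaceS -!addvA [(<[P _]> + _)%VS]addvC.
have n0 : n = n.-1.+1 by rewrite prednK // (leq_ltn_trans _ kn).
have n1 : (n.-1 < n)%N by rewrite {2}n0.
have [aA _] := dim_A_line (ltnW n1) (a0_M 0) a0_neq0.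
(* [us] carries [iota1] to [iota0], so the incidence of the point with its line through [e3 0]
   yields us F_(k+1) <= E_(k+1). *)
have us_i s : us (iota1 k s) = iota0 k s.
  by rewrite iota1E iota0E !lfunD !lfunZ (sf_usb1 sf) (sf_usQ sf) // (sf_usa1 sf) scaler0 add0r.
have us_img U : (us @: (iota1 k @: U) = iota0 k @: U)%VS.
  by rewrite -limg_comp; congr (_ @: _)%VS; apply/lfunP => s; rewrite comp_lfunE us_i.
have iU U : (iota0 k @: U <= A k.+1 + <[a0]>)%VS.
  apply/subvP => _ /memv_imgP[s _ ->]; rewrite iota0E memv_add ?memvZ ?memv_line //.
  exact: memA.
apply: (mk_in_fiber kn h1 h2 h3 _ aA (a0_M _) phi_a0a0 g1 g2 _ vN v0).
- have := kn; rewrite leq_eqVlt => /orP[/eqP nE|kn2]; last by rewrite mkE_high.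
  by rewrite -[in LHS]nE mkE2 -nE.
- by rewrite mkF_high // vE // -ltnS -n0.
- apply/subvP => _ /memv_imgP[_ /memv_imgP[s _ ->] ->].
  rewrite iota0E lfunD !lfunZ (sf_ua0 sf) scaler0 addr0 memvZ //.
  by apply: (u_A kn'); apply: memA.
- by rewrite limg_line (sf_ua0 sf) -memvE mem0v.
- by rewrite limg_line (sf_ua0 sf) -memvE mem0v.
- by rewrite us_img; apply: subv_trans (addvSr _ _); rewrite limgS.
- by rewrite us_img.
- by move=> _; rewrite us_img; apply: subv_trans (iU _) _; rewrite addvS // Aspace_le.
Qed.

Lemma gS_incidence y : incidence y -> Sset k (gS y) /\ fS (gS y) = y.
Proof.
move=> inc; have [w fw wy] := incidence_zpoints inc; subst y.
have Fi := gS_fiber fw inc; split.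
  split; first exact: springer_fiber_point.
  have jn j : (j <= k)%N -> (j <= n)%N by move=> jk; rewrite (leq_trans jk) // ltnW.
  split=> [j jk|j jk|].
  - by rewrite flagE_point ?mkE_low ?jn.
  - by rewrite flagF_point ?mkF_low ?jn.
  - by rewrite flagE_point // mkE2.
have [/= [dr dY1 dY2] [rY1 rY2 eY1 eY2]] := inc.
rewrite /fS; have -> : flagE (gS (zcls w)) k.+1 = (A k + iota0 k @: (zcls w).2.1)%VS.
  by rewrite flagE_point ?mkE1 // ltnW.
have -> : flagF (gS (zcls w)) k.+1 = (D k + iota1 k @: (zcls w).1)%VS.
  by rewrite flagF_point ?mkF1 // ltnW.
have -> : flagF (gS (zcls w)) k.+2 = (D k.+1 + iota1 k @: (zcls w).2.2)%VS.
  by rewrite flagF_point ?mkF_high.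
rewrite !limgD !(limg_cancel _ (iota1K kn)).
have -> : (pr k @: D k = 0)%VS by apply: limg_zero => x; apply: (pr_D kn).
have -> : (plift k @: A k = 0)%VS by apply: limg_zero => x; apply: (plift_A kn).
rewrite !add0v; congr (_, (_, _)).
  (* [plift] after [iota0] loses the [e3 0] component, which [fS] restores by adding that centre. *)
  have [x [x0 nx Y1E]] := plane_line_coef (isT : (0 < 3)%N) dY1 eY1.
  rewrite (Y1E : (zcls w).2.1 = _) !limgD !limg_line iota0_e0 linear0 addvA addv0.
  by rewrite (pliftK kn) x0 scale0r subr0; exact/esym/Y1E.
apply/addv_idPr; rewrite DspaceS limgD limg_line subv_add -memvE; apply/andP; split.
  have -> : (pr k @: D k = 0)%VS by apply: limg_zero => x; apply: (pr_D kn).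
  exact: sub0v.
rewrite prE gb_Q // ga_Q // nu_Q //.
by rewrite !scale0r scale1r add0r addr0.
Qed.

Lemma Sset_zpoints : Sset k `<=` @zpoints _ RS.
Proof.
move=> z Sz; have [inc <-] := fS_Sset Sz.
have [w fw wy] := incidence_zpoints inc; rewrite -wy in inc *.
have Fi := gS_fiber fw inc; rewrite /gS (incidence_frame fw) in inc Fi *.
have [c [i [j [zz [pc dz]]]]] := S_chart_exists inc.
have [h1 h2 g1 g2] := S_chart inc (memv_span (codom_f _ i)) (memv_span (codom_f _ j))
  (det_rows3_notin dz) pc.
have h3 : ((k.+2 < n)%N -> A k.+2 + <[a0]> = A k.+1 + <[a0]> + <[P k.+1]>)%VS.
  by move=> _; rewrite AspaceS -!addvA [(<[P _]> + _)%VS]addvC.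
by have [fr <-] := rmap_frame kn h1 h2 h3 g1 g2 Fi; exists (rmap k (iota0 k (w.2.1 i))
  (if c then a0 else P k) (P k.+1) (iota1 k (w.1 ord0)) (iota1 k (w.2.2 j))).
Qed.

Lemma gS_morphism : @variety_morphism K (blowup2_space K) RS (@incidence K) (Sset k) gS.
Proof.
apply: variety_morphism_lift.
- exact: zhomogeneous_blowup2_space.
- by move=> y /gS_incidence[].
- exact: incidence_zpoints.
move=> w0 fw0 inc0; have inc1 := inc0; rewrite (incidence_frame fw0) in inc1.
have [c [i [j [zz [pc dz]]]]] := S_chart_exists inc1.
pose cc : 'I_3 := if c then inord 1 else inord 2.
have pid := @polymap_id K (zcoord (blowup2_space K)).
have p1 := polymap_eval ord0 (polymap_fst pid).
have p2 := polymap_eval i (polymap_fst (polymap_snd pid)).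
have p3 := polymap_eval j (polymap_snd (polymap_snd pid)).
(* The chart is where the chosen coefficient of p and the certifying determinant are both
   nonzero. *)
exists (fun w : zcoord (blowup2_space K) => w.2.1 i 0 cc * \det (rows3 zz (w.1 ord0) (w.2.2 j))).
exists (fun w : zcoord (blowup2_space K) => rmap k (iota0 k (w.2.1 i)) (if c then a0 else P k) (P k.+1)
  (iota1 k (w.1 ord0)) (iota1 k (w.2.2 j))); split.
- apply: polyfun_mul; first exact: polyfun_rowcoef.
  by apply: polyfun_det3 p1 p3; apply: polymap_const.
- by rewrite mulf_neq0.
- by apply: polymap_rmap; [exact: (polymap_hom _ p2)|exact: polymap_const|
    exact: polymap_const|exact: (polymap_hom _ p1)|exact: (polymap_hom _ p3)].
move=> w fw inc; rewrite mulf_eq0 negb_or => /andP[pc' dz'].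
have Fi := gS_fiber fw inc; rewrite /gS (incidence_frame fw) in inc Fi *.
have [h1 h2 g1 g2] := S_chart inc (memv_span (codom_f _ i)) (memv_span (codom_f _ j))
  (det_rows3_notin dz') pc'.
have h3 : ((k.+2 < n)%N -> A k.+2 + <[a0]> = A k.+1 + <[a0]> + <[P k.+1]>)%VS.
  by move=> _; rewrite AspaceS -!addvA [(<[P _]> + _)%VS]addvC.
exact: rmap_frame kn h1 h2 h3 g1 g2 Fi.
Qed.

Let k0 : 'I_n := Ordinal kn'.
Let k1 : 'I_n := Ordinal kn.

Lemma fS_morphism : @variety_morphism K RS (blowup2_space K) (Sset k) (@incidence K) fS.
Proof.
apply: variety_morphism_lift.
- exact: zhomogeneous_RS.
- by move=> z /fS_Sset[].
- exact: Sset_zpoints.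
move=> w0 fw0 S0.
have pid := @polymap_id K (zcoord RS).
have pE i := polymap_eval i (polymap_fst (polymap_snd pid)).
have pF i := polymap_eval i (polymap_snd (polymap_snd pid)).
(* The frame vectors of index k and k + 1 are those added at levels k + 1 and k + 2; the standard
   lower members map to 0, so their images lift [fS] everywhere. *)
exists (fun=> 1), (fun w : zcoord RS => (frame1 (pr k (w.2.2 k0)),
  (frame2 (e3 0) (plift k (w.2.1 k0)), frame2 (pr k (w.2.2 k0)) (pr k (w.2.2 k1))))); split.
- exact: polyfun_const.
- exact: oner_neq0.
- apply: polymap_pair; first by apply: polymap_frame1; apply: polymap_hom; apply: pF.
  apply: polymap_pair; apply: polymap_frame2; [exact: polymap_const|..].
  + by apply: polymap_hom; apply: pE.
  + by apply: polymap_hom; apply: pF.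
  + by apply: polymap_hom; apply: pF.
move=> w fw Sw _; have [inc _] := fS_Sset Sw.
have [/springer_fiberP[_ H] cS] := Sw.
have [Ek Fk] := S_low H kn cS (leqnn k).
have fE : (plift k @: flagE (zcls w) k.+1 = <[plift k (w.2.1 k0)]>)%VS.
  rewrite (flagE_zcls w k0) limgD limg_line Ek.
  have -> : (plift k @: A k = 0)%VS by apply: limg_zero => x; apply: (plift_A kn).
  by rewrite add0v.
have fF : (pr k @: flagF (zcls w) k.+1 = <[pr k (w.2.2 k0)]>)%VS.
  rewrite (flagF_zcls w k0) limgD limg_line Fk.
  have -> : (pr k @: D k = 0)%VS by apply: limg_zero => x; apply: (pr_D kn).
  by rewrite add0v.
have fF2 : (pr k @: flagF (zcls w) k.+2 = <[pr k (w.2.2 k0)]> + <[pr k (w.2.2 k1)]>)%VS.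
  by rewrite (flagF_zcls w k1) limgD limg_line fF.
move: inc; rewrite /fS fE fF fF2 => -[/= [d1 d2 d3] _].
split; last by rewrite /= span_frame1 !span_frame2.
by split; [|split]; apply/zframe_dim; rewrite ?span_frame1 ?span_frame2.
Qed.

Lemma Sset_iso : variety_iso (Sset k) (blowup2 <[e3 0]> <[e3 1]>).
Proof.
rewrite (blowup2E charK); exists fS, gS; split.
- exact: fS_morphism.
- exact: gS_morphism.
- by move=> z /fS_Sset[].
- by move=> y /gS_incidence[].
Qed.

Lemma Sset_irreducible : irreducible (Sset k).
Proof.
have irr := irreducible_blowup2 charK; rewrite (blowup2E charK) in irr.
have := irreducible_image gS_morphism irr.
suff -> : gS @` (@incidence K) = Sset k by [].
apply/seteqP; split=> [_ [y /gS_incidence[? _] <-] //|z Sz].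
by have [inc E] := fS_Sset Sz; exists (fS z).
Qed.

End Level.

(** * The curves are projective lines *)

Local Notation P1 := (@zpoints _ (projective_space K 1)).

(** Serves both for the curves and for the intersections of consecutive surfaces: f is read off one
    frame vector, g is lifted locally in a vector r spanning the line, and irreducibility is carried
    over from P^1 by g. *)
Lemma line_isomorphism (S : set (zpt RS)) (f : zpt RS -> {vspace 'rV[K]_2})
    (g : {vspace 'rV[K]_2} -> zpt RS) (p : 'Hom(V1, 'rV[K]_2)) (i : 'I_n) :
  (forall z, S z -> \dim (f z) = 1%N /\ g (f z) = z) ->
  (forall y, \dim y = 1%N -> S (g y) /\ f (g y) = y) ->
  (forall w, zframe w -> S (zcls w) -> f (zcls w) = <[p (w.2.2 i)]>%VS) ->
  (forall r0 : 'rV[K]_2, r0 != 0 -> exists (q : 'rV[K]_2 -> K) (G : 'rV[K]_2 -> zcoord RS),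
    [/\ polyfun q, q r0 != 0, polymap G & forall r : 'rV[K]_2, r != 0 -> q r != 0 ->
      zframe (G r) /\ zcls (G r) = g <[r]>%VS]) ->
  [/\ variety_iso S P1, irreducible S & S `<=` @zpoints _ RS].
Proof.
move=> Sf Sg liftf liftg.
have Sz : S `<=` @zpoints _ RS.
  move=> z Sz; have [d1 <-] := Sf _ Sz; have [r r0 ->] := vline_exists d1.
  have [q [G [_ qr _ HG]]] := liftg _ r0; have [fG <-] := HG _ r0 qr.
  by exists (G r).
have P1P y : P1 y <-> \dim y = 1%N by exact: zpoints_grassmannian.
have gm : @variety_morphism K (projective_space K 1) RS P1 S g.
  apply: variety_morphism_lift => //; first exact: zhomogeneous_grassmannian.
    by move=> y /P1P/Sg[].
  have w1E w : zframe (w : zcoord (projective_space K 1)) ->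
      w ord0 != 0 /\ zcls w = <[w ord0]>%VS.
    rewrite {1}[w]frame1_eta => /zframe_dim; rewrite span_frame1 dim_vline => d.
    split; first by case: eqP d.
    by rewrite /= {1}[w]frame1_eta span_frame1.
  move=> w0 fw0 _; have [r0 _] := w1E _ fw0.
  have [q [G [qp qr Gp HG]]] := liftg _ r0.
  have pw := polymap_eval ord0 (@polymap_id K (zcoord (projective_space K 1))).
  exists (fun w : zcoord (projective_space K 1) => q (w ord0)),
    (fun w : zcoord (projective_space K 1) => G (w ord0)); split=> //.
  - exact: polyfun_comp pw qp.
  - by move=> l; apply: polyfun_comp pw (Gp l).
  move=> w fw _ qw; have [wn ->] := w1E _ fw; exact: HG.
have fm : @variety_morphism K RS (projective_space K 1) S P1 f.
  apply: variety_morphism_lift => //; first exact: zhomogeneous_RS.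
    by move=> z /Sf[d _]; apply/P1P.
  move=> w0 fw0 Sw0.
  exists (fun=> 1), (fun w : zcoord RS => frame1 (p (w.2.2 i))); split.
  - exact: polyfun_const.
  - exact: oner_neq0.
  - apply: polymap_frame1; apply: polymap_hom; apply: polymap_eval.
    exact/polymap_snd/polymap_snd/polymap_id.
  move=> w fw Sw _; have fE := liftf _ fw Sw; have [d _] := Sf _ Sw.
  rewrite fE in d *; split; last by rewrite /= span_frame1.
  by apply/zframe_dim; rewrite span_frame1.
split=> //.
  exists f, g; split=> //; first by move=> z /Sf[].
  by move=> y /P1P/Sg[].
have := irreducible_image gm (irreducible_line charK).
suff -> : g @` P1 = S by [].
apply/seteqP; split=> [_ [y /P1P/Sg[? _] <-] //|z zS].
by have [d E] := Sf _ zS; exists (f z) => //; apply/P1P.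
Qed.

Section Level.
Variable k : nat.
Hypothesis kn : (k.+1 < n)%N.
Let kn' := ltnW kn.
Let k0 : 'I_n := Ordinal kn'.
Let k1 : 'I_n := Ordinal kn.
Let n0 : n = n.-1.+1. Proof. by rewrite prednK // (leq_ltn_trans _ kn). Qed.
Let n1 : (n.-1 < n)%N. Proof. by rewrite {2}n0. Qed.

Definition fC (z : zpt RS) : {vspace 'rV[K]_2} := (prC k @: flagF z k.+1)%VS.
Definition gC (y : {vspace 'rV[K]_2}) : zpt RS :=
  flag_point (mkE k <[P k]> <[betav k (vpick y)]> <[b0]>)
             (mkF k (iotaC k @: y) <[b1]>).

Lemma fC_Cset z : Cset k z -> \dim (fC z) = 1%N /\ gC (fC z) = z.
Proof.
move=> [/springer_fiberP[z1 H] S]; have [d E] := C_struct H kn S.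
by split=> //; apply: esym; apply: flag_point_eta.
Qed.

(** [betav] is homogeneous, of degree 1, or of degree 2 in the conic case; hence the vector chosen
    by [vpick] does not influence the flag. *)
Lemma betav_scale l r : exists2 e, l != 0 -> e != 0 & betav k (l *: r) = e *: betav k r.
Proof.
rewrite /betav !mxE; case: ifP => _.
  by exists l => //; rewrite scalerDr !scalerA.
exists (l ^+ 2) => [l0|]; first by rewrite expf_neq0.
rewrite scalerBr scalerDr !scalerA.
by congr (_ *: _ + _ *: _ - _ *: _); ring.
Qed.

Lemma betav_line r : r != 0 -> <[betav k (vpick <[r]>)]>%VS = <[betav k r]>%VS.
Proof.
move=> r0; have : vpick <[r]>%VS \in <[r]>%VS by exact: memv_pick.
have : vpick <[r]>%VS != 0 by rewrite vpick0 -dimv_eq0 dim_vline r0.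
move=> /[swap] /vlineP[l ->]; rewrite scaler_eq0 negb_or => /andP[l0 _].
by have [e /(_ l0) e0 ->] := betav_scale l r; rewrite vlineZ.
Qed.

(** c, coerced to an index, names a nonzero coordinate of r; each frame is completed by the vector
    whose coefficient is the other coordinate. *)
Lemma C_chart (c : bool) (r : 'rV[K]_2) : r != 0 -> r 0 (inord c) != 0 ->
  [/\ (A k.+1 + <[betav k (vpick <[r]>)]> = A k + <[P k]> + <[betav k r]>)%VS,
      ((k.+2 < n)%N -> A k.+2 + <[b0]> = A k.+1 + <[betav k (vpick <[r]>)]> +
         <[if c then b0 else P k.+1]>)%VS,
      (D k + iotaC k @: <[r]> = D k + <[iotaC k r]>)%VS &
      (D k.+1 + <[b1]> = D k + iotaC k @: <[r]> + <[if c then b1 else Q k]>)%VS].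
Proof.
move=> r0 rc; rewrite betav_line // limg_line AspaceS; split=> //.
  move=> kn2; rewrite /betav kn2 -AspaceS AspaceS; case: c rc => rc.
    by rewrite vline_exchange.
  by rewrite vline_exchange'.
rewrite iota2E DspaceS; case: c rc => rc.
  by rewrite vline_exchange' // -!addvA [(<[b1]> + _)%VS]addvC.
by rewrite vline_exchange // -!addvA [(<[b1]> + _)%VS]addvC.
Qed.

Lemma C_chart_exists (r : 'rV[K]_2) : r != 0 -> exists c : bool, r 0 (inord c) != 0.
Proof.
move=> r0; apply: contrapT => H; case/eqP: r0; apply: row2P => j j2; rewrite mxE.
apply/eqP/negPn/negP => rj; apply: H; exists (j == 1%N).
by case: j j2 rj => [|[|]].
Qed.

Lemma betav_coord r : k.+2 = n -> [/\ betav k r \in M k.+2,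
  mu k.+1 (betav k r) = r 0 (inord 0) * r 0 (inord 1),
  fb (betav k r) = r 0 (inord 0) ^+ 2 &
  fa (betav k r) = - (phi (P n.-1) (P n.-1) / 2%:R * r 0 (inord 1) ^+ 2)].
Proof.
move=> nE; rewrite /betav nE ltnn; split.
- by rewrite -nE memvB ?memvD ?memvZ ?a0_M ?b0_M // (subvP (A_sub_M _)) // memA.
- rewrite lformB lformD !lformZ mu_P // !(mu_M kn) ?a0_M ?b0_M //.
  by rewrite !mulr0 mulr1 addr0 subr0.
- rewrite lformB lformD !lformZ fb_P // fb_b0 fb_a0.
  by rewrite !mulr0 mulr1 add0r subr0.
- rewrite lformB lformD !lformZ fa_P // fa_b0 fa_a0.
  by rewrite !mulr0 mulr1 !add0r.
Qed.

Lemma mkE_top U1 U2 U3 m : k.+2 = m -> mkE k U1 U2 U3 m = (A m.-1 + U2)%VS.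
Proof. by move=> <-; rewrite mkE2. Qed.

Lemma gC_fiber r : r != 0 -> in_fiber
  (mkE k <[P k]> <[betav k (vpick <[r]>)]> <[b0]>) (mkF k (iotaC k @: <[r]>) <[b1]>).
Proof.
move=> r0; have [c rc] := C_chart_exists r0.
have [h2 h3 g1 g2] := C_chart r0 rc.
have uP : u (P k) \in D k by apply: (u_A kn'); apply: memA.
have uW : (u @: <[P k]> <= D k)%VS by rewrite limg_line -memvE.
have ub0 : (u @: <[b0]> <= <[b1]>)%VS by rewrite limg_line (sf_ub0 sf).
have usb1 U : (us @: <[b1]> <= U)%VS by rewrite limg_line (sf_usb1 sf) -memvE mem0v.
have usW : (us @: (iotaC k @: <[r]>) <= A k + <[P k]>)%VS.
  rewrite !limg_line iota2E lfunD !lfunZ (sf_usb1 sf) (sf_usQ sf) // scaler0 add0r.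
  by rewrite -AspaceS -memvE memvZ // memA.
have Fn : mkF k (iotaC k @: <[r]>) <[b1]> n = (D n.-1 + <[b1]>)%VS.
  by rewrite mkF_high.
have [nE|kn2] : k.+2 = n \/ (k.+2 < n)%N.
  by move: kn; rewrite leq_eqVlt => /orP[/eqP|]; [left|right].
  have [bM bmu bfb bfa] := betav_coord r nE.
  (* u maps the point of the conic to a multiple of [iotaC k r], which is the inclusion u E_(k+2) <=
     F_(k+1). *)
  have ub : u (betav k r) = r 0 (inord 0) *: iotaC k r.
    rewrite /betav nE ltnn lfunB lfunD !lfunZ (sf_uP sf) // (sf_ub0 sf) (sf_ua0 sf).
    by rewrite scaler0 subr0 iota2E scalerDr !scalerA addrC expr2.
  have n1E : n.-1 = k.+1 by rewrite -nE.
  have bA : betav k r \notin A n.-1.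
    apply/negP => bA; have := fb_A (ltnW n1) bA; have := fa_A (ltnW n1) bA.
    rewrite bfb bfa => /eqP; rewrite oppr_eq0 !mulf_eq0 (negPf (sf_Pn sf)) invr_eq0.
    rewrite (negPf two_neq0) /= orbb => /eqP r1z /eqP; rewrite expf_eq0 /= => /eqP r0z.
    by case/eqP: r0; apply: row2P => -[|[|//]] _; rewrite ?r1z ?r0z mxE.
  apply: (mk_in_fiber kn erefl h2 h3 _ bA _ _ g1 g2 Fn (b1_N _) b1_neq0) => //.
  - by rewrite (mkE_top _ _ _ nE) betav_line.
  - by rewrite nE in bM.
  (* The P_(n-1)-term cancels twice the product of the a0- and b0-coefficients; this is the origin
     of the factor 1/2 in [betav]. *)
  - rewrite (phi_M kn bM bM) bmu bfa bfb n1E.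
    by field; exact: two_neq0.
  - rewrite betav_line // limg_line ub -memvE (subvP (addvSr _ _)) // memvZ //.
    by rewrite limg_line memv_line.
have [bA _] := dim_A_line (ltnW n1) (b0_M 0) b0_neq0.
apply: (mk_in_fiber kn erefl h2 h3 _ bA _ _ g1 g2 Fn (b1_N _) b1_neq0) => //.
- by rewrite mkE_high.
- exact: b0_M.
- exact: (sf_bb sf).
- rewrite betav_line // limg_line /betav kn2 lfunD !lfunZ (sf_uP sf) // (sf_ub0 sf).
  by rewrite -memvE (subvP (addvSr _ _)) // limg_line iota2E addrC memv_line.
Qed.

Lemma gC_line y : \dim y = 1%N -> Cset k (gC y) /\ fC (gC y) = y.
Proof.
move=> /vline_exists[r r0 ->]; have Fi := gC_fiber r0.
have iK : cancel (iotaC k) (prC k).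
  by apply: pr2K; rewrite ?gb_b1 ?gb_Q ?nu_Q ?(nu_N kn') ?b1_N.
have E1 : flagE (gC <[r]>%VS) k.+1 = A k.+1 by rewrite flagE_point ?mkE1 ?AspaceS // ltnW.
have E2 : flagE (gC <[r]>%VS) k.+2 = (A k.+1 + <[betav k r]>)%VS.
  by rewrite flagE_point // mkE2 betav_line.
have F1 : flagF (gC <[r]>%VS) k.+1 = (D k + <[iotaC k r]>)%VS.
  by rewrite flagF_point ?mkF1 ?limg_line // ltnW.
split; last first.
  rewrite /fC F1 limgD limg_line iK.
  have -> : (prC k @: D k = 0)%VS by apply: limg_zero => x; apply: (prC_D kn').
  by rewrite add0v.
split; first exact: springer_fiber_point.
have jn j : (j <= k)%N -> (j <= n)%N by move=> jk; rewrite (leq_trans jk) // ltnW.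
split.
- move=> j; rewrite leq_eqVlt => /orP[/eqP->|jk]; first by rewrite E1.
  by rewrite flagE_point ?mkE_low ?jn.
- by move=> j jk; rewrite flagF_point ?mkF_low ?jn.
- split=> [kn2|nE].
    rewrite E2 subv_add; apply/andP; split.
      by apply: subv_trans (addvSl _ _); apply: Aspace_le.
    by rewrite -memvE /betav kn2 memv_add ?memvZ ?memv_line // memA.
  have [bM bmu bfb bfa] := betav_coord r nE.
  move=> w v; rewrite E2 F1 => /memv_addv_lineP[c wA] /memv_addv_lineP[d vD].
  have m1 : mu k.+1 w = c * (r 0 (inord 0) * r 0 (inord 1)).
    have := mu_M kn (subvP (A_sub_M _) _ wA).
    by rewrite lformB lformZ bmu => /eqP; rewrite subr_eq0 => /eqP.
  have f1 : fa w = c * - (phi (P n.-1) (P n.-1) / 2%:R * r 0 (inord 1) ^+ 2).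
    have := fa_A kn' wA; rewrite lformB lformZ bfa => /eqP.
    by rewrite subr_eq0 => /eqP.
  have n2 : nu k v = d * r 0 (inord 1).
    have := nu_N kn' (subvP (D_sub_N _) _ vD).
    rewrite lformB lformZ iota2E lformD !lformZ nu_Q // (nu_N kn' (b1_N _)).
    by rewrite mulr0 add0r mulr1 => /eqP; rewrite subr_eq0 => /eqP.
  have g2 : gb v = d * r 0 (inord 0).
    have := gb_D kn' vD; rewrite lformB lformZ iota2E lformD !lformZ gb_Q // gb_b1.
    by rewrite mulr0 addr0 mulr1 => /eqP; rewrite subr_eq0 => /eqP.
  rewrite /tangency m1 f1 n2 g2; field; exact: two_neq0.
- by move=> j kj jn'; rewrite flagE_point // mkE_high.
- by move=> j kj jn'; rewrite flagF_point // mkF_high.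
Qed.

Lemma Cset_geometry : [/\ variety_iso (Cset k) P1, irreducible (Cset k) &
  Cset k `<=` @zpoints _ RS].
Proof.
apply: (@line_isomorphism _ fC gC (prC k) k0).
- exact: fC_Cset.
- exact: gC_line.
- move=> w fw Cw; have [/springer_fiberP[_ H] cC] := Cw.
  have [_ Fk] := C_low H kn cC (leqnn k).
  rewrite /fC (flagF_zcls w k0) limgD limg_line Fk.
  have -> : (prC k @: D k = 0)%VS by apply: limg_zero => x; apply: (prC_D kn').
  by rewrite add0v.
move=> r0 r0n; have [c rc] := C_chart_exists r0n.
have pid := @polymap_id K 'rV[K]_2.
have pc i : polyfun (fun r : 'rV[K]_2 => r 0 (inord i)) by exact: polyfun_rowcoef.
exists (fun r : 'rV[K]_2 => r 0 (inord c)), (fun r : 'rV[K]_2 => rmap k (P k) (betav k r)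
  (if c then b0 else P k.+1) (iotaC k r) (if c then b1 else Q k)); split=> //.
- apply: polymap_rmap; try exact: polymap_const; last exact: polymap_hom.
  rewrite /betav; case: (_ < n)%N.
    by apply: polymap_add; apply: polymap_scale => //; exact: polymap_const.
  apply: polymap_add; last first.
    apply: (@polymap_ext _ _ _ (fun v : 'rV[K]_2 =>
      (- (phi (P n.-1) (P n.-1) / 2%:R)) * v 0 (inord 1) ^+ 2 *: a0)).
      by move=> v; rewrite mulNr scaleNr.
    apply: polymap_scale; last exact: polymap_const.
    by apply: polyfun_scale; apply: polyfun_mul.
  apply: polymap_add; apply: polymap_scale; try exact: polymap_const.
    exact: polyfun_mul.
  exact: polyfun_mul.
move=> r rn rc'; have [h2 h3 g1 g2] := C_chart rn rc'.
exact: (rmap_frame kn erefl h2 h3 g1 g2 (gC_fiber rn)).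
Qed.

End Level.

(** * Intersections of the components *)


Lemma a0_notin_A j : (j <= n)%N -> a0 \notin A j.
Proof. by move=> jn; have [] := dim_A_line jn (a0_M 0) a0_neq0. Qed.

Lemma b1_notin_D j : (j < n)%N -> b1 \notin D j.
Proof. by move=> jn; have [] := dim_D_line jn (b1_N 0) b1_neq0. Qed.

Lemma e2E i j : (i < 2)%N -> (j < 2)%N -> e2 i 0 (inord j) = (j == i)%:R.
Proof. by move=> i3 j3; rewrite mxE eqxx -val_eqE /= !inordK. Qed.

Lemma e2_neq0 i : (i < 2)%N -> e2 i != 0.
Proof.
move=> i2; apply/eqP => /rowP/(_ (inord i)); rewrite e2E // eqxx mxE.
by move/eqP; rewrite oner_eq0.
Qed.

Section Sdata.
Variables (k : nat) (z : zpt RS).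
Hypothesis kn : (k.+1 < n)%N.
Hypothesis Sz : Sset k z.

Lemma Sset_low j : (j <= k)%N -> flagE z j = A j /\ flagF z j = D j.
Proof. by have [/springer_fiberP[_ H] S] := Sz; apply: (S_low H kn S). Qed.

Lemma Sset_high j : (k.+1 < j)%N -> (j <= n)%N -> flagE z j = (A j.-1 + <[a0]>)%VS.
Proof.
have [/springer_fiberP[_ H] S] := Sz => kj jn.
by have [w [_ _ /(_ j kj jn)[]]] := S_high H kn S.
Qed.

End Sdata.

Section Cdata.
Variables (k : nat) (z : zpt RS).
Hypothesis kn : (k.+1 < n)%N.
Hypothesis Cz : Cset k z.

Lemma Cset_lowE j : (j <= k.+1)%N -> flagE z j = A j.
Proof.
have [/springer_fiberP[_ H] [EA _ _ _ _]] := Cz => jk.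
by apply: (fib_E_le H); [exact: leq_trans jk (ltnW kn)|exact: EA].
Qed.

Lemma Cset_lowF j : (j <= k)%N -> flagF z j = D j.
Proof.
by have [/springer_fiberP[_ H] S] := Cz => /(C_low H kn S)[].
Qed.

Lemma Cset_highE j : (k.+2 < j)%N -> (j <= n)%N -> flagE z j = (A j.-1 + <[b0]>)%VS.
Proof.
move=> kj jn; have [_ E] := fC_Cset kn Cz.
by rewrite -E flagE_point // mkE_high.
Qed.

Lemma Cset_highF j : (k.+1 < j)%N -> (j <= n)%N -> flagF z j = (D j.-1 + <[b1]>)%VS.
Proof.
move=> kj jn; have [_ E] := fC_Cset kn Cz.
by rewrite -E flagF_point // mkF_high.
Qed.

End Cdata.

(** b1 lies in F_(k+2) on [Cset k], whereas F_(k+2) = D_(k+2) on [Cset l]. *)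
Lemma Cset_disjoint k l z : (l.+1 < n)%N -> (k.+1 < l)%N ->
  Cset k z -> Cset l z -> False.
Proof.
move=> ln kl Ck Cl; have kn : (k.+1 < n)%N := ltn_trans kl (ltnW ln).
have k2n : (k.+2 < n)%N := leq_ltn_trans kl (ltnW ln).
have := Cset_highF kn Ck (ltnSn _) (ltnW k2n).
rewrite (Cset_lowF ln Cl) // => E; case/negP: (b1_notin_D k2n).
by rewrite E (subvP (addvSr _ _)) ?memv_line.
Qed.

(** a0 lies in E_(k+2) on [Sset k], whereas E_(k+2) = A_(k+2) on [Sset l]. *)
Lemma Sset_disjoint k l z : (l.+1 < n)%N -> (k.+1 < l)%N ->
  Sset k z -> Sset l z -> False.
Proof.
move=> ln kl Sk Sl; have kn : (k.+1 < n)%N := ltn_trans kl (ltnW ln).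
have := Sset_high kn Sk (ltnSn _) kn; have [-> _] := Sset_low ln Sl kl => E.
case/negP: (a0_notin_A kn); rewrite E.
by rewrite (subvP (addvSr _ _)) ?memv_line.
Qed.

(** E_(l+2) = A_(l+1) + <a0> on the surface. On the curve it contains b0 if k < l, and is A_(l+2) if
    l < k. If k = l, the b0-coefficient of [betav k r] must vanish: on the conic this means r_0 = 0,
    and on the other curves the P_(k+1)-coefficient vanishes too, leaving no r. *)
Lemma CS_meet k l z : (k.+1 < n)%N -> (l.+1 < n)%N -> Cset k z -> Sset l z ->
  [/\ k = l, k.+2 = n & z = gC k <[e2 1]>%VS].
Proof.
move=> kn ln Ck Sl; have El := Sset_high ln Sl (ltnSn _) ln.
have aE : a0 \in flagE z l.+2 by rewrite El (subvP (addvSr _ _)) ?memv_line.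
have b0n j : (j <= n)%N -> b0 \notin (A j + <[a0]>)%VS.
  by move=> jn; rewrite mem_Aa // fb_b0 oner_eq0 andbF.
case: (ltngtP k l) => [kl|lk|kl].
- have := Cset_highE kn Ck (_ : k.+2 < l.+2)%N ln; rewrite El => /(_ kl) E.
  case/negP: (b0n l.+1 (ltnW ln)); rewrite [(A _ + _)%VS]E.
  by rewrite (subvP (addvSr _ _)) ?memv_line.
- case/negP: (a0_notin_A ln); rewrite -(Cset_lowE kn Ck) //.
have [d zE] := fC_Cset kn Ck; have [r r0 yE] := vline_exists d.
rewrite yE in zE; rewrite -kl in El; have := El.
rewrite -zE flagE_point // mkE2 betav_line // => E2.
have bE : betav k r \in (A k.+1 + <[a0]>)%VS.
  by rewrite -E2 (subvP (addvSr _ _)) ?memv_line.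
have fbz : fb (betav k r) = 0.
  by move: bE; rewrite mem_Aa ?(ltnW kn) // => /andP[_ /eqP].
have [nE|kn2] : k.+2 = n \/ (k.+2 < n)%N.
  by move: kn; rewrite leq_eqVlt => /orP[/eqP|]; [left|right].
  split=> //; have [_ _ bfb _] := betav_coord kn r nE.
  move: fbz; rewrite bfb => /eqP; rewrite expf_eq0 /= => /eqP rz.
  rewrite [r]row2E rz scale0r add0r vlineZ //.
  by apply: contraNneq r0 => r1; rewrite [r]row2E rz r1 !scale0r addr0.
have muz : mu k.+1 (betav k r) = 0.
  by apply: (mu_M kn); apply: subvP bE; exact: Aa_sub_M.
move: fbz muz; rewrite /betav kn2 !lformD !lformZ mu_P // (mu_M kn (b0_M _)).
rewrite fb_P // fb_b0 !mulr0 !mulr1 add0r addr0 => rz r1.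
by move: r0; rewrite [r]row2E rz r1 !scale0r addr0 eqxx.
Qed.

(** At r = [e2 1] the conic passes through <a0>, so E_n = A_(n-1) + <a0>. *)
Lemma CS_point k : k.+2 = n -> Cset k (gC k <[e2 1]>%VS) /\ Sset k (gC k <[e2 1]>%VS).
Proof.
move=> nE; have kn : (k.+1 < n)%N by rewrite -nE.
have d1 : \dim <[e2 1]> = 1%N by rewrite dim_vline e2_neq0.
have [Cz _] := gC_line kn d1.
split=> //; split; first by case: Cz.
split=> [j jk|j jk|].
- by rewrite (Cset_lowE kn Cz) // leqW.
- by rewrite (Cset_lowF kn Cz).
rewrite flagE_point // mkE2 betav_line ?e2_neq0 // /betav nE ltnn !e2E //.
rewrite mul0r expr0n /= !scale0r !add0r subv_add addvSl -memvE memvN.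
by rewrite memvZ // (subvP (addvSr _ _)) ?memv_line.
Qed.

(** On the next curve F_(k+1) = D_(k+1), so the parameter on [Cset k] is the class of Q_k;
    conversely E_(k+2) = A_(k+2) at that parameter. *)
Lemma CC_meet k : (k.+2 < n)%N -> Cset k `&` Cset k.+1 = [set gC k <[e2 1]>%VS].
Proof.
move=> kn2; have kn := ltnW kn2; apply/seteqP; split=> [z [Ck Cl]|_ ->].
  have [_ {1}<-] := fC_Cset kn Ck.
  congr (gC k _); rewrite /fC (Cset_lowF kn2 Cl) // DspaceS limgD limg_line.
  have -> : (prC k @: D k = 0)%VS by apply: limg_zero => x; apply: (prC_D (ltnW kn)).
  rewrite add0v pr2E gb_Q // nu_Q //.
  by rewrite scale0r scale1r add0r.
have d1 : \dim <[e2 1]> = 1%N by rewrite dim_vline e2_neq0.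
have [Cz _] := gC_line kn d1.
split=> //; split; first by case: Cz.
set z := gC k _ in Cz *.
have E2 : flagE z k.+2 = A k.+2.
  rewrite flagE_point // mkE2 betav_line ?e2_neq0 // /betav kn2 !e2E //.
  by rewrite scale0r addr0 scale1r -AspaceS.
have F1 : flagF z k.+1 = D k.+1.
  rewrite flagF_point ?(ltnW kn) // mkF1 limg_line iota2E !e2E //.
  by rewrite scale0r add0r scale1r -DspaceS.
have E3 := Cset_highE kn Cz (ltnSn _) kn2.
have F2 := Cset_highF kn Cz (ltnSn _) kn.
split.
- by move=> j; rewrite leq_eqVlt => /orP[/eqP->|jk]; rewrite ?E2 // (Cset_lowE kn Cz).
- by move=> j; rewrite leq_eqVlt => /orP[/eqP->|jk]; rewrite ?F1 // (Cset_lowF kn Cz).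
- split=> [kn3|nE]; first by rewrite E3 /= addvS // Aspace_le.
  (* If the next curve is the conic, its tangency condition holds because E_n = A_(n-1) + <b0> has
     no P_(n-1)- and no a0-coefficient. *)
  move=> w v; rewrite E3 F2 /= mem_Ab ?(ltnW kn2) // => /andP[wM /eqP faw] _.
  by rewrite /tangency (mu_M kn2 wM) faw !mulr0 !mul0r addr0.
- by move=> j kj jn; rewrite (Cset_highE kn Cz) // ltnW.
- by move=> j kj jn; rewrite (Cset_highF kn Cz) // ltnW.
Qed.

Definition fT k (z : zpt RS) : {vspace 'rV[K]_2} := (prT @: flagF z k.+2)%VS.
Definition gT k (y : {vspace 'rV[K]_2}) : zpt RS :=
  flag_point (mkE k <[P k]> <[a0]> <[a0]>) (mkF k <[Q k]> (iotaT @: y)).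

(** One frame, with [iotaT r] as its only varying vector, serves for all r, so a single chart with q
    = 1 is enough. *)
Lemma SS_meet k : (k.+2 < n)%N -> variety_iso (Sset k `&` Sset k.+1) P1.
Proof.
move=> kn2; have kn := ltnW kn2; have kn' := ltnW kn.
have n0 : n = n.-1.+1 by rewrite prednK // (leq_ltn_trans _ kn).
have n1 : (n.-1 < n)%N by rewrite {2}n0.
pose k1 : 'I_n := Ordinal kn.
have h2 : (A k.+1 + <[a0]> = A k + <[P k]> + <[a0]>)%VS by rewrite AspaceS.
have h3 : ((k.+2 < n)%N -> A k.+2 + <[a0]> = A k.+1 + <[a0]> + <[P k.+1]>)%VS.
  by move=> _; rewrite AspaceS -!addvA [(<[P _]> + _)%VS]addvC.
have g2 r : (D k.+1 + iotaT @: <[r]> = D k + <[Q k]> + <[iotaT r]>)%VS.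
  by rewrite limg_line DspaceS.
have iK : cancel iotaT prT.
  by apply: pr2K; rewrite ?gb_b1 ?ga_b1 ?gb_a1 ?ga_a1.
have iN r : iotaT r \in N 0 by rewrite iota2E memvD ?memvZ ?b1_N ?a1_N.
have Fi r : r != 0 -> in_fiber
    (mkE k <[P k]> <[a0]> <[a0]>) (mkF k <[Q k]> (iotaT @: <[r]>)).
  move=> r0; have ir0 : iotaT r != 0.
    by apply: contraNneq r0 => i0; rewrite -(iK r) i0 linear0.
  have usW : us (iotaT r) = r 0 (inord 1) *: a0.
    by rewrite iota2E lfunD !lfunZ (sf_usb1 sf) (sf_usa1 sf) scaler0 add0r.
  apply: (mk_in_fiber kn erefl h2 h3 _ (a0_notin_A (ltnW n1)) (a0_M _)
    phi_a0a0 erefl (g2 r) _ (iN r) ir0).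
  - by rewrite mkE_high.
  - by rewrite mkF_high // limg_line.
  - by rewrite limg_line -memvE; apply: (u_A kn'); apply: memA.
  - by rewrite limg_line (sf_ua0 sf) -memvE mem0v.
  - by rewrite limg_line (sf_ua0 sf) -memvE mem0v.
  - by rewrite limg_line (sf_usQ sf) // addvSr.
  - by rewrite !limg_line usW -memvE memvZ // (subvP (addvSr _ _)) ?memv_line.
  - by move=> _; rewrite !limg_line usW -memvE memvZ // (subvP (addvSr _ _)) ?memv_line.
have jn j : (j <= k.+1)%N -> (j <= n)%N by move=> jk; rewrite (leq_trans jk) // ltnW.
have [] // := @line_isomorphism (Sset k `&` Sset k.+1) (fT k) (gT k) prT k1.
- move=> z [Sk Sl]; have [/springer_fiberP[z1 H] S] := Sk.
  have [_ S'] := Sl; have [d E] := T_struct H kn2 S S'.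
  by split=> //; apply: esym; apply: flag_point_eta.
- move=> y /vline_exists[r r0 ->]; have Fr := springer_fiber_point (Fi _ r0).
  have E1 : flagE (gT k <[r]>%VS) k.+1 = A k.+1 by rewrite flagE_point ?mkE1 ?AspaceS // ltnW.
  have F1 : flagF (gT k <[r]>%VS) k.+1 = D k.+1 by rewrite flagF_point ?mkF1 ?DspaceS // ltnW.
  split; last first.
    rewrite /fT flagF_point // mkF_high //= limgD (limg_cancel _ iK).
    have -> : (prT @: D k.+1 = 0)%VS.
      by apply: limg_zero => v vD; rewrite pr2E (gb_D kn vD) (ga_D kn vD) !scale0r addr0.
    by rewrite add0v.
  split; split=> //; split.
  + by move=> j jk; rewrite flagE_point ?mkE_low ?jn // leqW.
  + by move=> j jk; rewrite flagF_point ?mkF_low ?jn // leqW.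
  + by rewrite flagE_point // mkE2.
  + move=> j; rewrite leq_eqVlt => /orP[/eqP->|jk]; rewrite ?E1 //.
    by rewrite flagE_point ?mkE_low ?jn // leqW.
  + move=> j; rewrite leq_eqVlt => /orP[/eqP->|jk]; rewrite ?F1 //.
    by rewrite flagF_point ?mkF_low ?jn // leqW.
  + by rewrite flagE_point // mkE_high.
- move=> w fw [Sk Sl]; rewrite /fT (flagF_zcls w k1) limgD limg_line.
  have [_ ->] := Sset_low kn2 Sl (leqnn _).
  have -> : (prT @: D k.+1 = 0)%VS.
    by apply: limg_zero => v vD; rewrite pr2E (gb_D kn vD) (ga_D kn vD) !scale0r addr0.
  by rewrite add0v.
move=> r0 _; have pid := @polymap_id K 'rV[K]_2.
exists (fun=> 1), (fun r : 'rV[K]_2 => rmap k (P k) a0 (P k.+1) (Q k) (iotaT r)); split.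
- exact: polyfun_const.
- exact: oner_neq0.
- by apply: polymap_rmap; try exact: polymap_const; exact: polymap_hom.
by move=> r rn _; exact: (rmap_frame kn erefl h2 h3 erefl (g2 r) (Fi r rn)).
Qed.

(** * The irreducible components of the fiber and the final statement *)

Definition component (b : bool) k : set (zpt RS) := if b then Sset k else Cset k.

(** Gives maximality and distinctness at once. The witnesses have all coordinates 1: the point (1,
    1, 1) of the plane with its lines to both centres, or the point (1, 1) of the line. *)
Lemma generic_point b k : (k.+1 < n)%N -> exists2 z, component b k z &
  forall b' l, (l.+1 < n)%N -> component b' l z -> b' = b /\ l = k.
Proof.
move=> kn; have kn' := ltnW kn; case: b.
  pose x := e3 0 + e3 1 + e3 2.
  have x0 : x 0 (inord 0) = 1 by rewrite !mxE -!val_eqE /= !inordK //= !addr0.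
  have x1 : x 0 (inord 1) = 1 by rewrite !mxE -!val_eqE /= !inordK //= add0r addr0.
  have x2 : x 0 (inord 2) = 1 by rewrite !mxE -!val_eqE /= !inordK //= !add0r.
  have xn i : (i < 3)%N -> x \notin <[e3 i]>%VS.
    move=> i3; apply/negP => /vlineP[c xE].
    have [j [j3 ji xj]] : exists j, [/\ (j < 3)%N, j != i & x 0 (inord j) = 1].
      by case: i i3 {xE} => [|[|[|]]] // _; [exists 1%N|exists 0%N|exists 0%N].
    by move: xj; rewrite xE mxE e3E // (negPf ji) mulr0 => /eqP; rewrite eq_sym oner_eq0.
  have inc : @incidence K (<[x]>, (<[e3 0]> + <[x]>, <[e3 1]> + <[x]>))%VS.
    split; split=> /=; rewrite ?addvSr ?dim_two_lines ?e3_neq0 ?xn //.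
    - by rewrite dim_vline; case: eqP x0 => // ->; rewrite mxE => /eqP; rewrite eq_sym oner_eq0.
    - by rewrite (subvP (addvSl _ _)) ?memv_line.
    - by rewrite (subvP (addvSl _ _)) ?memv_line.
  have [Sz _] := gS_incidence kn inc; set z := gS k _ in Sz.
  exists z => //.
  (* v lies in E_(k+1). Its a0-coefficient excludes the surfaces with l > k and the curve with l =
     k, its P_k-coefficient the surface with l + 1 = k. *)
  pose v := iota0 k x.
  have vE : v \in flagE z k.+1.
    rewrite flagE_point ?(ltnW kn) // mkE1 (subvP (addvSr _ _)) // memv_img //=.
    by rewrite (subvP (addvSr _ _)) ?memv_line.
  have fav : fa v = 1.
    by rewrite /v iota0E x1 x2 !scale1r lformD fa_P // fa_a0 add0r.
  have muv : mu k v = 1.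
    rewrite /v iota0E x1 x2 !scale1r lformD mu_P // (mu_M kn') ?addr0 //.
    exact: a0_M.
  have nA j : (j <= n)%N -> v \notin A j.
    by move=> jn; apply/negP => /(fa_A jn); rewrite fav => /eqP; rewrite oner_eq0.
  move=> b' l ln; case: b' => /= Hl.
    split=> //; case: (ltngtP l k) => // [lk|kl].
      move: lk; rewrite leq_eqVlt => /orP[/eqP lk|lk].
        have vM : v \in M k.
          by move: vE; rewrite -lk (Sset_high ln Hl) //= => /(subvP (Aa_sub_M _)).
        by have /eqP := mu_M kn' vM; rewrite muv oner_eq0.
      by case: (Sset_disjoint kn lk Hl Sz).
    by have := nA _ (ltnW kn); have [<- _] := Sset_low ln Hl kl; rewrite vE.
  have [lk _ _] := CS_meet ln kn Hl Sz.
  by have := nA _ (ltnW kn); rewrite -lk -(Cset_lowE ln Hl) // lk vE.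
pose r := e2 0 + e2 1.
have r0 : r 0 (inord 0) = 1 by rewrite mxE !e2E //= addr0.
have r1 : r 0 (inord 1) = 1 by rewrite mxE !e2E //= add0r.
have rn : r != 0 by apply: contra_eq_neq r0 => ->; rewrite mxE eq_sym oner_eq0.
have dr : \dim <[r]> = 1%N by rewrite dim_vline rn.
have [Cz fz] := gC_line kn dr; set z := gC k _ in Cz fz.
(* v lies in F_(k+1). Its b1-coefficient excludes the curves with l > k, its Q_k-coefficient those
   with l < k; a surface would require the parameter [e2 1]. *)
exists z => //; pose v := iotaC k r.
have vF : v \in flagF z k.+1.
  rewrite flagF_point ?(ltnW kn) // mkF1 (subvP (addvSr _ _)) // memv_img //.
  exact: memv_line.
have gbv : gb v = 1.
  by rewrite /v iota2E r0 r1 !scale1r lformD gb_Q // gb_b1 addr0.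
have nuv : nu k v = 1.
  rewrite /v iota2E r0 r1 !scale1r lformD nu_Q // (nu_N kn') ?add0r //.
  exact: b1_N.
move=> [] l ln /= Hl.
  have [_ _ zE] := CS_meet kn ln Cz Hl.
  have d1 : \dim <[e2 1]> = 1%N by rewrite dim_vline e2_neq0.
  have [_] := gC_line kn d1; rewrite -zE fz => rE.
  have : r \in <[e2 1]>%VS by rewrite -rE memv_line.
  move=> /vlineP[c rcE]; move: r0; rewrite rcE mxE e2E // mulr0 => /eqP.
  by rewrite eq_sym oner_eq0.
split=> //; case: (ltngtP l k) => // [lk|kl].
  move: vF; rewrite (Cset_highF ln Hl) ?(ltnW kn) // => vD.
  have /(nu_N kn')/eqP : v \in N k by apply: subvP vD; rewrite addvS ?addvSl.
  by rewrite nuv oner_eq0.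
move: vF; rewrite (Cset_lowF ln Hl kl) => /(gb_D kn)/eqP.
by rewrite gbv oner_eq0.
Qed.

Local Notation fiber := (springer_fiber (n := n) phi psi X).

Hypothesis n1 : (1 < n)%N.

Lemma component_fiber b k z : component b k z -> fiber z.
Proof. by case: b => -[]. Qed.

Lemma fiber_component z : fiber z -> exists b k, (k.+1 < n)%N /\ component b k z.
Proof.
move=> Fz; have [_ H] := (springer_fiberP z).1 Fz.
have [k [kn [S|C]]] := fiber_decomposition H n1.
  by exists true, k.
by exists false, k.
Qed.

Lemma component_irreducible b k : (k.+1 < n)%N -> irreducible (component b k).
Proof.
move=> kn; case: b; first exact: (Sset_irreducible kn).
by have [] := Cset_geometry kn.
Qed.

(** An irreducible Z' in the fiber lies in a single set of a finite closed cover, hence in one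
    component; the generic point, which it contains, shows which one. *)
Lemma component_maximal b k : (k.+1 < n)%N ->
  irreducible_component fiber (component b k).
Proof.
move=> kn; split; first by move=> z; exact: component_fiber.
  exact: component_irreducible.
move=> Z' irr sub Zf.
(* The cover keeps only the closed conditions; within the fiber, where Z' lies, they define the
   components. *)
pose cond (p : bool * nat) : set (zpt RS) := [set z |
  if p.1 then cond_S p.2 (flagE z) (flagF z)
  else cond_C p.2 (flagE z) (flagF z)].
pose r := [seq (c, l) | c <- [:: true; false], l <- iota 0 n.-1].
have rP c l : ((c, l) \in r) = (l.+1 < n)%N.
  apply/allpairsP/idP => [[[c' l'] /= [_ + [_ ->]]]|ln].
    by rewrite mem_iota add0n => /andP[_]; clear -n1; lia.
  exists (c, l); split=> //=; first by case: c.
  by rewrite mem_iota add0n; clear -n1 ln; lia.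
have [[c l]||[c l]] := irreducible_cover (r := r) (Z := cond) irr.
- rewrite rP => ln; rewrite /cond /=; case: c; first exact: zclosed_cond_S.
  exact: zclosed_cond_C.
- move=> z /Zf/fiber_component[c [l [ln H]]]; exists (c, l); first by rewrite rP.
  by case: c H => -[].
rewrite rP => ln Zc.
have Zcl : Z' `<=` component c l.
  by move=> z Zz; have := Zc _ Zz; have := Zf _ Zz; case: c Zc.
have [z zk gen] := generic_point b kn.
have [cb lk] := gen c l ln (Zcl _ (sub _ zk)); subst c l.
by apply/seteqP; split.
Qed.

Lemma component_inj b k b' k' : (k.+1 < n)%N -> (k'.+1 < n)%N ->
  component b k = component b' k' -> b = b' /\ k = k'.
Proof.
move=> kn kn' E; have [z zk gen] := generic_point b kn.
by rewrite E in zk; have [] := gen _ _ kn' zk.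
Qed.

Lemma standard_fiber_geometry :
  exists C S : nat -> set (zpt RS),
    [/\ fiber =
          (\bigcup_(i in [set i | (1 <= i <= n - 1)%N]) C i) `|`
          (\bigcup_(i in [set i | (1 <= i <= n - 1)%N]) S i),
        (forall i, (1 <= i <= n - 1)%N ->
          irreducible_component fiber (C i) /\
          irreducible_component fiber (S i)) &
        (forall i j, (1 <= i <= n - 1)%N -> (1 <= j <= n - 1)%N ->
          [/\ C i = C j -> i = j, S i = S j -> i = j & C i <> S j])]
    /\
    [/\ forall i, (1 <= i <= n - 1)%N ->
          variety_iso (C i) P1,
        forall i, (1 <= i <= n - 1)%N ->
          exists p q, [/\ @zpoints _ (projective_space K 2) p,
            @zpoints _ (projective_space K 2) q, p <> q &
            variety_iso (S i) (blowup2 p q)],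
        chain (n - 1) (fun Z => exists x, Z = [set x]) C,
        chain (n - 1) (fun Z => variety_iso Z P1) S &
        exists2 x, (C (n - 1)%N `&` S (n - 1)%N) x &
          (\bigcup_(i in [set i | (1 <= i <= n - 1)%N]) C i) `&`
          (\bigcup_(i in [set i | (1 <= i <= n - 1)%N]) S i) = [set x]].
Proof.
have rng i : (1 <= i <= n - 1)%N -> i = i.-1.+1 /\ (i.-1.+1 < n)%N.
  by move=> H; split; clear -H n1; lia.
have rng' k : (k.+1 < n)%N -> (1 <= k.+1 <= n - 1)%N by clear -n1; lia.
exists (fun i => component false i.-1), (fun i => component true i.-1).
split; split.
- apply/seteqP; split=> [z /fiber_component[[] [k [kn H]]]|z [] [i _]].
  + by right; exists k.+1 => //; exact: rng'.
  + by left; exists k.+1 => //; exact: rng'.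
  + exact: component_fiber.
  + exact: component_fiber.
- by move=> i /rng[_ H]; split; apply: component_maximal.
- move=> i j /rng[iE iH] /rng[jE jH]; split.
  + by move=> /(component_inj iH jH)[_ E]; rewrite iE jE E.
  + by move=> /(component_inj iH jH)[_ E]; rewrite iE jE E.
  + by move=> /(component_inj iH jH)[].
- by move=> i /rng[_ H]; have [] := Cset_geometry H.
- move=> i /rng[_ H]; exists <[e3 0]>%VS, <[e3 1]>%VS; split.
  + by apply/zpoints_grassmannian; rewrite dim_vline e3_neq0.
  + by apply/zpoints_grassmannian; rewrite dim_vline e3_neq0.
  + move=> E; have : e3 0 \in <[e3 1]>%VS by rewrite -E memv_line.
    by move=> /(@e3_line_coef _ 1 0 _ isT isT isT)/eqP; rewrite e3E // oner_eq0.
  + exact: (Sset_iso H).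
- move=> i j i1 ij jn; have [iE iH] : i = i.-1.+1 /\ (i.-1.+1 < n)%N by clear -i1 ij jn n1; lia.
  have jH : (j.-1.+1 < n)%N by clear -i1 ij jn n1; lia.
  case: eqP => [jE|ne].
    have jE' : j.-1 = i.-1.+1 by rewrite jE.
    by rewrite jE' in jH *; have -> := CC_meet jH; exists (gC i.-1 <[e2 1]>%VS).
  apply/seteqP; split=> // z [Ci Cj]; apply: (Cset_disjoint jH _ Ci Cj).
  by clear -i1 ij ne; lia.
- move=> i j i1 ij jn; have jH : (j.-1.+1 < n)%N by clear -i1 ij jn n1; lia.
  case: eqP => [jE|ne].
    have jE' : j.-1 = i.-1.+1 by rewrite jE; clear -i1; lia.
    by rewrite jE' in jH *; apply: (SS_meet jH).
  apply/seteqP; split=> // z [Ci Cj]; apply: (Sset_disjoint jH _ Ci Cj).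
  by clear -i1 ij ne; lia.
have nE : n.-2.+2 = n by clear -n1; lia.
have nE' : (n - 1).-1 = n.-2 by clear -n1; lia.
have [Cx Sx] := CS_point nE.
eexists; first by rewrite nE'; split; [exact: Cx|exact: Sx].
apply/seteqP; split=> [z [[i /rng[iE iH] Ci] [j /rng[jE jH] Sj]]|_ ->].
  have [_ E ->] := CS_meet iH jH Ci Sj.
  by congr (gC _ _); move: E nE; clear; lia.
by split; exists (n - 1)%N; rewrite ?nE' //=; clear -n1; lia.
Qed.

End StandardForm.

(** * Existence of a standard form *)

Section NormalForm.
Variables (K : fieldType) (n : nat) (V0 V1 : vectType K).
Variables (phi : 'Hom(V0, dualv V0)) (psi : 'Hom(V1, dualv V1)).
Hypothesis charK : [pchar K] =i pred0.
Hypothesis n1 : (1 < n)%N.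
Hypothesis sym : bilin_symmetric phi.
Hypothesis ndeg0 : bilin_nondegenerate phi.
Hypothesis alt : bilin_alternating psi.
Hypothesis ndeg1 : bilin_nondegenerate psi.

Section Operator.
Variable u : 'Hom(V0, V1).
Local Notation us := (adjoint_lfun phi psi u).
Local Notation X := (odd_end phi psi u).

Let adj v x : phi (us v) x = psi v (u x).
Proof. exact: adjoint_lfunP. Qed.

Let anti x y : psi x y = - psi y x.
Proof.
apply/eqP; rewrite -addr_eq0; have := alt (x + y).
by rewrite bilin_addl !bilin_addr !alt add0r addr0 => /eqP.
Qed.

(** [T0] and [T1] are the restrictions of X^2 to V0 and V1. *)
Definition T0 (x : V0) : V0 := us (u x).
Definition T1 (v : V1) : V1 := u (us v).

Lemma endX_even j (x : V0) (v : V1) :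
  endX X (2 * j) ((x, v) : supV V0 V1) = (iter j T0 x, iter j T1 v).
Proof.
elim: j => [|j IH]; first by rewrite muln0 /= id_lfunE.
by rewrite mulnS /= !comp_lfunE -/(endX X (2 * j)) IH !odd_endE.
Qed.

(** Moving [us] and then [u] across the forms returns [us] after [u], with one sign from psi being
    alternating. *)
Lemma T0_skew j x y : phi (iter j T0 x) y = (-1) ^+ j * phi x (iter j T0 y).
Proof.
elim: j x y => [|j IH] x y; first by rewrite expr0 mul1r.
rewrite iterS {1}/T0 adj anti -adj -/(T0 y) sym IH iterSr exprS.
by rewrite mulN1r mulNr.
Qed.

Lemma iter_T0_linear j : linear (iter j T0).
Proof.
by elim: j => // j IH a x y; rewrite !iterS IH /T0 !linearP.
Qed.

Lemma iter_T0_0 j : iter j T0 0 = 0.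
Proof. by elim: j => // j IH; rewrite iterS IH /T0 !linear0. Qed.

Definition kerim k e : {vspace supV V0 V1} := (lker X :&: limg (endX X k.-1) :&: Vpart V0 V1 e)%VS.

Lemma kerimF k x : (x, 0) \in kerim k false = (u x == 0) && ((x, 0) \in limg (endX X k.-1)).
Proof.
rewrite !memv_cap memVpart eqxx andbT memv_ker odd_endE /= linear0.
by congr (_ && _); apply/eqP/eqP => [[]//|->].
Qed.

Lemma kerimT k v : (0, v) \in kerim k true = (us v == 0) && ((0, v) \in limg (endX X k.-1)).
Proof.
rewrite !memv_cap memVpart eqxx andbT memv_ker odd_endE /= linear0.
by congr (_ && _); apply/eqP/eqP => [[]//|->].
Qed.

Lemma limg_endX1 (w : supV V0 V1) :
  w \in limg (endX X 1) -> exists x v, w = (us v, u x).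
Proof.
by case/memv_imgP => -[x v] _ ->; exists x, v; rewrite /endX /= comp_lfun1r odd_endE.
Qed.

Lemma limg_even j x : (iter j T0 x, 0) \in limg (endX X (2 * j)).
Proof.
apply/memv_imgP; exists (x, 0); rewrite ?memvf // endX_even; congr (_, _).
by elim: j => // j IH; rewrite iterS -IH /T1 !linear0.
Qed.

Lemma limg_even1 j v : (0, iter j T1 v) \in limg (endX X (2 * j)).
Proof.
by apply/memv_imgP; exists (0, v); rewrite ?memvf // endX_even iter_T0_0.
Qed.

Hypothesis nil : exists k, endX X k = 0.
Hypothesis diag : has_diagram X [:: (false, 4 * n - 3); (false, 2); (true, 2)]%N.

Lemma dim_kerim k : (1 <= k)%N ->
  \dim (kerim k false) = ((k <= 4 * n - 3) + (k <= 2))%N /\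
  \dim (kerim k true) = (k <= 2)%N.
Proof. by move=> k1; rewrite /kerim -!(diag _ k1) /= !add0n !addn0. Qed.

Lemma kerim_eq0 k e w : \dim (kerim k e) = 0%N -> w \in kerim k e -> w = 0.
Proof. by move/eqP; rewrite dimv_eq0 => /eqP->; rewrite memv0 => /eqP. Qed.

(** T1 v lies in ker X, Im X^2 and V1, and no line of parity 1 has length 3 or more. *)
Lemma kerus_T1 v : us (T1 v) = 0 -> T1 v = 0.
Proof.
move=> H; have [_ d] := dim_kerim (isT : (1 <= 3)%N).
suff /(kerim_eq0 d)[] : (0, T1 v) \in kerim 3 true by [].
by rewrite kerimT H eqxx /=; exact: (limg_even1 1).
Qed.

(** Otherwise the last nonzero iterate on x, of exponent at least 2n - 1, would be a nonzero vector
    of ker X and Im X^(4n-2), although no line is longer than 4n - 3. *)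
Lemma T0_nilpotent x : iter (2 * n - 1) T0 x = 0.
Proof.
have [k Xk] := nil.
have T0k : iter k T0 x = 0.
  have Xmk m : endX X (m + k) = 0.
    by elim: m => // m IH; rewrite addSn /endX iterS -/(endX X (m + k)) IH comp_lfun0r.
  have : endX X (2 * k) (x, 0) = 0 by rewrite mul2n -addnn Xmk zero_lfunE.
  rewrite endX_even => -[T _]; exact: T.
apply/eqP/negPn/negP => ne.
have [m [mn mne mS]] : exists m, [/\ (2 * n - 1 <= m)%N, iter m T0 x != 0 & iter m.+1 T0 x = 0].
  have ex : exists m, (2 * n - 1 <= m)%N && (iter m T0 x != 0).
    by exists (2 * n - 1)%N; rewrite leqnn.
  have bd m : (2 * n - 1 <= m)%N && (iter m T0 x != 0) -> (m <= k)%N.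
    move=> /andP[_]; apply: contraNleq => km.
    by rewrite -(subnK (ltnW km)) iterD T0k iter_T0_0.
  have [m /andP[mn mne] mmax] := ex_maxnP ex bd.
  exists m; split=> //; apply/eqP/negPn/negP => mS.
  by have := mmax m.+1; rewrite mS (leq_trans mn) //= ltnn => /(_ isT).
have mE : m = (2 * n - 1 + (m - (2 * n - 1)))%N by rewrite subnKC.
have m0 : m = m.-1.+1 by clear -mn n1; lia.
have uz : u (iter m T0 x) = 0.
  rewrite m0 iterS -[u (T0 _)]/(T1 (u _)); apply: kerus_T1.
  by rewrite -[us (T1 _)]/(T0 (T0 _)) -!iterS -m0.
have [d _] := dim_kerim (isT : (1 <= (2 * (2 * n - 1)).+1)%N).
have {}d : \dim (kerim (2 * (2 * n - 1)).+1 false) = 0%N by rewrite d; clear -n1; lia.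
suff /(kerim_eq0 d)[/eqP] : (iter m T0 x, 0) \in kerim (2 * (2 * n - 1)).+1 false.
  by rewrite (negPf mne).
by rewrite kerimF uz eqxx /= mE iterD; exact: limg_even.
Qed.

(** 4n - 3 = 2(2n - 2) + 1, so T0^(2n-2) is nonzero. An even power of a skew map is self-adjoint,
    and by polarisation its quadratic form takes a nonzero value. *)
Lemma generator : exists t, phi (iter (2 * n - 2) T0 t) t != 0.
Proof.
have [d _] := dim_kerim (isT : (1 <= (2 * (2 * n - 2)).+1)%N).
have {}d : \dim (kerim (2 * (2 * n - 2)).+1 false) = 1%N by rewrite d; clear -n1; lia.
have [w w0 E] := vline_exists d.
have : w \in kerim (2 * (2 * n - 2)).+1 false by rewrite E memv_line.
rewrite !memv_cap memVpart => /andP[/andP[_ /memv_imgP[[z v] _ wE]] w2].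
rewrite endX_even in wE; rewrite wE /= in w0 w2.
have z0 : iter (2 * n - 2) T0 z != 0.
  by apply: contra w0 => /eqP->; rewrite (eqP w2).
have [y py] : exists y, phi (iter (2 * n - 2) T0 z) y != 0.
  apply: contrapT => H; case/negP: z0; rewrite -memv0 -(ndeg0 : lker phi = _) memv_ker.
  apply/eqP/lfunP => y; rewrite zero_lfunE; apply/eqP/negPn/negP => ne.
  by apply: H; exists y.
apply: contrapT => H; case/negP: py.
have s0 a : phi (iter (2 * n - 2) T0 a) a = 0.
  by apply/eqP/negPn/negP => ne; apply: H; exists a.
have sign : (-1) ^+ (2 * n - 2) = 1 :> K.
  by rewrite (_ : 2 * n - 2 = 2 * (n - 1))%N ?exprM ?sqrrN ?expr1n //; clear; lia.
have := s0 (z + y); rewrite -[z]scale1r iter_T0_linear !scale1r.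
rewrite bilin_addl !bilin_addr !s0 add0r addr0 (T0_skew _ y) sign mul1r [phi y _]sym.
rewrite -mulr2n -mulr_natl => /eqP.
by rewrite mulf_eq0 (negPf (two_neq0 charK)).
Qed.

Lemma standard_basis : exists P Q a0 b0 a1 b1,
  standard_form n phi psi u us P Q a0 b0 a1 b1.
Proof.
have [t tt] := generator.
(* t generates the long line, with P_0 = T0^(2n-2) t at its end; P_(n-1) is the middle box, and its
   self-pairing is phi(T0^(2n-2) t, t) up to sign. *)
pose P j := iter (2 * n - 2 - j) T0 t; pose Q j := u (P j.+1).
have P0 : P 0%N != 0.
  by apply: contra_neq tt => P0; rewrite -[(2 * n - 2)%N]subn0 -/(P 0%N) P0 bilin_zerol.
have usQ j : (j.+1 < n)%N -> us (Q j) = P j.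
  move=> jn; rewrite /Q /P -[us (u _)]/(T0 _) -iterS.
  by rewrite (_ : (2 * n - 2 - j.+1).+1 = 2 * n - 2 - j)%N //; clear -jn; lia.
have uP0 : u (P 0%N) = 0.
  rewrite /P subn0 (_ : 2 * n - 2 = (2 * n - 3).+1)%N; last by clear -n1; lia.
  rewrite iterS -[u (T0 _)]/(T1 (u _)); apply: kerus_T1.
  rewrite -[us (T1 _)]/(T0 (T0 _)) -!iterS.
  by rewrite (_ : (2 * n - 3).+2 = 2 * n - 1)%N ?T0_nilpotent //; clear -n1; lia.
have [d1F d1T] := dim_kerim (isT : (1 <= 1)%N).
have [d2F d2T] := dim_kerim (isT : (1 <= 2)%N).
have n3 : (2 <= 4 * n - 3)%N by clear -n1; lia.
rewrite (leq_trans _ n3) //= in d1F; rewrite n3 /= in d2F; rewrite /= in d1T d2T.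
(* All lines have length at least 2, so the kernel of X lies in its image; this provides a1 above a0
   and b0 above b1. *)
have le21 e : (kerim 2 e <= kerim 1 e)%VS.
  by rewrite /kerim !capvS //= lim1g subvf.
have k12F : kerim 1 false = kerim 2 false by apply: subv_dim_eq; rewrite ?d1F ?d2F.
have k12T : kerim 1 true = kerim 2 true by apply: subv_dim_eq; rewrite ?d1T ?d2T.
have mem1F x : u x = 0 -> ((x, 0) : supV V0 V1) \in kerim 2 false.
  by move=> ux; rewrite -k12F kerimF ux eqxx /= lim1g memvf.
have mem1T v : us v = 0 -> ((0, v) : supV V0 V1) \in kerim 2 true.
  by move=> uv; rewrite -k12T kerimT uv eqxx /= lim1g memvf.
have pair0 : ((P 0%N, 0) : supV V0 V1) != 0.
  by apply: contra_neq P0 => -[].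
have [||[a0 c0] [aM _ kE]] := @addv_line_exists _ _ <[(P 0%N, 0) : supV V0 V1]> (kerim 2 false).
- by rewrite -memvE mem1F.
- by rewrite d2F dim_vline pair0.
have c00 : c0 = 0 by move: aM; rewrite !memv_cap memVpart => /andP[_ /eqP].
subst c0; have := aM; rewrite kerimF => /andP[/eqP ua0 /limg_endX1[_ [a1 [a0E _]]]].
have keru x : u x = 0 -> x \in (<[P 0%N]> + <[a0]>)%VS.
  move=> /mem1F; rewrite kE => /memv_addP[_ /vlineP[c ->] [_ /vlineP[d ->] [-> _]]].
  by apply: memv_add; apply/memvZ/memv_line.
have [[c0 b1] nb kTE] := vline_exists d2T.
have c00 : c0 = 0.
  have : (c0, b1) \in kerim 2 true by rewrite kTE memv_line.
  by rewrite !memv_cap memVpart => /andP[_ /eqP].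
subst c0.
have b1n : b1 != 0 by apply: contra_neq nb => ->.
have b1M : (0, b1) \in kerim 2 true by rewrite kTE memv_line.
have := b1M; rewrite kerimT => /andP[/eqP usb1 /limg_endX1[b0 [_ [_ b1E]]]].
have kerus v : us v = 0 -> v \in <[b1]>%VS.
  by move=> /mem1T; rewrite kTE => /vlineP[c [_ ->]]; apply/memvZ/memv_line.
have aim v : phi a0 (us v) = 0 by rewrite sym adj ua0 linear0.
have bim x : phi b0 (us (u x)) = 0.
  by rewrite sym adj -b1E anti -adj usb1 bilin_zerol oppr0.
have PT j : (j < n)%N -> P j = us (u (iter (2 * n - 3 - j) T0 t)).
  move=> jn; rewrite -[us (u _)]/(T0 _) -iterS /P.
  by rewrite (_ : (2 * n - 3 - j).+1 = 2 * n - 2 - j)%N //; clear -jn n1; lia.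
have aP j : (j < n)%N -> phi a0 (P j) = 0 by move=> /PT->; exact: aim.
have bP j : (j < n)%N -> phi b0 (P j) = 0 by move=> /PT->; exact: bim.
have aa : phi a0 a0 = 0 by rewrite {2}a0E aim.
(* Otherwise b0 would be orthogonal to ker u = <P_0, a0>, which is the orthogonal of Im us; then b0
   would lie in Im us, and [kerus_T1] would give b1 = 0. *)
have ab : phi a0 b0 != 0.
  apply/eqP => ab0; have b0n : b0 \notin limg us.
    apply/negP => /memv_imgP[c _ b0E]; case/eqP: b1n; rewrite b1E b0E.
    by apply: kerus_T1; rewrite /T1 -b0E -b1E.
  have [s1 s0] := sep_formP b0n.
  have : sep_form (limg us) b0 \in limg phi.
    suff -> : limg phi = fullv by rewrite memvf.
    apply/eqP; rewrite eqEdim subvf dim_dualv limg_dim_eq ?leqnn //.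
    by rewrite (ndeg0 : lker phi = 0%VS) capv0.
  case/memv_imgP => y _ yE.
  have uy : u y = 0.
    apply/eqP; rewrite -memv0 -(ndeg1 : lker psi = _) memv_ker; apply/eqP/lfunP => v.
    by rewrite zero_lfunE anti -adj sym -yE s0 ?oppr0 ?memv_img ?memvf.
  have := keru _ uy => /memv_addP[_ /vlineP[c ->] [_ /vlineP[d ->] yE2]].
  move: s1; rewrite yE yE2 bilin_addl !bilin_scalel ab0 [phi (P _) _]sym bP 1?ltnW //.
  by rewrite !mulr0 addr0 => /eqP; rewrite eq_sym oner_eq0.
(* Rescaling a0 and a1 makes the pairing with b0 equal to 1; subtracting a multiple of a0, which u
   kills, makes b0 isotropic and keeps u b0 = b1. *)
pose c : K := (phi a0 b0 : K)^-1; have cn : c != 0 by rewrite invr_eq0.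
pose a0' := c *: a0; pose b0' := b0 - ((phi b0 b0 : K) / 2%:R) *: a0'.
have ab' : phi a0' b0 = 1 by rewrite bilin_scalel mulVf.
have aa' : phi a0' a0' = 0 by rewrite bilin_scalel bilin_scaler aa !mulr0.
exists P, Q, a0', b0', (c *: a1), b1; split=> //.
- by rewrite lfunZ ua0 scaler0.
- by rewrite lfunB !lfunZ ua0 !scaler0 subr0.
- by rewrite lfunZ -a0E.
- move=> x /keru; rewrite (_ : <[a0']> = <[a0]>)%VS //.
  apply/eqP; rewrite eqEsubv -!memvE memvZ ?memv_line //=.
  by rewrite -{1}(scalerK cn a0) memvZ ?memv_line.
(* For j + k < 2n - 2 the total exponent of T0 is at least 2n - 1, where T0 vanishes. *)
- move=> j k jn kn jk; rewrite T0_skew -iterD.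
  rewrite (_ : 2 * n - 2 - j + (2 * n - 2 - k) = (2 * n - 3 - j - k) + (2 * n - 1))%N.
    by rewrite iterD T0_nilpotent iter_T0_0 linear0 mulr0.
  by clear -jn kn jk n1; lia.
- rewrite T0_skew -iterD mulf_neq0 ?signr_eq0 // sym.
  by rewrite (_ : 2 * n - 2 - n.-1 + (2 * n - 2 - n.-1) = 2 * n - 2)%N //; clear -n1; lia.
- by move=> j jn; rewrite bilin_scalel aP ?mulr0.
- move=> j jn; rewrite /b0' -scaleNr bilin_addl bilin_scalel bP // add0r.
  by rewrite bilin_scalel aP // !mulr0.
- by rewrite /b0' -scaleNr bilin_addr bilin_scaler ab' aa' mulr0 addr0.
rewrite /b0' -scaleNr; clearbody a0'.
rewrite !(bilin_addl, bilin_addr, bilin_scalel, bilin_scaler).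
by rewrite aa' [phi b0 a0']sym ab'; field; exact: two_neq0.
Qed.

End Operator.
End NormalForm.

(** * The theorem *)

From mathcomp Require Import reals complex.
Local Open Scope complex_scope.
Local Open Scope classical_set_scope.

Theorem proposition3p3 (R : realType) (n : nat) (V0 V1 : vectType R[i])
    (phi : 'Hom(V0, dualv V0))
    (psi : 'Hom(V1, dualv V1)) (X : 'End(supV V0 V1)) :
  (2 <= n)%N ->
  \dim {:V0} = (2 * n + 1)%N -> \dim {:V1} = (2 * n)%N ->
  bilin_symmetric phi -> bilin_nondegenerate phi ->
  bilin_alternating psi -> bilin_nondegenerate psi ->
  orbit3 n phi psi X ->
  exists C S : nat -> set (zpt (resolution_space V0 V1 n)),
    [/\ springer_fiber phi psi X =
          (\bigcup_(i in [set i | (1 <= i <= n - 1)%N]) C i) `|`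
          (\bigcup_(i in [set i | (1 <= i <= n - 1)%N]) S i),
        (forall i, (1 <= i <= n - 1)%N ->
          irreducible_component (springer_fiber phi psi X) (C i) /\
          irreducible_component (springer_fiber phi psi X) (S i)) &
        (forall i j, (1 <= i <= n - 1)%N -> (1 <= j <= n - 1)%N ->
          [/\ C i = C j -> i = j, S i = S j -> i = j & C i <> S j])]
    /\
    [/\ forall i, (1 <= i <= n - 1)%N ->
          variety_iso (C i) (@zpoints _ (projective_space R[i] 1)),
        forall i, (1 <= i <= n - 1)%N ->
          exists p q, [/\ @zpoints _ (projective_space R[i] 2) p,
            @zpoints _ (projective_space R[i] 2) q, p <> q &
            variety_iso (S i) (blowup2 p q)],
        chain (n - 1) (fun Z => exists x, Z = [set x]) C,
        chain (n - 1) (fun Z =>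
          variety_iso Z (@zpoints _ (projective_space R[i] 1))) S &
        exists2 x, (C (n - 1)%N `&` S (n - 1)%N) x &
          (\bigcup_(i in [set i | (1 <= i <= n - 1)%N]) C i) `&`
          (\bigcup_(i in [set i | (1 <= i <= n - 1)%N]) S i) = [set x]].
Proof.
move=> n2 _ _ sym nd0 alt nd1 [[[u ->] nilX] diag].
have charK : [pchar R[i]] =i pred0 by exact: Num.Theory.pchar_num.
have [P [Q [a0 [b0 [a1 [b1 sf]]]]]] := standard_basis charK n2 sym nd0 alt nd1 nilX diag.
exact: standard_fiber_geometry sf charK erefl n2.
Qed.
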